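(* Let $X$ be the Möbius–Kantor graph, i.e. the generalized Petersen graph $\mathrm{GP}(8,3)$. For a prime $p$, let $n_p$ denote the number of pairwise nonisomorphic (that is, the number of isomorphism classes of) minimal semisymmetric $p$-elementary abelian regular covering projections $\wp\colon\tilde X\to X$ with $\tilde X$ connected. Then: (1) $n_2=0$; (2) $n_p=(p-1)/4$ if $p\equiv 5,9,13,17,21 \pmod{24}$; (3) $n_p=1+(p-1)/4$ if $p\equiv 1\pmod{24}$; (4) $n_p=(p+1)/4$ if $p\equiv 3,7,11,15,23\pmod{24}$; (5) $n_p=1+(p+1)/4$ if $p\equiv 19\pmod{24}$.
   Context: **Graphs.** Graphs are finite and simple; an arc is an ordered pair of adjacent vertices; a morphism is an adjacency-preserving map on vertices. $\mathrm{Aut}\,X$ is the automorphism group of $X$. A subgroup of $\mathrm{Aut}\,X$ is vertex-transitive (edge-transitive) if it acts transitively on vertices (edges) of $X$. **The graph $\mathrm{GP}(8,3)$.** Vertex set $\{1,\dots,16\}$. Edges: the outer edges $\{i,i+1\}$ for $1\le i\le 7$ and $\{8,1\}$; the spokes $\{i,8+i\}$ for $1\le i\le 8$; and the inner edges $\{8+i,8+j\}$ where $i,j\in\{1,\dots,8\}$, $j\equiv i+3\pmod 8$. **Regular covering projections.** An epimorphism $\wp\colon\tilde X\to X$ of graphs is a regular covering projection if there is a subgroup $\mathrm{CT}(\wp)\le\mathrm{Aut}\,\tilde X$ acting semiregularly (all vertex stabilizers trivial) on $V(\tilde X)$ whose vertex orbits are exactly the fibres $\wp^{-1}(v)$, $v\in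 V(X)$, and whose arc and edge orbits are exactly the fibres over the arcs and over the edges of $X$. If $\mathrm{CT}(\wp)\cong N$ it is called a regular $N$-covering projection. It is nontrivial if $N\neq 1$, and $p$-elementary abelian if $N$ is a (nontrivial) elementary abelian $p$-group. **Isomorphism.** Two regular covering projections $\wp\colon\tilde X\to X$ and $\wp'\colon\tilde X'\to X$ are isomorphic if there exist $\alpha\in\mathrm{Aut}\,X$ and a graph isomorphism $\tilde\alpha\colon\tilde X\to\tilde X'$ with $\alpha\circ\wp=\wp'\circ\tilde\alpha$. **Lifting and symmetry.** $\alpha\in\mathrm{Aut}\,X$ lifts along $\wp\colon\tilde X\to X$ if there is $\tilde\alpha\in\mathrm{Aut}\,\tilde X$ with $\alpha\circ\wp=\wp\circ\tilde\alpha$. A subgroup $G\le\mathrm{Aut}\,X$ lifts if each of its elements lifts. The projection $\wp$ is vertex-transitive (edge-transitive) if some vertex-transitive (edge-transitive) subgroup of $\mathrm{Aut}\,X$ lifts along $\wp$, and semisymmetric if it is edge-transitive but not vertex-transitive. **Minimality.** A projection $\wp\colon\tilde X\to X$ is minimal semisymmetric if it is semisymmetric and there is no decomposition $\wp=\wp'\circ\wp''$ into two nontrivial regular covering projections $\wp''\colon\tilde X\to Y$, $\wp'\colon Y\to X$ with $\wp'$ semisymmetric. *)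

(* Defs.v *)
From mathcomp Require Import all_boot all_fingroup all_solvable.
Set Implicit Arguments.
Unset Strict Implicit.
Unset Printing Implicit Defensive.
Local Open Scope group_scope.

Record sgraph := SGraph {
  vertex :> finType;
  adj : rel vertex;
  adj_sym : symmetric adj;
  adj_irr : irreflexive adj
}.
Arguments adj {s} _ _.

Section Graphs.

Variable X : sgraph.

Definition arcs : {set X * X} := [set a | adj a.1 a.2].

Definition edges : {set {set X}} := [set [set a.1; a.2] | a in arcs].

Definition connected : Prop := forall x y : X, connect adj x y.

Definition gaut : {set {perm X}} :=
  [set s : {perm X} | [forall x, forall y, adj (s x) (s y) == adj x y]].

Lemma gaut_group_set : group_set gaut.
Proof.
apply/group_setP; split.
  by rewrite inE; apply/'forall_forallP=> x y; rewrite !perm1.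
move=> s t; rewrite !inE => /'forall_'forall_eqP hs /'forall_'forall_eqP ht.
by apply/'forall_'forall_eqP=> x y; rewrite !permM ht hs.
Qed.
Canonical gaut_group := Group gaut_group_set.

Definition vertex_transitive (G : {group {perm X}}) : Prop :=
  [transitive G, on [set: X] | 'P].

Definition edge_transitive (G : {group {perm X}}) : Prop :=
  [transitive G, on edges | 'P^*].

End Graphs.

Arguments connected : clear implicits.
Arguments gaut : clear implicits.
Arguments arcs : clear implicits.
Arguments edges : clear implicits.

Definition graph_morphism (Y X : sgraph) (f : Y -> X) : Prop :=
  forall x y, adj x y -> adj (f x) (f y).

Definition graph_iso (Y Z : sgraph) (f : Y -> Z) : Prop :=
  bijective f /\ forall x y, adj (f x) (f y) = adj x y.

Section Coverings.

Variables (Y X : sgraph) (pr : Y -> X).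

Definition vertex_fibre (v : X) : {set Y} := [set x | pr x == v].

Definition arc_fibre (a : X * X) : {set Y * Y} :=
  [set b in arcs Y | (pr b.1, pr b.2) == a].

Definition edge_fibre (e : {set X}) : {set {set Y}} :=
  [set d in edges Y | pr @: d == e].

Definition arc_orbit (N : {set {perm Y}}) (a : Y * Y) : {set Y * Y} :=
  [set (s a.1, s a.2) | s : {perm Y} in N].

(* [N] can serve as the group CT of [pr]; it is determined by [pr] when [Y] is
   connected, but not in general. *)
Definition is_CT (N : {group {perm Y}}) : Prop :=
  [/\ N \subset gaut Y,
      forall x : Y, 'C_N[x | 'P] = 1,
      [set orbit 'P N x | x : Y] = [set vertex_fibre v | v : X],
      [set arc_orbit N b | b in arcs Y] = [set arc_fibre a | a in arcs X] &
      [set orbit 'P^* N d | d in edges Y] = [set edge_fibre e | e in edges X]].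

Definition graph_epimorphism : Prop :=
  graph_morphism pr /\ forall v : X, exists x : Y, pr x = v.

Definition regular_covering_by (N : {group {perm Y}}) : Prop :=
  graph_epimorphism /\ is_CT N.

Definition nontrivial_regular_covering : Prop :=
  exists N : {group {perm Y}}, regular_covering_by N /\ N :!=: 1.

Definition elementary_abelian_covering (p : nat) : Prop :=
  exists N : {group {perm Y}},
    [/\ regular_covering_by N, p.-abelem N & N :!=: 1].

Definition lifts (a : {perm X}) : Prop :=
  exists2 t : {perm Y}, t \in gaut Y & forall x, a (pr x) = pr (t x).

Definition group_lifts (G : {group {perm X}}) : Prop :=
  forall a, a \in G -> lifts a.

Definition vertex_transitive_proj : Prop :=
  exists G : {group {perm X}},
    [/\ G \subset gaut X, vertex_transitive G & group_lifts G].

Definition edge_transitive_proj : Prop :=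
  exists G : {group {perm X}},
    [/\ G \subset gaut X, edge_transitive G & group_lifts G].

Definition semisymmetric : Prop :=
  edge_transitive_proj /\ ~ vertex_transitive_proj.

End Coverings.

Definition minimal_semisymmetric (Y X : sgraph) (pr : Y -> X) : Prop :=
  semisymmetric pr /\
  ~ exists (Z : sgraph) (pr'' : Y -> Z) (pr' : Z -> X),
      [/\ pr =1 pr' \o pr'',
          nontrivial_regular_covering pr'',
          nontrivial_regular_covering pr' &
          semisymmetric pr'].

Record graph_over (X : sgraph) := GraphOver {
  total :> sgraph;
  proj : total -> X
}.

Definition isomorphic_over (X : sgraph) (P Q : graph_over X) : Prop :=
  exists2 a : {perm X}, a \in gaut X &
  exists2 f : P -> Q, graph_iso f & forall x, a (proj x) = proj (f x).

Definition num_iso_classes (X : sgraph) (C : graph_over X -> Prop) (n : nat)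
    : Prop :=
  exists F : 'I_n -> graph_over X,
    [/\ forall i, C (F i),
        forall i j, isomorphic_over (F i) (F j) -> i = j &
        forall P, C P -> exists i, isomorphic_over (F i) P].

Definition GP83_edge (i j : nat) : bool :=
  [|| (1 <= i <= 7) && (j == i + 1),
      (i == 8) && (j == 1),
      (1 <= i <= 8) && (j == 8 + i) |
      [&& 9 <= i <= 16, 9 <= j <= 16 & j - 8 == i - 8 + 3 %[mod 8]]]%N.

(* The element [x] of ['I_16] stands for the vertex [x + 1] of {1, ..., 16}. *)
Definition GP83_adj : rel 'I_16 :=
  fun x y => GP83_edge x.+1 y.+1 || GP83_edge y.+1 x.+1.

Lemma GP83_sym : symmetric GP83_adj.
Proof. by move=> x y; apply: orbC. Qed.

Lemma GP83_irr : irreflexive GP83_adj.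
Proof. by case; do 16?[case=> //]. Qed.

Definition GP83 : sgraph := SGraph GP83_sym GP83_irr.

Definition minimal_semisymmetric_elab_cover (p : nat) (P : graph_over GP83)
    : Prop :=
  [/\ connected P,
      elementary_abelian_covering (@proj _ P) p &
      minimal_semisymmetric (@proj _ P)].

(* Main.v *)
(** A cochain [c] on a graph [X] with values in [F_p] is killed by a cover [pr] of [X]
   when its pullback is a coboundary. Over connected covers, an elementary abelian
   p-cover is determined by the subspace [W] of H^1(X; F_p) formed by the killed
   classes; every subspace occurs, an automorphism lifts exactly when it preserves
   [W], isomorphism is conjugacy of subspaces under Aut X, and intermediate covers
   correspond to smaller subspaces.

   For the Möbius-Kantor graph, H^1 has dimension 9, all edge-transitive groups
   contain the same subgroup H, isomorphic to SL(2,3), and a group containing H is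
   vertex-transitive exactly when it contains one of two automorphisms t_2, t_3. So
   minimal semisymmetric covers are the minimal ones among the H-submodules stable
   neither under t_2 nor under t_3. For p = 2 there are none. For p odd,
   H^1 = A + B + C with A of dimension 2 and factoring through H / Q_8 = C_3, C
   irreducible of dimension 3, and B the quaternion algebra, whose proper nonzero
   submodules are its left ideals, indexed by the conic x^2 + y^2 + z^2 = 0. An
   ideal fixed by neither t_2 nor t_3 is a solution; the only other ones are sums
   of an ideal fixed by t_2 but not t_3 and an eigenline of H / Q_8 in A, fixed by
   t_3 but not t_2: these exist when -2 is a square and p = 1 mod 3, and form one
   orbit. The first kind is counted by the points of the circle y^2 + z^2 = -1. *)

Require Import Defs.
From mathcomp Require Import all_boot all_fingroup all_algebra all_solvable.
From mathcomp Require Import finfield mxabelem ring zify.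
From Stdlib Require Import Classical_Prop.

Set Implicit Arguments.
Unset Strict Implicit.
Unset Printing Implicit Defensive.

Import GRing.Theory.

(** * Covers and the cohomology classes they kill *)

(** Covers range over arbitrary finite graphs whose group is only known to exist, so everything is
    read off from primitives: functions on the total graph whose increments along arcs are a
    pulled-back cochain. A homomorphism from the covering group to F_p yields a primitive on which
    the group acts by translations. Such homomorphisms separate the elements of an elementary
    abelian group, hence the primitives separate the points of a fibre, and this alone suffices to
    rebuild the cover. Killed classes form a predicate closed under combinations; no dimension is
    ever attached to it.

    The automorphism t_3 is -1 on A and 1 on C, and every H-submodule of C is stable under t_2; so
    t_3 can only be obstructed in B, and t_2 only in A or B. Since t_3 is right multiplication by i
    on B, the ideals that it moves belong to the points of the conic with x nonzero, normalised to x
    = 1. On the pairs (y, z), t_2 acts by exchange and t_3 by negation, so the orbits are told apart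
    by (y - z)^2. *)

Lemma connected_ind (Y : sgraph) (P : Y -> Prop) (y0 : Y) :
  connected Y -> P y0 -> (forall y z, adj y z -> P y -> P z) -> forall y, P y.
Proof.
move=> cY P0 PS y; have /connectP[s] := cY y0 y.
elim: s y0 P0 => [|z s IHs] y0 P0 /=; first by move=> _ ->.
by case/andP=> yz pth eqy; apply: IHs pth eqy; apply: PS yz P0.
Qed.

Section Covering.

Variables (Y X : sgraph) (pr : Y -> X).

Definition covering : Prop :=
  [/\ graph_epimorphism pr,
      forall y x, adj (pr y) x -> exists2 z, adj y z & pr z = x &
      forall y z z', adj y z -> adj y z' -> pr z = pr z' -> z = z'].

Definition deck_group (N : {group {perm Y}}) : Prop :=
  [/\ N \subset gaut Y,
      forall (n : {perm Y}) y, n \in N -> n y = y -> n = 1%g,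
      forall (n : {perm Y}) y, n \in N -> pr (n y) = pr y &
      forall y z, pr y = pr z -> exists2 n : {perm Y}, n \in N & z = n y].

Lemma gautP (Z : sgraph) (s : {perm Z}) :
  reflect (forall x y, adj (s x) (s y) = adj x y) (s \in gaut Z).
Proof. by rewrite inE; apply: 'forall_'forall_eqP. Qed.

(** If the fibres of arcs are orbits, two lifts of an arc from the same vertex differ by an element
    fixing that vertex, which is trivial: arcs lift uniquely. Conversely, under unique lifting an
    element carrying one end of an arc to the right place carries the other end as well, so fibres
    of arcs and edges are single orbits. *)
Lemma regular_covering_byP (N : {group {perm Y}}) :
  regular_covering_by pr N <-> covering /\ deck_group N.
Proof.
split=> [[epi [sNG free vert arc_ _]] | [[epi ex uniq] [sNG free prN trans]]].
  have [mor surj] := epi.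
  have free' (n : {perm Y}) y : n \in N -> n y = y -> n = 1%g.
    move=> nN ny; apply/set1gP; rewrite -(free y) inE nN.
    by apply/astab1P; rewrite /= apermE.
  have orbV y : orbit 'P N y = vertex_fibre pr (pr y).
    have: orbit 'P N y \in [set orbit 'P N x | x : Y] by apply: imset_f.
    rewrite vert => /imsetP[v _ eqv].
    have: y \in orbit 'P N y by apply: orbit_refl.
    by rewrite eqv inE => /eqP->.
  have prN (n : {perm Y}) y : n \in N -> pr (n y) = pr y.
    move=> nN; have: n y \in orbit 'P N y by apply: (mem_orbit 'P).
    by rewrite orbV inE => /eqP.
  have tr y z : pr y = pr z -> exists2 n : {perm Y}, n \in N & z = n y.
    move=> eyz; have: z \in orbit 'P N y by rewrite orbV inE eyz.
    by case/imsetP=> n nN ->; exists n.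
  have lift y x : adj (pr y) x -> exists b : Y * Y,
      b \in arcs Y /\ arc_fibre pr (pr y, x) = arc_orbit N b.
    move=> yx; have: arc_fibre pr (pr y, x) \in [set arc_fibre pr a | a in arcs X].
      by apply: imset_f; rewrite inE.
    by rewrite -arc_ => /imsetP[b bY eqb]; exists b.
  have orb_fib b : b \in arcs Y -> b \in arc_orbit N b.
    by move=> _; apply/imsetP; exists 1%g; rewrite ?group1 // !perm1; case: b.
  split; last by split.
  split=> // [y x /[dup] yx /lift[[b1 b2] [bY eqb]] | y z z' yz yz' ezz'].
    have: (b1, b2) \in arc_fibre pr (pr y, x) by rewrite eqb orb_fib.
    rewrite !inE /= => /andP[b12 /eqP[pb1 pb2]].
    have [n nN def_y] := tr b1 y pb1.
    exists (n b2); last by rewrite prN.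
    by rewrite def_y (gautP _ (subsetP sNG _ nN)).
  have [b [bY eqb]] := lift y _ (mor _ _ yz).
  have: (y, z) \in arc_orbit N b by rewrite -eqb !inE /= yz eqxx.
  have: (y, z') \in arc_orbit N b by rewrite -eqb !inE /= yz' -ezz' eqxx.
  case/imsetP=> m mN [ey ez] /imsetP[n nN [ey' ez']].
  suff emn : m = n by rewrite ez ez' emn.
  apply/eqP; rewrite eq_mulgV1; apply/eqP/(free' _ b.1).
    by rewrite groupM ?groupV.
  by rewrite permM -ey ey' permK.
have [mor surj] := epi.
have orbV y : orbit 'P N y = vertex_fibre pr (pr y).
  apply/setP=> z; rewrite inE; apply/imsetP/eqP=> [[n nN ->] | /esym/trans[n nN ->]].
    by rewrite /= apermE prN.
  by exists n.
have adjN n y z : n \in N -> adj (n y) (n z) = adj y z.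
  by move=> nN; rewrite (gautP _ (subsetP sNG _ nN)).
have orbA b : b \in arcs Y -> arc_orbit N b = arc_fibre pr (pr b.1, pr b.2).
  case: b => y z; rewrite inE /= => yz; apply/setP=> [[y' z']]; rewrite !inE /=.
  apply/imsetP/andP=> [[n nN [-> ->]] | [yz' /eqP[ey ez]]].
    by rewrite adjN // !prN.
  have [n nN def_y'] := trans _ _ (esym ey); exists n => //.
  congr (_, _) => //; apply: (uniq y') => //; first by rewrite def_y' adjN.
  by rewrite prN.
have arcX a : a \in arcs X -> exists2 b, b \in arcs Y & a = (pr b.1, pr b.2).
  case: a => x x'; rewrite inE /=; have [y <-] := surj x => /ex[z yz <-].
  by exists (y, z); rewrite ?inE.
split=> //; split=> // [x|||].
- apply/trivgP/subsetP=> n /setIP[nN /astab1P]; rewrite /= apermE => nx.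
  by rewrite (free n x) ?set1g.
- apply/setP=> A; apply/imsetP/imsetP=> [[y _ ->] | [x _ ->]].
    by exists (pr y).
  by have [y <-] := surj x; exists y.
- apply/setP=> A; apply/imsetP/imsetP=> [[b bY ->] | [a aX ->]].
    rewrite orbA //; exists (pr b.1, pr b.2) => //.
    by move: bY; rewrite !inE; apply: mor.
  by have [b bY ->] := arcX a aX; exists b; rewrite ?orbA.
have im2 (Z T : finType) (f : Z -> T) y z : f @: [set y; z] = [set f y; f z].
  by rewrite imsetU1 imset_set1.
have orbE y z : adj y z -> orbit 'P^* N [set y; z] = edge_fibre pr [set pr y; pr z].
  move=> yz; apply/setP=> d; rewrite inE; apply/imsetP/andP.
    case=> n nN ->; rewrite /= setactE im2 /= !apermE; split.
      by apply/imsetP; exists (n y, n z); rewrite ?inE //= adjN.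
    by rewrite im2 !prN.
  case=> /imsetP[[y' z']]; rewrite inE /= => yz' -> /eqP; rewrite im2 => eqp.
  (* The two edges may match in either orientation; the mixed cases would produce a loop in [X]. *)
  have dE : exists n, n \in N /\ ([set y'; z'] = [set n y; n z]).
    have: pr y' \in [set pr y; pr z] by rewrite -eqp set21.
    have: pr z' \in [set pr y; pr z] by rewrite -eqp set22.
    have nzy : pr y' <> pr z' by move=> E; move: (mor _ _ yz'); rewrite E adj_irr.
    rewrite !inE => /orP[]/eqP ez /orP[]/eqP ey; try by case: nzy; rewrite ey ez.
      have [n nN def_z'] := trans _ _ (esym ez); exists n; split=> //.
      rewrite setUC def_z'; congr [set _; _]; apply: (uniq z') => //.
      - by rewrite adj_sym.
      - by rewrite def_z' adjN.
      - by rewrite prN.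
    have [n nN def_y'] := trans _ _ (esym ey); exists n; split=> //.
    rewrite def_y'; congr [set _; _]; apply: (uniq y') => //.
    - by rewrite def_y' adjN.
    - by rewrite prN.
  by case: dE => n [nN ->]; exists n; rewrite //= setactE im2 /= !apermE.
apply/setP=> A; apply/imsetP/imsetP=> [[d /imsetP[[y z] yz ->] ->] | [d /imsetP[a aX ->] ->]].
  move: yz; rewrite inE /= => yz; rewrite orbE //; exists [set pr y; pr z] => //.
  by apply/imsetP; exists (pr y, pr z); rewrite ?inE //; apply: mor.
have [[y z] bY ->] := arcX a aX; exists [set y; z].
  by apply/imsetP; exists (y, z).
by rewrite orbE //; move: bY; rewrite inE.
Qed.

End Covering.

(** * Primitives of cochains and the reconstruction of a cover from them *)

Section Cochains.

Variable p : nat.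
Local Notation F := 'F_p.
Local Open Scope group_scope.
Local Open Scope ring_scope.

(* A function on all pairs of vertices stands for a 1-cochain: only its values
   on arcs matter. *)
Definition primitive_along (Y X : sgraph) (pr : Y -> X) (c : X -> X -> F)
    (f : Y -> F) : Prop :=
  forall y z, adj y z -> f z - f y = c (pr y) (pr z).

Definition exact_along (Y X : sgraph) (pr : Y -> X) (c : X -> X -> F) : Prop :=
  exists f, primitive_along pr c f.

Definition exact (X : sgraph) (c : X -> X -> F) : Prop := exact_along (@id X) c.

Definition pullback (X : sgraph) (a : X -> X) (c : X -> X -> F) : X -> X -> F :=
  fun x y => c (a x) (a y).

(** A substitute for being elementary abelian that does not mention the covering group. *)
Definition separated (Y X : sgraph) (pr : Y -> X) : Prop :=
  forall y z, pr y = pr z ->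
    (forall c f, primitive_along pr c f -> f y = f z) -> y = z.

Lemma exact_along_cohomologous (Y X : sgraph) (pr : Y -> X) c c' :
  graph_morphism pr -> exact (fun x y => c' x y - c x y) ->
  exact_along pr c -> exact_along pr c'.
Proof.
move=> mor [g gE] [f fE]; exists (fun y => f y + g (pr y)) => y z yz.
have := fE _ _ yz; have /= := gE _ _ (mor _ _ yz) => Eg Ef.
by apply: etrans (_ : (f z - f y) + (g (pr z) - g (pr y)) = _); [|rewrite Eg Ef]; ring.
Qed.

Lemma primitive_along_const (Y X : sgraph) (pr : Y -> X) c f g :
  connected Y -> primitive_along pr c f -> primitive_along pr c g ->
  forall y z, f y - g y = f z - g z.
Proof.
move=> cY fE gE y; apply: (connected_ind (y0 := y)) => // z z' zz' ->.
apply/eqP; rewrite -subr_eq0; apply/eqP.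
by apply: etrans (_ : (g z' - g z) - (f z' - f z) = _); [|rewrite fE ?gE // subrr]; ring.
Qed.

Section Regular.

Variables (Y X : sgraph) (pr : Y -> X) (N : {group {perm Y}}).
Hypotheses (cov : covering pr) (dgN : deck_group pr N).

Lemma deck_section : exists2 s : X -> Y, forall x, pr (s x) = x &
  exists m : Y -> {perm Y}, [/\ forall y, m y \in N,
    forall y, y = m y (s (pr y)) &
    forall (n : {perm Y}) y, n \in N -> m (n y) = (m y * n)%g].
Proof.
have [[_ /fin_all_exists[s sK]] _ _] := cov; have [_ free prN trans] := dgN.
exists s => //.
have/fin_all_exists[m mP]: forall y, exists n : {perm Y}, n \in N /\ y = n (s (pr y)).
  by move=> y; have [n nN ->] := trans (s (pr y)) y (sK _); exists n; rewrite prN ?sK.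
have mN y := (mP y).1; have mE y := (mP y).2.
exists m; split=> // n y nN; apply/eqP; rewrite eq_mulgV1; apply/eqP.
apply: (free _ (s (pr y))); first by rewrite groupM ?groupV ?groupM ?mN.
rewrite permM; apply: (canLR (permK _)); rewrite permM -mE.
by rewrite -{1}(prN n y nN) -mE.
Qed.

(** Relative to a section, each point is reached by a unique element of [N]; composing with [phi]
    gives a function whose increments are constant on the [N]-orbits of arcs, hence come from a
    cochain on [X]. *)
Lemma hom_cochain (phi : {perm Y} -> F) :
  {in N &, {morph phi : m n / (m * n)%g >-> m + n}} ->
  exists c f, primitive_along pr c f /\
    forall (n : {perm Y}) y, n \in N -> f (n y) = f y + phi n.
Proof.
move=> phiM; have [s sK [m [mN mE mM]]] := deck_section.
have [_ ex uniq] := cov; have [sNG _ prN trans] := dgN.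
pose f y := phi (m y).
have fM (n : {perm Y}) y : n \in N -> f (n y) = f y + phi n.
  by move=> nN; rewrite /f mM // phiM.
have/fin_all_exists[c cE]: forall a : X * X, exists t, forall y z, adj y z ->
    pr y = a.1 -> pr z = a.2 -> f z - f y = t.
  case=> x x' /=.
  have [/existsP[y /existsP[z /and3P[yz /eqP<- /eqP<-]]] | no] := boolP
    [exists y, exists z, [&& adj y z, pr y == x & pr z == x']].
    exists (f z - f y) => y' z' yz' ey ez.
    have [n nN def_y'] := trans _ _ (esym ey).
    have def_z' : z' = n z.
      apply: (uniq y') => //; last by rewrite prN.
      by rewrite def_y' (gautP _ (subsetP sNG _ nN)).
    by rewrite def_y' def_z' !fM // opprD addrACA subrr addr0.
  (* No arc lies above this pair, so its value is arbitrary. *)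
  exists 0 => y z yz ey ez; case/negP: no; apply/existsP; exists y.
  by apply/existsP; exists z; rewrite yz ey ez !eqxx.
by exists (fun x x' => c (x, x')), f; split=> // y z yz; apply: cE.
Qed.

Lemma descend (T : Type) (f : Y -> T) :
  (forall (n : {perm Y}) y, n \in N -> f (n y) = f y) ->
  exists g, forall y, f y = g (pr y).
Proof.
move=> fN; have [s sK [m [mN mE mM]]] := deck_section.
by exists (f \o s) => y /=; rewrite {1}(mE y) fN.
Qed.

(** The quotient of [N] by [M] is a vector space over F_p in which the class of [n] has a nonzero
    coordinate. *)
Lemma hom_separating (M : {group {perm Y}}) (n : {perm Y}) :
  p.-abelem N -> M \subset N -> n \in N -> n \notin M ->
  exists2 phi : {perm Y} -> F,
    {in N &, {morph phi : m n / (m * n)%g >-> m + n}} &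
    {in M, phi =1 fun=> 0} /\ phi n != 0.
Proof.
move=> abN sMN nN nM; have nMN := sub_abelian_norm (abelem_abelian abN) sMN.
have abQ : p.-abelem (N / M)%g by apply: quotient_abelem.
have nQ : coset M n \in (N / M)%g by apply: mem_quotient.
have n1 : coset M n != 1%g.
  by apply: contra nM => /eqP/coset_idr-> //; apply: (subsetP nMN).
have ntQ : (N / M)%g != 1%g.
  by apply: contraNneq n1 => Q1; rewrite -in_set1 -[[set _]]Q1.
pose r := abelem_rV abQ ntQ.
have r1 : r 1%g = 0 by apply: abelem_rV_1.
have [i ri] : exists i, r (coset M n) 0 i != 0.
  apply/existsP; apply: contraNT n1; rewrite negb_exists => /forallP r0.
  apply/eqP/(abelem_rV_inj (abelE := abQ) (ntE := ntQ)) => //; rewrite -/r r1.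
  by apply/rowP=> i; rewrite mxE; apply/eqP; rewrite -[_ == _]negbK r0.
exists (fun m => r (coset M m) 0 i).
  move=> m m' mN m'N; rewrite morphM ?(subsetP nMN) //.
  by rewrite /r abelem_rV_M ?mem_quotient // mxE.
by split=> // m mM; rewrite coset_id // r1 mxE.
Qed.

Lemma abelem_separated : p.-abelem N -> separated pr.
Proof.
move=> abN y z eyz sep; have [_ free _ trans] := dgN.
have [n nN def_z] := trans _ _ eyz; case: (eqVneq n 1%g) => [n1 | nt_n].
  by rewrite def_z n1 perm1.
have nM : n \notin 1%G by rewrite inE.
have [phi phiM [_]] := hom_separating abN (sub1G N) nN nM.
have [c [f [fE fM]]] := hom_cochain phiM.
have := fM n y nN; rewrite -def_z -(sep _ _ fE) -[LHS]addr0 => /addrI <-.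
by rewrite eqxx.
Qed.

End Regular.

Section Isomorphism.

Variables (X : sgraph) (P Q : graph_over X) (a : {perm X}).
Hypotheses (cP : connected P) (cQ : connected Q).
Hypotheses (covP : covering (@proj _ P)) (covQ : covering (@proj _ Q)).
Hypotheses (sepP : separated (@proj _ P)) (sepQ : separated (@proj _ Q)).
Hypothesis Xa : a \in gaut X.

(** The isomorphism is a connected component of the fibre product of the two covers over [a]. Along
    it, a primitive on [Q] and a primitive on [P] of the pulled-back cochain differ by a constant,
    so separation on both sides makes the component the graph of a bijection. *)
Lemma covering_iso :
  (forall c, exact_along (@proj _ Q) c <-> exact_along (@proj _ P) (pullback a c)) ->
  exists2 f : P -> Q, graph_iso f & forall x, a (proj x) = proj (f x).
Proof.
move=> eqW; have adja x y : adj (a x) (a y) = adj x y by apply: gautP.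
have [[morP surP] exP uniqP] := covP; have [[morQ surQ] exQ uniqQ] := covQ.
(* If [P] has no vertex then neither has [Q], and the empty map is the isomorphism. *)
have [y0 _ | noP] := pickP P; last first.
  have noQ (z : Q) : False.
    by have [y _] := surP (proj z); have := noP y.
  exists (fun y : P => False_rect Q (notF (etrans (esym (noP y)) erefl))).
    split; last by move=> y; have := noP y.
    by exists (fun z => False_rect P (noQ z)) => y; [have := noP y | case: (noQ y)].
  by move=> y; have := noP y.
have [z0 z0E] := surQ (a (proj y0)).
pose e (u v : P * Q) := [&& adj u.1 v.1, adj u.2 v.2 & a (proj v.1) == proj v.2].
pose R y z := connect e (y0, z0) (y, z).
have Rpr y z : R y z -> a (proj y) = proj z.
  case/connectP=> s; elim/last_ind: s => [|s [y' z'] _]; first by move=> _ [-> ->].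
  by rewrite rcons_path last_rcons => /andP[_ /and3P[_ _ /eqP H]] [-> ->].
have Rstep y z y' z' : R y z -> adj y y' -> adj z z' -> a (proj y') = proj z' -> R y' z'.
  move=> Ryz yy' zz' eqa; apply: connect_trans Ryz (connect1 _).
  by rewrite /e /= yy' zz' eqa eqxx.
have R0 : R y0 z0 by apply: connect0.
have liftQ y z y' : R y z -> adj y y' -> exists2 z', adj z z' & R y' z'.
  move=> Ryz yy'; have [|z' zz' eqz'] := exQ z (a (proj y')).
    by rewrite -(Rpr _ _ Ryz) adja; apply: morP.
  by exists z' => //; apply: (Rstep y z).
have liftP y z z' : R y z -> adj z z' -> exists2 y', adj y y' & R y' z'.
  move=> Ryz zz'; have [|y' yy' eqy'] := exP y ((a^-1)%g (proj z')).
    by rewrite -adja permKV (Rpr _ _ Ryz); apply: morQ.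
  by exists y' => //; apply: (Rstep y z) => //; rewrite eqy' permKV.
have Rtot y : exists z, R y z.
  move: y; apply: (connected_ind (y0 := y0)) => //; first by exists z0.
  by move=> y y' yy' [z /liftQ/(_ yy')[z' _ R']]; exists z'.
have Rsur z : exists y, R y z.
  move: z; apply: (connected_ind (y0 := z0)) => //; first by exists y0.
  by move=> z z' zz' [y /liftP/(_ zz')[y' _ R']]; exists y'.
have Rdiff c f g y z : primitive_along (@proj _ Q) c f ->
    primitive_along (@proj _ P) (pullback a c) g -> R y z -> f z - g y = f z0 - g y0.
  move=> fE gE /connectP[s]; elim/last_ind: s y z => [|s [y z] IHs] y' z'.
    by move=> _ [-> ->].
  rewrite rcons_path last_rcons => /andP[pth ee] [-> ->] {y' z'}.
  case def_l: (last _ _) ee => [y1 z1] /and3P[/= yy zz eqa].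
  rewrite -(IHs y1 z1) ?def_l //.
  have Rl : R y1 z1 by apply/connectP; exists s; rewrite ?def_l.
  have := fE _ _ zz; rewrite -(Rpr _ _ Rl) -(eqP eqa) => Ef.
  have := gE _ _ yy; rewrite /pullback -Ef => /esym Eg.
  apply/eqP; rewrite -subr_eq0; apply/eqP.
  by apply: etrans (_ : (f z - f z1) - (g y - g y1) = _); [|rewrite Eg subrr]; ring.
have Rfun y z z' : R y z -> R y z' -> z = z'.
  move=> Rz Rz'; apply: sepQ => [|c f fE]; first by rewrite -(Rpr _ _ Rz) (Rpr _ _ Rz').
  have [g gE] := (eqW c).1 (ex_intro _ f fE).
  by apply: (addIr (- g y)); rewrite !(Rdiff _ _ _ _ _ fE gE).
have Rinj y y' z : R y z -> R y' z -> y = y'.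
  move=> Rz Rz'; apply: sepP => [|c g gE].
    by apply: (@perm_inj _ a); rewrite (Rpr _ _ Rz) (Rpr _ _ Rz').
  pose c' := pullback (a^-1)%g c.
  have gE' : primitive_along (@proj _ P) (pullback a c') g.
    by move=> u v uv; rewrite gE // /pullback /c' /pullback !permK.
  have [f fE] := (eqW c').2 (ex_intro _ g gE').
  apply: oppr_inj; apply: (addrI (f z)).
  by rewrite !(Rdiff _ _ _ _ _ fE gE').
have /fin_all_exists[f fR] := Rtot; have /fin_all_exists[g gR] := Rsur.
exists f => [|y]; last exact: Rpr.
split=> [|y y'].
  by exists g => x; [apply: Rinj (gR _) (fR _) | apply: Rfun (fR _) (gR _)].
apply/idP/idP=> [ff | yy'].
  have [y1 yy1 R1] := liftP _ _ _ (fR y) ff.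
  by rewrite (Rinj _ _ _ (fR y') R1).
have [z1 zz1 R1] := liftQ _ _ _ (fR y) yy'.
by rewrite (Rfun _ _ _ (fR y') R1).
Qed.

End Isomorphism.
End Cochains.

(** * Automorphisms that lift *)

Section Lifting.

Variable p : nat.
Local Notation F := 'F_p.
Variables (Y X : sgraph) (pr : Y -> X).
Local Open Scope group_scope.

(** The largest group that lifts: some lifting group is transitive exactly when this one is. *)
Definition lift_set : {set {perm X}} :=
  [set a in gaut X | [exists t in gaut Y, [forall x, a (pr x) == pr (t x)]]].

Lemma lift_setP a : reflect (a \in gaut X /\ lifts pr a) (a \in lift_set).
Proof.
apply: (iffP setIdP) => [[-> /exists_inP[t tY /'forall_eqP tE]] | [-> [t tY tE]]].
  by split=> //; exists t.
by split=> //; apply/exists_inP; exists t => //; apply/'forall_eqP.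
Qed.

Lemma lift_group_set : group_set lift_set.
Proof.
apply/group_setP; split.
  apply/lift_setP; split; first exact: group1.
  by exists 1; rewrite ?group1 // => x; rewrite !perm1.
move=> a b /lift_setP[aX [s sY sE]] /lift_setP[bX [t tY tE]].
apply/lift_setP; split; first exact: groupM.
by exists (s * t); rewrite ?groupM // => x; rewrite !permM sE tE.
Qed.
Canonical lift_group := Group lift_group_set.

Lemma lift_set_gaut : lift_set \subset gaut X.
Proof. by apply/subsetP=> a /lift_setP[]. Qed.

Lemma vertex_transitive_projP : vertex_transitive_proj pr ->
  forall x y, exists2 a, a \in lift_set & a x = y.
Proof.
case=> G [sG vtG lG] x y; have /(atransP2 vtG) : x \in [set: X] by [].
case/(_ y (in_setT _))=> a aG ->; exists a; last by rewrite /= apermE.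
by apply/lift_setP; split; [apply: (subsetP sG) | apply: lG].
Qed.

Lemma vertex_transitive_proj_intro (x0 : X) :
  (forall x, exists2 a, a \in lift_set & a x0 = x) -> vertex_transitive_proj pr.
Proof.
move=> tr; exists lift_group; split; first exact: lift_set_gaut.
  apply/imsetP; exists x0 => //; apply/setP=> x; rewrite inE; apply/esym/imsetP.
  by have [a aG <-] := tr x; exists a; rewrite //= apermE.
by move=> a /lift_setP[].
Qed.

Lemma edge_transitive_projP : edge_transitive_proj pr ->
  forall e e', e \in edges X -> e' \in edges X ->
  exists2 a : {perm X}, a \in lift_set & a @: e = e'.
Proof.
case=> G [sG etG lG] e e' eX e'X; have [a aG ->] := atransP2 etG eX e'X.
exists a; last by rewrite /= setactE; apply: eq_imset => x; rewrite /= apermE.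
by apply/lift_setP; split; [apply: (subsetP sG) | apply: lG].
Qed.

Lemma edge_transitive_proj_intro (e0 : {set X}) : e0 \in edges X ->
  (forall e, e \in edges X -> exists2 a : {perm X}, a \in lift_set & a @: e0 = e) ->
  edge_transitive_proj pr.
Proof.
move=> e0X tr; exists lift_group; split; first exact: lift_set_gaut; last first.
  by move=> a /lift_setP[].
apply/imsetP; exists e0 => //; apply/setP=> e; apply/idP/imsetP.
  move=> /tr[a aG <-]; exists a => //; rewrite /= setactE.
case=> a /lift_setP[/gautP aX _] ->; case/imsetP: e0X => [[x y]].
rewrite inE /= => xy ->; rewrite setactE imsetU1 imset_set1 /= !apermE.
by apply/imsetP; exists (a x, a y); rewrite // inE /= aX.
Qed.

Lemma exact_along_pullback (c : X -> X -> F) a :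
  lifts pr a -> exact_along pr c -> exact_along pr (pullback a c).
Proof.
case=> t /gautP tY tE [f fE]; exists (f \o t) => y z yz /=.
by rewrite fE ?tY // /pullback !tE.
Qed.

Lemma exact_along_ext (c c' : X -> X -> F) :
  (forall x y, c x y = c' x y) -> exact_along pr c -> exact_along pr c'.
Proof. by move=> eqc [f fE]; exists f => y z yz; rewrite fE. Qed.

(** Stability in one direction is enough: [a] has finite order, so its inverse is a power of [a] and
    also preserves the killed cochains. Then [covering_iso] applies to the cover and itself. *)
Lemma pullback_exact_liftable (a : {perm X}) : connected Y -> covering pr ->
  separated p pr -> a \in gaut X ->
  (forall c : X -> X -> F, exact_along pr c -> exact_along pr (pullback a c)) ->
  a \in lift_set.
Proof.
move=> cY covY sepY aX stab; apply/lift_setP; split=> //.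
have stabX k (c : X -> X -> F) : exact_along pr c -> exact_along pr (pullback (a ^+ k) c).
  elim: k c => [|k IHk] c Wc.
    by apply: exact_along_ext Wc => x y; rewrite /pullback !perm1.
  apply: exact_along_ext (stab _ (IHk _ Wc)) => x y.
  by rewrite /pullback expgS !permM.
have [|f [bij_f adj_f] fE] := @covering_iso p X (GraphOver pr) (GraphOver pr) a
    cY cY covY covY sepY sepY aX.
  move=> c; split=> [|/(stabX #[a].-1)]; first exact: stab.
  apply: exact_along_ext => x y.
  by rewrite /pullback -!permM -expgSr prednK // expg_order !perm1.
exists (perm (bij_inj bij_f)); first by apply/gautP=> x y; rewrite !permE adj_f.
by move=> x; rewrite permE fE.
Qed.

End Lifting.

(** * The cover defined by a vector of cochains *)

Section DerivedCover.

Variables (p : nat) (p_prime : prime p) (X : sgraph) (d : nat).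
Local Notation F := 'F_p.
Variable C : X -> X -> 'rV[F]_d.
Hypothesis C_anti : forall x y, C y x = (- C x y)%R.
Local Open Scope group_scope.
Local Open Scope ring_scope.

(** The voltage graph of [C]: crossing an arc adds its voltage, so that the coordinates of the fibre
    are primitives of the components of [C]. *)
Definition derived_adj : rel (X * 'rV[F]_d) :=
  fun u v => adj u.1 v.1 && (v.2 == u.2 + C u.1 v.1).

Lemma derived_adj_sym : symmetric derived_adj.
Proof.
move=> [x u] [y v]; rewrite /derived_adj /= adj_sym; congr (_ && _).
by rewrite (C_anti x y) -subr_eq eq_sym.
Qed.

Lemma derived_adj_irr : irreflexive derived_adj.
Proof. by move=> u; rewrite /derived_adj adj_irr. Qed.

Definition derived_graph := SGraph derived_adj_sym derived_adj_irr.

Definition derived_cover : graph_over X :=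
  @GraphOver X derived_graph (fun u : derived_graph => u.1).

Lemma derived_covering : covering (@proj _ derived_cover).
Proof.
split=> /= [|u x ux|[x u] [y v] [z w]].
- by split=> [u v /andP[] | x] //; exists (x, 0).
- by exists (x, u.2 + C u.1 x); rewrite //= /derived_adj /= ux eqxx.
- by move=> /andP[/= _ /eqP->] /andP[/= _ /eqP->] ->.
Qed.

Definition shift_fun (v : 'rV[F]_d) (u : derived_graph) : derived_graph := (u.1, u.2 + v).

Lemma shift_fun_inj v : injective (shift_fun v).
Proof. by move=> [x u] [y w] [-> /addIr->]. Qed.

Definition shift v : {perm derived_graph} := perm (@shift_fun_inj v).

Lemma shiftE v x u : shift v (x, u) = (x, u + v).
Proof. by rewrite permE. Qed.

Lemma shift_morphM : {in [set: 'rV[F]_d] &, {morph shift : u v / (u * v)%g}}.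
Proof.
by move=> u v _ _; apply/permP=> [[x w]]; rewrite permM !shiftE addrA.
Qed.
Canonical shift_morphism := Morphism shift_morphM.

Definition shift_group : {group {perm derived_graph}} := (shift @* [set: 'rV[F]_d])%G.

Lemma shift_groupP s : reflect (exists v, s = shift v) (s \in shift_group).
Proof.
apply: (iffP morphimP) => [[v _ _ ->] | [v ->]]; first by exists v.
by exists v; rewrite ?inE.
Qed.

Lemma derived_adj_shift v (u w : derived_graph) : adj (shift v u) (shift v w) = adj u w.
Proof.
case: u w => [x u] [y w]; rewrite !shiftE /= /derived_adj /=.
by rewrite addrAC (inj_eq (addIr _)).
Qed.

Lemma derived_deck : deck_group (@proj _ derived_cover) shift_group.
Proof.
split=> [|s u|s u|[x u] [y v] /= ->].
- apply/subsetP=> _ /shift_groupP[v ->]; apply/gautP=> u w.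
  exact: derived_adj_shift.
- case/shift_groupP=> v ->; case: u => x u; rewrite shiftE => -[/eqP].
  rewrite -subr_eq0 addrAC subrr add0r => /eqP->.
  by apply/permP=> [[y w]]; rewrite perm1 shiftE addr0.
- by case/shift_groupP=> v ->; case: u => x u; rewrite shiftE.
- exists (shift (v - u)); first by apply/shift_groupP; exists (v - u).
  by rewrite shiftE addrC subrK.
Qed.

Lemma shift_group_abelem : p.-abelem shift_group.
Proof. by apply: morphim_abelem; apply: mx_Fp_abelem. Qed.

Lemma derived_elementary_abelian (x0 : X) : (0 < d)%N ->
  elementary_abelian_covering (@proj _ derived_cover) p.
Proof.
move=> d_gt0; exists shift_group; split; last 1 first.
- pose v : 'rV[F]_d := const_mx 1.
  apply/trivgPn; exists (shift v); first by apply/shift_groupP; exists v.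
  apply/eqP=> /permP/(_ (x0, 0)); rewrite shiftE perm1 add0r => -[].
  move/rowP/(_ (Ordinal d_gt0)); rewrite !mxE => /eqP.
  by rewrite oner_eq0.
- by apply/regular_covering_byP; split; [apply: derived_covering | apply: derived_deck].
- exact: shift_group_abelem.
Qed.

Lemma derived_separated : separated p (@proj _ derived_cover).
Proof. exact: abelem_separated derived_covering derived_deck shift_group_abelem. Qed.

Definition independent_mod_exact : Prop :=
  forall l : 'cV[F]_d, exact (fun x y => (C x y *m l) 0 0) -> l = 0.

Lemma derived_connect_shift v (u w : derived_graph) :
  connect adj u w -> connect adj (shift v u) (shift v w).
Proof.
case/connectP=> s; elim: s u => [|w1 s IHs] u /=; first by move=> _ ->.
case/andP=> uw1 pth eqw; apply: connect_trans (IHs _ pth eqw).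
by apply: connect1; rewrite derived_adj_shift.
Qed.

(** The translations [D] that join the base point to its translates form a subspace. If it were
    proper, a nonzero functional vanishing on it would take the same value on all lifts of a vertex
    reachable from the base point, and this value would be a primitive of a nontrivial combination
    of the components of [C]. *)
Lemma derived_connected : connected X -> independent_mod_exact -> connected derived_graph.
Proof.
move=> cX indC [x0 u0].
have csym (u v : derived_graph) : connect adj u v = connect adj v u.
  by apply: sym_connect_sym; apply: adj_sym.
pose D := [set v | connect (adj : rel derived_graph) (x0, u0) (x0, u0 + v)].
have transD u v x : connect (adj : rel derived_graph) (x0, u0) (x, u) ->
    connect (adj : rel derived_graph) (x0, u0) (x, v) -> v - u \in D.
  move=> /(derived_connect_shift (v - u)); rewrite !shiftE [u + _]addrC subrK => cv'.
  by rewrite inE => /connect_trans; apply; rewrite csym.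
have D0 : 0 \in D by rewrite inE addr0 connect0.
have DD u v : u \in D -> v \in D -> u + v \in D.
  rewrite !inE => Du /(derived_connect_shift u); rewrite !shiftE => Dv.
  by apply: connect_trans Du _; rewrite addrA addrAC.
have DZ a u : u \in D -> a *: u \in D.
  move=> Du; rewrite -[a]natr_Zp scaler_nat; elim: (a : nat) => [|n IHn].
    by rewrite mulr0n.
  by rewrite mulrS DD.
have liftX x : exists u, connect (adj : rel derived_graph) (x0, u0) (x, u).
  move: x; apply: (connected_ind (y0 := x0)) => //; first by exists u0.
  move=> x y xy [u cu]; exists (u + C x y).
  by apply: connect_trans cu (connect1 _); rewrite /= /derived_adj /= xy eqxx.
pose M := \matrix_(i < #|D|) enum_val i.
have [fullM | ] := boolP (row_full M).
  have DT v : v \in D.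
    have /submxP[w ->] : (v <= M)%MS by apply: submx_full.
    rewrite mulmx_sum_row; elim/big_rec: _ => // i u _ Du.
    by rewrite DD // DZ // rowK enum_valP.
  move=> [x u]; have [u1 cu1] := liftX x.
  have := DT (u - u1); rewrite inE => /connect_trans; apply.
  have := derived_connect_shift (u - u1) cu1.
  by rewrite !shiftE [u1 + _]addrC subrK.
rewrite -cokermx_eq0 => /eqP nz_coker; case: nz_coker.
have D_coker v : v \in D -> v *m cokermx M = 0.
  move=> Dv; have := enum_rankK_in Dv Dv; set i := enum_rank_in _ _ => <-.
  by rewrite -(rowK (fun i : 'I_#|D| => enum_val i)) -/M -row_mul mulmx_coker row0.
apply/matrixP=> k l; rewrite mxE.
suff /matrixP/(_ k 0) : col l (cokermx M) = 0 by rewrite !mxE.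
apply: indC; have /fin_all_exists[s sP] := liftX.
exists (fun x => (s x *m col l (cokermx M)) 0 0) => x y xy /=.
have E : (s y - (s x + C x y)) *m col l (cokermx M) = 0.
  rewrite colE mulmxA D_coker ?mul0mx //.
  apply: transD (sP y); apply: connect_trans (sP x) (connect1 _).
  by rewrite /= /derived_adj /= xy eqxx.
move: (col l (cokermx M)) E => w /(congr1 (fun m : 'M[F]_1 => m 0 0)).
rewrite /= mulmxBl mulmxDl; move: (s y *m w) (s x *m w) (C x y *m w) => a b c.
by rewrite !mxE => E; apply/eqP; rewrite -subr_eq0 -[_ - c 0 0]addrA -opprD E.
Qed.

(** A translate of a primitive is again a primitive, so it differs from it by a constant; the
    constant is additive, hence linear, in the translation, and [l] is its matrix. *)
Lemma derived_exact_along c : connected derived_graph ->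
  exact_along (@proj _ derived_cover) c <->
  exists l : 'cV[F]_d, exact (fun x y => c x y - (C x y *m l) 0 0).
Proof.
move=> cC; split=> [[f fE] | [l]]; last first.
  move=> ex; apply: exact_along_cohomologous ex _.
    by have [[]] := derived_covering.
  exists (fun u : derived_graph => (u.2 *m l) 0 0) => u v /andP[_ /eqP->] /=.
  by rewrite mulmxDl mxE addrAC subrr add0r.
have fv v : exists t, forall u, f (shift v u) = f u + t.
  have prim : primitive_along (@proj _ derived_cover) c (f \o shift v).
    move=> u w uw /=; rewrite fE ?derived_adj_shift //.
    by case: u w {uw} => [x u] [y w]; rewrite !shiftE.
  have [u0 _ | noY] := pickP derived_graph; last by exists 0 => u; have := noY u.
  exists (f (shift v u0) - f u0) => u.
  by have /= <- := primitive_along_const cC prim fE u; rewrite addrC subrK.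
have [x0 _ | noX] := pickP X; last first.
  by exists 0, (fun=> 0) => x; have := noX x.
pose phi v : F := f (shift v (x0, 0)) - f (x0, 0).
have fS v u : f (shift v u) = f u + phi v.
  by have [t tE] := fv v; rewrite /phi !tE addrAC subrr add0r.
move: phi fS => phi fS.
have phiD u v : phi (u + v) = phi u + phi v.
  apply: (addrI (f (x0, 0))); rewrite addrA -!fS !shiftE.
  by rewrite addrA.
have phi0 : phi 0 = 0 by apply: (addrI (phi 0)); rewrite -phiD !addr0.
have phiZ a v : phi (a *: v) = a * phi v.
  rewrite -[a]natr_Zp scaler_nat mulr_natl; elim: (a : nat) => [|n IHn].
    by rewrite !mulr0n.
  by rewrite !mulrS phiD IHn.
pose l : 'cV[F]_d := \col_i phi (delta_mx 0 i).
have phiE v : phi v = (v *m l) 0 0.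
  rewrite {1}[v]row_sum_delta mxE; elim/big_rec2: _ => // i t u _ <-.
  by rewrite phiD phiZ mxE.
(* After subtraction of this combination, the restriction of [f] to the zero section is a
   primitive. *)
exists l, (fun x => f (x, 0)) => x y xy.
have := fE (x, 0) (y, C x y); rewrite /= /derived_adj /= xy add0r eqxx => /(_ isT) <-.
have := fS (C x y) (y, 0); rewrite shiftE add0r phiE => ->.
by ring.
Qed.

End DerivedCover.

(** * Intermediate covers and the classes that they kill *)

Section Decomposition.

Variables (p : nat) (Y X : sgraph) (pr : Y -> X) (N : {group {perm Y}}).
Hypotheses (cY : connected Y) (covY : covering pr) (dgN : deck_group pr N).
Hypothesis abN : (p.-abelem N)%g.
Local Open Scope ring_scope.

Section Through.

Variables (Z : sgraph) (pr2 : Y -> Z) (pr1 : Z -> X).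
Hypothesis pr12 : pr =1 pr1 \o pr2.
Hypotheses (reg2 : nontrivial_regular_covering pr2).
Hypotheses (reg1 : nontrivial_regular_covering pr1).

Lemma middle_connected : connected Z.
Proof.
have [N2 [/regular_covering_byP[[[mor2 sur2] _ _] _] _]] := reg2.
move=> z z'; have [y <-] := sur2 z; have [y' <-] := sur2 z'.
move: y'; apply: (connected_ind (y0 := y)) => // u v uv c.
by apply: connect_trans c (connect1 _); apply: mor2.
Qed.

Lemma middle_covering : covering pr1.
Proof. by have [N1 [/regular_covering_byP[]]] := reg1. Qed.

(** By unique lifting, an automorphism of the connected graph [Y] over [X] is determined by one
    value, so it is the element of [N] with that value. *)
Lemma middle_deck_sub (N2 : {group {perm Y}}) : deck_group pr2 N2 -> N2 \subset N.
Proof.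
move=> [sN2 _ prN2 _]; apply/subsetP=> n nN2.
have [_ _ uniq] := covY; have [sN _ prN trans] := dgN.
have prn y : pr y = pr (n y) by rewrite !pr12 /= prN2.
have [y0 _ | noY] := pickP Y; last first.
  suff -> : n = 1%g by apply: group1.
  by apply/permP=> y; have := noY y.
have [m mN m0] := trans _ _ (prn y0).
suff -> : n = m by [].
apply/permP; apply: (connected_ind (y0 := y0)) => // y z yz nmy.
apply: (uniq (n y)); rewrite -?prn ?prN //.
  by rewrite (gautP _ (subsetP sN2 _ nN2)).
by rewrite nmy (gautP _ (subsetP sN _ mN)).
Qed.

(** Two distinct points of [Z] over the same vertex lift to points of [Y] that differ by an element
    of [N] outside [N2]. A homomorphism vanishing on [N2] but not on this element has a primitive
    that descends to [Z] and separates the two points. *)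
Lemma middle_separated : separated p pr1.
Proof.
move=> z z' ezz' sep; apply/eqP; apply: contraT => nzz'.
have [N2 [/regular_covering_byP[cov2 dg2] _]] := reg2.
have [[mor2 sur2] ex2 _] := cov2; have [y ey] := sur2 z; have [y' ey'] := sur2 z'.
have [sN _ prN trans] := dgN; have [sN2 _ prN2 trans2] := dg2.
have [|n nN def_y'] := trans y y'; first by rewrite !pr12 /= ey ey'.
have nN2 : n \notin N2.
  by apply: contra nzz' => nN2; rewrite -ey -ey' def_y' prN2.
have [phi phiM [phi0 phin]] := hom_separating abN (middle_deck_sub dg2) nN nN2.
have [c [f [fE fM]]] := hom_cochain covY dgN phiM.
have [m y1 mN2|g gE] := descend cov2 dg2 (f := f).
  by rewrite fM ?(subsetP (middle_deck_sub dg2)) // phi0 // addr0.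
have gP : primitive_along pr1 c g.
  move=> u v; have [y1 <-] := sur2 u => /ex2[y2 y12 <-].
  by rewrite -!gE fE // !pr12.
case/eqP: phin; apply: (addrI (f y)).
by rewrite -fM // -def_y' !gE ey ey' (sep _ _ gP) addr0.
Qed.

Lemma middle_exact_along (c : X -> X -> 'F_p) : exact_along pr1 c -> exact_along pr c.
Proof.
have [N2 [/regular_covering_byP[[[mor2 sur2] _ _] _] _]] := reg2.
case=> f fE; exists (f \o pr2) => y z yz /=.
by rewrite !pr12 fE //; apply: mor2.
Qed.

(** Otherwise every primitive on [Y] would be constant on the orbits of [N2], and separation would
    make [N2] trivial. *)
Lemma middle_proper :
  ~ (forall c : X -> X -> 'F_p, exact_along pr c -> exact_along pr1 c).
Proof.
move=> triv; have [N2 [/regular_covering_byP[[[mor2 _] _ _] dg2] nt2]] := reg2.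
have [_ _ prN2 _] := dg2.
have [n nN2 /eqP[]] := trivgPn _ nt2; apply/permP=> y; rewrite perm1.
apply/esym/(abelem_separated covY dgN abN) => [|c f fE].
  by rewrite !pr12 /= prN2.
have [g gE] := triv _ (ex_intro _ f fE).
have gP : primitive_along pr c (g \o pr2).
  by move=> u v uv; rewrite /= gE ?pr12 //; apply: mor2.
have := primitive_along_const cY fE gP y (n y).
by rewrite /= prN2 // => /addIr.
Qed.

End Through.

Section OntoDerived.

Variables (d : nat) (C : X -> X -> 'rV['F_p]_d).
Hypothesis C_anti : forall x y, C y x = - C x y.
Let Z := derived_graph C_anti.
Hypothesis cZ : connected Z.
Hypothesis C_pr : forall l : 'cV_d, exact_along pr (fun x y => (C x y *m l) 0 0).
Hypothesis proper : ~ forall c : X -> X -> 'F_p, exact_along pr c -> exact_along (@proj _ (derived_cover C_anti)) c.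

(** Primitives on [Y] of the components of [C] give the second coordinate of the map. An element of
    [N] changes them by a constant vector, and the elements for which it is 0 form the group of the
    upper cover. *)
Lemma derived_decomposition : exists pr2 : Y -> Z,
  pr =1 @proj _ (derived_cover C_anti) \o pr2 /\ nontrivial_regular_covering pr2.
Proof.
have [[morY surY] exY unY] := covY; have [sN free prN trans] := dgN.
have [_ exZ unZ] := derived_covering C_anti.
have [f fE] : exists f : Y -> 'rV['F_p]_d,
    forall y z, adj y z -> f z - f y = C (pr y) (pr z).
  have/fin_all_exists[g gE] (i : 'I_d) := C_pr (delta_mx i 0).
  exists (fun y => \row_i g i y) => y z yz; apply/rowP=> i.
  by rewrite !mxE gE // -colE mxE.
pose pr2 y : Z := (pr y, f y); exists pr2; split=> //.
have mor2 : graph_morphism pr2.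
  by move=> y z yz; rewrite /= /derived_adj /= morY // -fE // addrC subrK eqxx.
have sur2 z : exists y, pr2 y = z.
  have [y0 _] := surY z.1.
  move: z; apply: (connected_ind (y0 := pr2 y0)) => //; first by exists y0.
  move=> z z' zz' [y def_z]; have [|y' yy' ey'] := exY y z'.1.
    by case/andP: zz'; rewrite -def_z.
  exists y'; apply: (unZ z) => //; rewrite -def_z //.
  exact: mor2.
have cov2 : covering pr2.
  split=> [|y z yz|y z z' yz yz' [ez _]]; first by split.
    have [|y' yy' ey'] := exY y z.1; first by case/andP: yz.
    by exists y' => //; apply: (unZ (pr2 y)) => //; apply: mor2.
  exact: unY yz yz' ez.
have fconst (n : {perm Y}) y z : n \in N -> f (n y) - f y = f (n z) - f z.
  move=> nN; move: z; apply: (connected_ind (y0 := y)) => // u v uv ->.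
  have E : f (n v) - f (n u) = f v - f u.
    by rewrite !fE ?(gautP _ (subsetP sN _ nN)) // !prN.
  have -> : f (n v) = f v - f u + f (n u) by rewrite -E subrK.
  by rewrite [RHS]addrAC [f v - f u]addrC addrK addrC.
have grN : group_set [set n in N | [forall y, f (n y) == f y]].
  apply/group_setP; split.
    by rewrite inE group1; apply/'forall_eqP=> y; rewrite perm1.
  move=> m n /setIdP[mN /'forall_eqP mE] /setIdP[nN /'forall_eqP nE].
  by rewrite inE groupM //; apply/'forall_eqP=> y; rewrite permM nE mE.
pose N2 := Group grN.
have dg2 : deck_group pr2 N2.
  split=> [|n y /setIdP[nN _]|n y /setIdP[nN /'forall_eqP nE]|y z [eyz fyz]].
  - by apply/subsetP=> n /setIdP[nN _]; apply: (subsetP sN).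
  - exact: free.
  - by rewrite /pr2 prN ?nE.
  have [n nN def_z] := trans _ _ eyz; exists n => //; rewrite inE nN.
  apply/forallP=> u; rewrite -subr_eq0 (fconst n u y) // -def_z.
  by rewrite fyz subrr.
exists N2; split; first by apply/regular_covering_byP.
(* If that group were trivial, the map would be injective and every primitive on [Y] could be
   transported to the derived graph. *)
apply/eqP=> N21; apply: proper => c [h hE].
have inj2 : injective pr2.
  move=> y z eyz; have [_ _ _ trans2] := dg2; have [n] := trans2 _ _ eyz.
  by rewrite [_ \in _]/(n \in (N2 : {set _})) N21 => /set1gP->; rewrite perm1.
have /fin_all_exists[s sK] := sur2.
exists (h \o s) => z z' zz' /=.
have pr_s u : pr (s u) = u.1 by rewrite -[in RHS](sK u).
rewrite -!pr_s; apply: hE.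
rewrite -(sK z) -(sK z') in zz'; have [|y yz ey] := exY (s z) (pr (s z')).
  by case/andP: zz'.
suff -> : s z' = y by [].
apply: inj2; apply: (unZ (pr2 (s z))) => //; exact: mor2.
Qed.

End OntoDerived.
End Decomposition.

(** * The automorphism group of the Möbius-Kantor graph *)

Section Tables.

(* A table is the list of images of 0, ..., 15. *)
Definition table_mul (s t : seq nat) : seq nat := [seq nth 0 t k | k <- s].

Definition table_id : seq nat := iota 0 16.

Definition table_of (s : {perm GP83}) : seq nat := [seq nat_of_ord (s x) | x <- enum 'I_16].

Definition perm_of (t : seq nat) : {perm GP83} :=
  insubd (1%g : {perm GP83}) [ffun x : 'I_16 => inord (nth 0 t x)].

Definition is_table (t : seq nat) : bool :=
  [&& size t == 16, uniq t & all (fun k => k < 16) t].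

Lemma nth_table_of s (x : 'I_16) : nth 0 (table_of s) x = s x.
Proof. by rewrite (nth_map x) ?nth_ord_enum // size_enum_ord. Qed.

Lemma size_table_of s : size (table_of s) = 16.
Proof. by rewrite size_map size_enum_ord. Qed.

Lemma table_of_inj : injective table_of.
Proof.
move=> s t est; apply/permP=> x; apply: val_inj => /=.
by rewrite -!nth_table_of est.
Qed.

Lemma table_of1 : table_of 1 = table_id.
Proof.
by rewrite /table_of (eq_map (g := val)) ?val_enum_ord // => x; rewrite perm1.
Qed.

Lemma table_ofM s t : table_of (s * t) = table_mul (table_of s) (table_of t).
Proof.
rewrite /table_mul /table_of -map_comp; apply: eq_map => x /=.
by rewrite -/(table_of t) nth_table_of permM.
Qed.

Lemma perm_ofE t (x : 'I_16) : is_table t -> perm_of t x = nth 0 t x :> nat.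
Proof.
case/and3P=> /eqP sz_t uniq_t /allP lt_t.
have lt k : k < 16 -> nth 0 t k < 16 by move=> k16; apply: lt_t; rewrite mem_nth ?sz_t.
rewrite /perm_of -pvalE val_insubd ifT ?ffunE ?inordK ?lt //.
apply/injectiveP=> y z; rewrite !ffunE => /(congr1 val); rewrite /= !inordK ?lt //.
by move/eqP; rewrite nth_uniq ?sz_t // => /eqP; apply: val_inj.
Qed.

Lemma perm_ofK t : is_table t -> table_of (perm_of t) = t.
Proof.
move=> tabt; apply: (@eq_from_nth _ 0).
  by rewrite size_table_of; case/and3P: tabt => /eqP->.
move=> k; rewrite size_table_of => k16.
by rewrite (nth_table_of _ (Ordinal k16)) perm_ofE.
Qed.

(** Breadth-first closure, with [fresh] the last layer. Only soundness is proved: too small a bound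
    [n] merely loses elements, and a membership test would then fail. *)
Fixpoint table_bfs (n : nat) (gens seen fresh : seq (seq nat)) : seq (seq nat) :=
  if n isn't n'.+1 then seen else
  let fresh' := undup [seq u <- [seq table_mul s t | s <- fresh, t <- gens] | u \notin seen] in
  table_bfs n' gens (fresh' ++ seen) fresh'.

Definition table_span (n : nat) (gens : seq (seq nat)) : seq (seq nat) :=
  table_bfs n gens [:: table_id] [:: table_id].

Lemma table_spanP n gens (G : {group {perm GP83}}) s :
  (forall t, t \in gens -> exists2 g, g \in G & table_of g = t) ->
  table_of s \in table_span n gens -> s \in G.
Proof.
move=> gensG; pose inG t := exists2 g, g \in G & table_of g = t.
have id1 t : t \in [:: table_id] -> inG t.
  by rewrite inE => /eqP->; exists 1%g; rewrite ?group1 ?table_of1.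
suff IH seen fresh : (forall t, t \in seen -> inG t) -> (forall t, t \in fresh -> inG t) ->
    forall t, t \in table_bfs n gens seen fresh -> inG t.
  by case/(IH _ _ id1 id1)=> g gG /table_of_inj<-.
elim: n seen fresh => [|n IHn] seen fresh sG fG //=.
set fresh' := undup _; have f'G t : t \in fresh' -> inG t.
  rewrite mem_undup mem_filter => /andP[_ /allpairsP[[u v] [/= uL vg ->]]].
  have [g gG <-] := fG _ uL; have [h hG <-] := gensG _ vg.
  by exists (g * h)%g; rewrite ?groupM ?table_ofM.
by apply: IHn => // t; rewrite mem_cat => /orP[/f'G | /sG].
Qed.

End Tables.

Definition gp_adj (i j : nat) : bool := GP83_edge i.+1 j.+1 || GP83_edge j.+1 i.+1.

Lemma GP83_adjE (x y : GP83) : adj x y = gp_adj x y.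
Proof. by []. Qed.

Definition is_aut_table (t : seq nat) : bool :=
  all (fun i => all (fun j => gp_adj (nth 0 t i) (nth 0 t j) == gp_adj i j) table_id) table_id.

(** Backtracking search: partial automorphisms defined below [k] are extended by every admissible
    image of [k]. *)
Definition aut_step (ms : seq (seq nat)) (k : nat) : seq (seq nat) :=
  [seq rcons m x | m <- ms, x <- [seq x <- table_id | (x \notin m) &&
    all (fun j => gp_adj j k == gp_adj (nth 0 m j) x) (iota 0 k)]].

Definition aut_tables : seq (seq nat) := foldl aut_step [:: [::]] table_id.

Lemma ord_table_id (x : 'I_16) : (x : nat) \in table_id.
Proof. by rewrite mem_iota /= ltn_ord. Qed.

Lemma perm_of_gaut t : is_table t -> is_aut_table t -> perm_of t \in gaut GP83.
Proof.
move=> tabt /allP autt; apply/gautP=> x y; rewrite !GP83_adjE !perm_ofE //.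
by have /allP/(_ _ (ord_table_id y))/eqP := autt _ (ord_table_id x).
Qed.

Lemma aut_tables_complete (s : {perm GP83}) :
  s \in gaut GP83 -> table_of s \in aut_tables.
Proof.
move/gautP=> sE.
have tk k : k <= 16 -> take k (table_of s) \in foldl aut_step [:: [::]] (iota 0 k).
  elim: k => [|k IHk] k16; first by rewrite take0.
  rewrite -addn1 iotaD foldl_cat /= add0n addn1 (take_nth 0) ?size_table_of //.
  apply/allpairsPdep; exists (take k (table_of s)), (nth 0 (table_of s) k).
  split=> //; first exact/IHk/ltnW.
  rewrite mem_filter (nth_table_of _ (Ordinal k16)) ord_table_id andbT.
  apply/andP; split.
    apply/negP=> /(nthP 0)[j]; rewrite size_take size_table_of k16 => jk.
    rewrite nth_take // (nth_table_of _ (Ordinal (ltn_trans jk k16))).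
    by move/val_inj/perm_inj=> [] ejk; rewrite ejk ltnn in jk.
  apply/allP=> j; rewrite mem_iota /= => jk.
  rewrite nth_take // (nth_table_of _ (Ordinal (ltn_trans jk k16))).
  by rewrite -[gp_adj (val _) _]/(adj (s _ : GP83) (s _)) sE.
by have := tk 16 isT; rewrite take_oversize // size_table_of.
Qed.

Definition aut_list : seq (seq nat) := Eval vm_compute in aut_tables.

Lemma mem_aut_list (s : {perm GP83}) : s \in gaut GP83 -> table_of s \in aut_list.
Proof.
have <- : aut_tables = aut_list by vm_compute.
exact: aut_tables_complete.
Qed.

Definition tab_i := [:: 13; 8; 11; 14; 9; 12; 15; 10; 5; 0; 3; 6; 1; 4; 7; 2].
Definition tab_r := [:: 6; 14; 11; 3; 2; 10; 15; 7; 5; 9; 8; 4; 1; 13; 12; 0].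
Definition tab_2 := [:: 3; 11; 8; 0; 7; 15; 12; 4; 2; 14; 13; 1; 6; 10; 9; 5].
Definition tab_3 := [:: 10; 15; 12; 9; 14; 11; 8; 13; 2; 7; 4; 1; 6; 3; 0; 5].

Definition aut_i : {perm GP83} := perm_of tab_i.
Definition aut_r : {perm GP83} := perm_of tab_r.
Definition aut_2 : {perm GP83} := perm_of tab_2.
Definition aut_3 : {perm GP83} := perm_of tab_3.

(* [<<aut_i, aut_r>>] is isomorphic to SL(2,3) and regular on the edges; it is
   contained in every edge-transitive group of automorphisms. *)
Definition tabs_H : seq (seq nat) := Eval vm_compute in table_span 5 [:: tab_i; tab_r].

Definition tabs_coset (t : seq nat) : seq (seq nat) := [seq table_mul h t | h <- tabs_H].

Lemma table_of_i : table_of aut_i = tab_i. Proof. exact: perm_ofK. Qed.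
Lemma table_of_r : table_of aut_r = tab_r. Proof. exact: perm_ofK. Qed.
Lemma table_of_2 : table_of aut_2 = tab_2. Proof. exact: perm_ofK. Qed.
Lemma table_of_3 : table_of aut_3 = tab_3. Proof. exact: perm_ofK. Qed.

Lemma aut_i_gaut : aut_i \in gaut GP83. Proof. by apply: perm_of_gaut; vm_compute. Qed.
Lemma aut_r_gaut : aut_r \in gaut GP83. Proof. by apply: perm_of_gaut; vm_compute. Qed.
Lemma aut_2_gaut : aut_2 \in gaut GP83. Proof. by apply: perm_of_gaut; vm_compute. Qed.
Lemma aut_3_gaut : aut_3 \in gaut GP83. Proof. by apply: perm_of_gaut; vm_compute. Qed.

Definition group_H : {group {perm GP83}} := <<[set aut_i; aut_r]>>%G.

Lemma tabs_H_gen (G : {group {perm GP83}}) (s : {perm GP83}) :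
  aut_i \in G -> aut_r \in G -> table_of s \in tabs_H -> s \in G.
Proof.
have -> : tabs_H = table_span 5 [:: tab_i; tab_r] by vm_compute.
move=> iG rG; apply: table_spanP => t; rewrite !inE.
by case/orP=> /eqP->; [exists aut_i | exists aut_r]; rewrite ?table_of_i ?table_of_r.
Qed.

Lemma tabs_HP t : t \in tabs_H -> exists2 h, h \in group_H & table_of h = t.
Proof.
have iH : aut_i \in group_H by rewrite mem_gen // set21.
have rH : aut_r \in group_H by rewrite mem_gen // set22.
have /allP tabsH : all is_table tabs_H by vm_compute.
move=> tH; exists (perm_of t); last by rewrite perm_ofK ?tabsH.
by apply: tabs_H_gen; rewrite ?perm_ofK ?tabsH.
Qed.

Lemma tabs_cosetP (s g : {perm GP83}) : table_of s \in tabs_coset (table_of g) ->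
  exists2 h, h \in group_H & s = (h * g)%g.
Proof.
case/mapP=> t /tabs_HP[h hH <-] eqs; exists h => //.
by apply: table_of_inj; rewrite table_ofM.
Qed.

Lemma aut_list_cosets : all (fun t => [|| t \in tabs_H, t \in tabs_coset tab_2,
  t \in tabs_coset tab_3 | t \in tabs_coset (table_mul tab_2 tab_3)]) aut_list.
Proof. by vm_compute. Qed.

Lemma gaut_cosets (s : {perm GP83}) : s \in gaut GP83 ->
  exists2 h, h \in group_H & [\/ s = h, s = (h * aut_2)%g, s = (h * aut_3)%g |
    s = (h * (aut_2 * aut_3))%g].
Proof.
move/mem_aut_list=> /(allP aut_list_cosets)/or4P[].
- by case/tabs_HP=> h hH /table_of_inj<-; exists h; [|constructor 1].
- by rewrite -table_of_2 => /tabs_cosetP[h hH ->]; exists h; [|constructor 2].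
- by rewrite -table_of_3 => /tabs_cosetP[h hH ->]; exists h; [|constructor 3].
- rewrite -table_of_2 -table_of_3 -table_ofM => /tabs_cosetP[h hH ->].
  by exists h; [|constructor 4].
Qed.

Definition vtx (k : nat) : GP83 := inord k.

(** The graph is bipartite: moving 0 to its neighbour 1 exchanges the colour classes, as t_2 and t_3
    do, whereas H and the coset of t_2 t_3 preserve them. *)
Lemma aut_list_swap : all (fun t => (nth 0 t 0 == 1) ==>
  (t \in tabs_coset tab_2) || (t \in tabs_coset tab_3)) aut_list.
Proof. by vm_compute. Qed.

Lemma vtxE k : k < 16 -> vtx k = k :> nat.
Proof. by move=> k16; rewrite /= inordK. Qed.

Lemma gaut_swap (s : {perm GP83}) : s \in gaut GP83 -> s (vtx 0) = vtx 1 ->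
  exists2 h, h \in group_H & s = (h * aut_2)%g \/ s = (h * aut_3)%g.
Proof.
move/mem_aut_list=> /(allP aut_list_swap)/implyP imp s0.
have /imp/orP[] : nth 0 (table_of s) 0 == 1.
- by rewrite -{2}(vtxE (isT : 0 < 16)) nth_table_of s0 vtxE.
- by rewrite -table_of_2 => /tabs_cosetP[h hH ->]; exists h; [|left].
- by rewrite -table_of_3 => /tabs_cosetP[h hH ->]; exists h; [|right].
Qed.

Lemma ord16P (x : GP83) : x = vtx x.
Proof. by apply: val_inj; rewrite /= inordK. Qed.

Lemma vertices_H2 : all (fun t => is_table t && all (fun k =>
  has (fun u => nth 0 u 0 == k) (tabs_H ++ tabs_coset t)) table_id) [:: tab_2; tab_3].
Proof. by vm_compute. Qed.

Lemma vertex_transitive_H2 (G : {group {perm GP83}}) t : t \in [:: tab_2; tab_3] ->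
  aut_i \in G -> aut_r \in G -> perm_of t \in G ->
  forall x, exists2 a, a \in G & a (vtx 0) = x.
Proof.
move=> t23 iG rG tG x.
have /andP[tabt /allP/(_ _ (ord_table_id x))/hasP[u]] := allP vertices_H2 _ t23.
rewrite mem_cat -{2}(vtxE (isT : 0 < 16)) => uH /eqP ux.
have [a aG eu] : exists2 a, a \in G & table_of a = u.
  have HG h : h \in group_H -> h \in G.
    by apply/subsetP; rewrite gen_subG subUset !sub1set iG.
  case/orP: uH => [/tabs_HP[h hH <-] | /mapP[v /tabs_HP[h hH <-] ->]].
    by exists h; rewrite ?HG.
  exists (h * perm_of t)%g; first exact: groupM (HG _ hH) tG.
  by rewrite table_ofM perm_ofK.
by exists a => //; apply: val_inj; rewrite /= -ux -eu nth_table_of.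
Qed.

Lemma GP83_edgeP (e : {set GP83}) : e \in edges GP83 ->
  exists x y, adj x y /\ e = [set x; y].
Proof.
by case/imsetP=> [[x y]]; rewrite inE /= => xy ->; exists x, y.
Qed.

Lemma edge_vtx i j : i < 16 -> j < 16 -> gp_adj i j ->
  [set vtx i; vtx j] \in edges GP83.
Proof.
move=> i16 j16 ij; apply/imsetP; exists (vtx i, vtx j); rewrite // inE.
by rewrite -(vtxE i16) -(vtxE j16) in ij.
Qed.

Lemma edges_H : all (fun i => all (fun j => gp_adj i j ==>
    has (fun u => (nth 0 u 0 == i) && (nth 0 u 1 == j) ||
                  (nth 0 u 0 == j) && (nth 0 u 1 == i)) tabs_H) table_id) table_id.
Proof. by vm_compute. Qed.

Lemma edge_transitive_H (G : {group {perm GP83}}) : aut_i \in G -> aut_r \in G ->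
  forall e, e \in edges GP83 ->
  exists2 a : {perm GP83}, a \in G & a @: [set vtx 0; vtx 1] = e.
Proof.
move=> iG rG e /GP83_edgeP[x [y [xy ->]]].
have /allP/(_ _ (ord_table_id x))/allP/(_ _ (ord_table_id y)) := edges_H.
rewrite -GP83_adjE xy => /hasP[u /tabs_HP[h hH <-]].
have HG : h \in G by apply: (subsetP _ _ hH); rewrite gen_subG subUset !sub1set iG.
have hE k z : k < 16 -> nth 0 (table_of h) k == z :> nat -> h (vtx k) = z :> nat.
  by move=> k16 /eqP <-; rewrite -[X in nth 0 _ X](vtxE k16) nth_table_of.
case/orP=> /andP[/hE h0 /hE h1]; exists h => //; rewrite imsetU1 imset_set1.
  by congr [set _; _]; apply: val_inj; [apply: h0 | apply: h1].
by rewrite setUC; congr [set _; _]; apply: val_inj; [apply: h1 | apply: h0].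
Qed.

Definition tabs_to (i j : nat) : seq (seq nat) :=
  [seq t <- aut_list | (nth 0 t 0 == i) && (nth 0 t 1 == j) ||
                       (nth 0 t 0 == j) && (nth 0 t 1 == i)].

(** The targets are the two other edges at 0 and one more edge at 1. An edge-transitive group
    contains automorphisms taking the edge {0, 1} to each of them, and any such three already
    generate H; no classification of subgroups is involved. *)
Lemma three_edges_span_H : all (fun t1 => all (fun t2 => all (fun t3 =>
    let L := table_span 12 [:: t1; t2; t3] in (tab_i \in L) && (tab_r \in L))
  (tabs_to 1 9)) (tabs_to 0 7)) (tabs_to 0 8).
Proof. by vm_cast_no_check (erefl true). Qed.

Lemma edge_transitive_contains_H (G : {group {perm GP83}}) : G \subset gaut GP83 ->
  (forall e e', e \in edges GP83 -> e' \in edges GP83 ->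
     exists2 a : {perm GP83}, a \in G & a @: e = e') ->
  aut_i \in G /\ aut_r \in G.
Proof.
move=> sG trG.
have toP i j : i < 16 -> j < 16 -> gp_adj i j ->
    exists2 a, a \in G & table_of a \in tabs_to i j.
  move=> i16 j16 ij; have eX := edge_vtx i16 j16 ij.
  have [a aG] := trG _ _ (@edge_vtx 0 1 isT isT isT) eX; rewrite imsetU1 imset_set1 => ea; exists a => //.
  rewrite mem_filter mem_aut_list ?(subsetP sG) // andbT.
  have aE k : k < 16 -> nth 0 (table_of a) k = a (vtx k).
    by move=> k16; rewrite -{1}(vtxE k16) nth_table_of.
  rewrite !aE //.
  have a01 : a (vtx 0) != a (vtx 1).
    by rewrite (inj_eq perm_inj) -val_eqE /= !inordK.
  rewrite -(vtxE i16) -(vtxE j16).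
  have: a (vtx 0) \in [set vtx i; vtx j] by rewrite -ea set21.
  have: a (vtx 1) \in [set vtx i; vtx j] by rewrite -ea set22.
  case/set2P=> e1 /set2P[] e0; rewrite e0 e1 ?eqxx ?orbT // in a01 *.
have [a1 a1G] := toP 0 8 isT isT isT.
have [a2 a2G] := toP 0 7 isT isT isT.
have [a3 a3G] := toP 1 9 isT isT isT.
move=> m3 m2 m1; have /andP[iL rL] := allP (allP (allP three_edges_span_H _ m1) _ m2) _ m3.
have gG t : t \in [:: table_of a1; table_of a2; table_of a3] ->
    exists2 g, g \in G & table_of g = t.
  by rewrite !inE => /or3P[]/eqP->; [exists a1 | exists a2 | exists a3].
by split; apply: (table_spanP (n := 12) gG); [rewrite table_of_i | rewrite table_of_r].
Qed.

(** * Coordinates on the first cohomology group *)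

Section TreeCoordinates.
Local Open Scope ring_scope.

(* [tree_path x] is the path from 0 to [x] in a spanning tree, and [cotree] lists
   the nine remaining edges; a cochain supported on the latter is determined by
   its class in H^1. *)
Definition tree_paths : seq (seq nat) := [:: [:: 0]; [:: 0; 1]; [:: 0; 1; 2];
  [:: 0; 1; 2; 3]; [:: 0; 1; 2; 3; 4]; [:: 0; 7; 6; 5]; [:: 0; 7; 6]; [:: 0; 7];
  [:: 0; 8]; [:: 0; 1; 9]; [:: 0; 1; 2; 10]; [:: 0; 8; 11]; [:: 0; 1; 9; 12];
  [:: 0; 8; 13]; [:: 0; 1; 9; 14]; [:: 0; 7; 15]]%N.

Definition cotree : seq (nat * nat) := [:: (3, 11); (4, 5); (4, 12); (5, 13); (6, 14);
  (10, 13); (10, 15); (11, 14); (12, 15)]%N.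

Definition tree_edges : seq (nat * nat) := [:: (0, 1); (1, 2); (2, 3); (3, 4); (6, 5);
  (7, 6); (0, 7); (0, 8); (1, 9); (2, 10); (8, 11); (9, 12); (8, 13); (9, 14); (7, 15)]%N.

Definition potential (R : zmodType) (c : nat -> nat -> R) (x : nat) : R :=
  let s := nth [::] tree_paths x in
  foldr (fun e r => c e.1 e.2 + r) 0 (zip s (behead s)).

(** The sum of [c] round the fundamental cycle of the [k]-th cotree edge. *)
Definition cotree_value (R : zmodType) (c : nat -> nat -> R) (k : nat) : R :=
  let e := nth (0, 0)%N cotree k in
  potential c e.1 + c e.1 e.2 - potential c e.2.

Definition cotree_cochain (w : seq int) (x y : nat) : int :=
  foldr (fun ew r => (if (x, y) == ew.1 then ew.2
                      else if (y, x) == ew.1 then - ew.2 else 0) + r) 0 (zip cotree w).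

(** A primitive vanishing at 0 can only be the potential along the tree, so it suffices to test that
    one. *)
Definition exactb (c : nat -> nat -> int) : bool :=
  let g := [seq potential c x | x <- table_id] in
  all (fun e => (nth 0 g e.2 - nth 0 g e.1 == c e.1 e.2) &&
                (nth 0 g e.1 - nth 0 g e.2 == c e.2 e.1)) (tree_edges ++ cotree).

Lemma GP83_arcP (P : nat -> nat -> Prop) :
  (forall e, e \in tree_edges ++ cotree -> P e.1 e.2 /\ P e.2 e.1) ->
  forall x y : GP83, adj x y -> P x y.
Proof.
have chk : all (fun i => all (fun j => gp_adj i j ==>
    ((i, j) \in tree_edges ++ cotree) || ((j, i) \in tree_edges ++ cotree))
    table_id) table_id by vm_compute.
move=> PE x y; rewrite GP83_adjE; move: (ord_table_id x) (ord_table_id y).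
move: (nat_of_ord x) (nat_of_ord y) => i j iT jT ij.
have /allP/(_ _ iT)/allP/(_ _ jT)/implyP/(_ ij) := chk.
by case/orP=> /PE[].
Qed.

Section Field.

Variable p : nat.
Local Notation F := 'F_p.

Lemma exactb_exact (c : nat -> nat -> int) :
  exactb c -> exact (fun x y : GP83 => (c x y)%:~R : F).
Proof.
move/allP=> chk; exists (fun x : GP83 => (potential c x)%:~R) => x y xy.
rewrite -intrB; congr _%:~R => /=; move: x y xy.
apply: (GP83_arcP (P := fun i j => potential c j - potential c i = c i j)) => e eE.
have : (e.1 < 16)%N && (e.2 < 16)%N.
  by apply: (allP (a := fun e => (e.1 < 16)%N && (e.2 < 16)%N)) eE; vm_compute.
case/andP=> e1 e2; have /andP[/eqP H1 /eqP H2] := chk e eE.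
by rewrite !(nth_map 0%N) ?size_iota // !nth_iota // in H1 H2.
Qed.

Lemma exact_ext (X : sgraph) (c c' : X -> X -> F) :
  (forall x y, adj x y -> c x y = c' x y) -> exact c -> exact c'.
Proof. by move=> E [g gE]; exists g => x y xy; rewrite gE ?E. Qed.

Lemma exact_along0 (Y X : sgraph) (pr : Y -> X) : exact_along pr (fun _ _ => 0 : F).
Proof. by exists (fun=> 0) => x y xy; rewrite subr0. Qed.

Lemma exact_along_comb (Y X : sgraph) (pr : Y -> X) (c c' : X -> X -> F) s t :
  exact_along pr c -> exact_along pr c' ->
  exact_along pr (fun x y => s * c x y + t * c' x y).
Proof.
move=> [g gE] [g' gE']; exists (fun x => s * g x + t * g' x) => x y xy.
by rewrite -gE // -gE' //; ring.
Qed.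

Lemma exact_along_sum (Y X : sgraph) (pr : Y -> X) n (v : 'I_n -> F) (c : 'I_n -> X -> X -> F) :
  (forall i, exact_along pr (c i)) -> exact_along pr (fun x y => \sum_i v i * c i x y).
Proof.
move=> /fin_all_exists[g gE]; exists (fun y => \sum_i v i * g i y) => y z yz.
by rewrite -sumrB; apply: eq_bigr => i _; rewrite -mulrBr gE.
Qed.

Lemma exact_cotree_value (c : nat -> nat -> F) k :
  (k < 9)%N -> exact (fun x y : GP83 => c x y) -> cotree_value c k = 0.
Proof.
move=> k9 [g gE].
pose h i := g (vtx i).
have hE i j : (i < 16)%N -> (j < 16)%N -> gp_adj i j -> c i j = h j - h i.
  move=> i16 j16 ij; rewrite gE ?vtxE //.
  by rewrite GP83_adjE !vtxE.
by do 9?[case: k k9 => [_ | k k9]; first by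
  rewrite /cotree_value /potential /= !hE //; ring].
Qed.

Definition unit_row (k : nat) : seq int := mkseq (fun j => (j == k)%:R) 9.

Variable base : seq (seq int).

Definition base_cochain (j : nat) : nat -> nat -> int := cotree_cochain (nth [::] base j).

Definition beta (v : seq F) (x y : GP83) : F :=
  \sum_(j < 9) v`_j * (base_cochain j x y)%:~R.

Definition lin_row (s t : F) (u v : seq F) : seq F :=
  mkseq (fun j => s * u`_j + t * v`_j) 9.

Definition act_row (M : seq (seq int)) (v : seq F) : seq F :=
  mkseq (fun j => \sum_(i < 9) v`_i * (nth 0 (nth [::] M i) j)%:~R) 9.

Lemma beta_ext u v x y : (forall j : 'I_9, u`_j = v`_j) -> beta u x y = beta v x y.
Proof. by move=> E; apply: eq_bigr => j _; rewrite E. Qed.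

Lemma beta_lin s t u v x y :
  beta (lin_row s t u v) x y = s * beta u x y + t * beta v x y.
Proof.
rewrite /beta !mulr_sumr -big_split /=; apply: eq_bigr => j _.
by rewrite nth_mkseq //; ring.
Qed.

Lemma cotree_cochain_anti w x y : cotree_cochain w y x = - cotree_cochain w x y.
Proof.
have lt : all (fun e : nat * nat => e.1 < e.2)%N cotree by [].
rewrite /cotree_cochain; elim: cotree lt w => [|[a b] s IHs] /= lt [|k w] /=; rewrite ?oppr0 //.
case/andP: lt => lt_ab lt_s; rewrite opprD IHs //; congr (_ + _).
case: eqP => [[-> ->] | _].
  by rewrite xpair_eqE (gtn_eqF lt_ab) /= opprK.
by case: eqP; rewrite ?opprK ?oppr0.
Qed.

Lemma beta_anti v x y : beta v y x = - beta v x y.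
Proof.
rewrite /beta -sumrN; apply: eq_bigr => j _.
by rewrite /base_cochain cotree_cochain_anti rmorphN mulrN.
Qed.

(** Equality is only asked up to coboundaries; [den] clears the halves in the matrix of [aut_r], so
    the test takes place over the integers and serves all primes. *)
Definition act_check (t : seq nat) (den : int) (M : seq (seq int)) : bool :=
  all (fun i => exactb (fun x y => den * base_cochain i (nth 0%N t x) (nth 0%N t y) -
    foldr (fun j r => nth 0 (nth [::] M i) j * base_cochain j x y + r) 0 (iota 0 9)))
  (iota 0 9).

Lemma pullback_beta (a : {perm GP83}) t den M v :
  table_of a = t -> act_check t den M ->
  exact (fun x y => den%:~R * pullback a (beta v) x y - beta (act_row M v) x y).
Proof.
move=> ta /allP chk.
have ex (i : 'I_9) : exact (fun x y : GP83 =>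
    (den%:~R * (base_cochain i (a x) (a y))%:~R -
     \sum_(j < 9) (nth 0 (nth [::] M i) j)%:~R * (base_cochain j x y)%:~R) : F).
  have /chk/exactb_exact : (i : nat) \in iota 0 9 by rewrite mem_iota /=.
  apply: exact_ext => x y _; rewrite -ta !nth_table_of rmorphB rmorphM /=; congr (_ - _).
  by rewrite !(rmorphD, rmorphM) rmorph0 !big_ord_recl big_ord0.
apply: exact_ext (exact_along_sum (fun i : 'I_9 => v`_i) ex) => x y _.
rewrite /pullback /beta mulr_sumr.
under [in RHS]eq_bigr do rewrite mulrCA.
under [X in _ = _ - X]eq_bigr => j _ do rewrite nth_mkseq // mulr_suml.
rewrite exchange_big -sumrB /=; apply: eq_bigr => i _.
by rewrite mulrBr mulr_sumr; congr (_ - _); apply: eq_bigr => j _; rewrite mulrA.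
Qed.

Lemma potential_sum n (w : 'I_n -> F) (b : 'I_n -> nat -> nat -> int) x :
  potential (fun x y => \sum_j w j * (b j x y)%:~R) x = \sum_j w j * (potential (b j) x)%:~R.
Proof.
rewrite /potential; elim: (zip _ _) => [|e s IHs] /=.
  by rewrite big1 // => j _; rewrite mulr0.
by rewrite IHs -big_split /=; apply: eq_bigr => j _; rewrite rmorphD mulrDr.
Qed.

Lemma cotree_value_sum n (w : 'I_n -> F) (b : 'I_n -> nat -> nat -> int) k :
  cotree_value (fun x y => \sum_j w j * (b j x y)%:~R) k =
  \sum_j w j * (cotree_value (b j) k)%:~R.
Proof.
rewrite /cotree_value !potential_sum -big_split -sumrB /=; apply: eq_bigr => j _.
by rewrite rmorphB rmorphD /=; ring.
Qed.

End Field.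
Definition std_base : seq (seq int) := mkseq unit_row 9.

Definition edge_list := tree_edges ++ cotree.

Lemma std_cochain_delta : all (fun k => all (fun e =>
  base_cochain std_base k e.1 e.2 == (nth (0, 0)%N cotree k == e)%:R) edge_list) (iota 0 9).
Proof. by vm_compute. Qed.

Lemma std_betaE p (v : seq 'F_p) (e : nat * nat) : e \in edge_list ->
  \sum_(j < 9) v`_j * (base_cochain std_base j e.1 e.2)%:~R =
  if e \in cotree then v`_(index e cotree) else 0.
Proof.
move=> eE; have delta (j : 'I_9) : (base_cochain std_base j e.1 e.2)%:~R =
    (nth (0, 0)%N cotree j == e)%:R :> 'F_p.
  have /(allP std_cochain_delta)/allP/(_ _ eE)/eqP-> : (j : nat) \in iota 0 9.
    by rewrite mem_iota /=.
  by case: (_ == _).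
under eq_bigr do rewrite delta.
case: ifPn => [eC | neC]; last first.
  rewrite big1 // => j _; case: eqP => [E | _]; rewrite ?mulr0 //.
  by rewrite -E mem_nth in neC.
have e9 : (index e cotree < 9)%N by rewrite (index_mem e cotree).
rewrite (bigD1 (Ordinal e9)) //= nth_index // eqxx mulr1 big1 ?addr0 // => j nj.
rewrite -(nth_index (0, 0)%N eC) nth_uniq //.
by rewrite -val_eqE /= in nj; rewrite (negbTE nj) mulr0.
Qed.

(** Subtracting the coboundary of the potential makes the cochain vanish on the tree and leaves, on
    each cotree edge, the sum round its cycle. *)
Lemma exact_std p (c : GP83 -> GP83 -> 'F_p) :
  (forall x y, adj x y -> c y x = - c x y) ->
  exists v, exact (fun x y => c x y - beta std_base v x y).
Proof.
move=> anti; pose c' i j := c (vtx i) (vtx j).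
have anti' e : e \in edge_list -> c' e.2 e.1 = - c' e.1 e.2.
  have /allP chk : all (fun e => [&& e.1 < 16, e.2 < 16 & gp_adj e.1 e.2]%N) edge_list.
    by vm_compute.
  by case/chk/and3P=> e1 e2 ee; rewrite /c' anti // GP83_adjE !vtxE.
exists (mkseq (cotree_value c') 9), (fun x : GP83 => potential c' x) => x y xy /=.
rewrite [c x y](_ : _ = c' x y); last by rewrite /c' -!ord16P.
move: x y xy; pose b i j : 'F_p := \sum_(k < 9) (mkseq (cotree_value c') 9)`_k *
  (base_cochain std_base k i j)%:~R.
apply: (GP83_arcP (P := fun i j => potential c' j - potential c' i = c' i j - b i j)).
move=> e eE; suff H : potential c' e.2 - potential c' e.1 = c' e.1 e.2 - b e.1 e.2.
  split=> //; rewrite -opprB H anti' //.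
  suff -> : b e.2 e.1 = - b e.1 e.2 by rewrite opprB opprK addrC.
  rewrite /b -sumrN; apply: eq_bigr => j _.
  by rewrite /base_cochain cotree_cochain_anti rmorphN mulrN.
rewrite /b std_betaE //; case: ifPn => [eC | neC].
  have e9 : (index e cotree < 9)%N by rewrite (index_mem e cotree).
  by rewrite nth_mkseq // /cotree_value nth_index //; ring.
have {neC} : e \in tree_edges.
  by move: eE; rewrite mem_cat (negbTE neC) orbF.
rewrite !inE; do ?[case/orP]; move/eqP-> => /=; rewrite /potential /=; ring.
Qed.

End TreeCoordinates.

(** * The action on H^1 in coordinates: odd primes, then the prime 2 *)

Section AdaptedBasis.
Local Open Scope ring_scope.

(* Over Z[1/2], H^1 is the sum of three sublattices stable under Aut X, spanned
   by the first two, the next four and the last three rows: on the first,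
   [aut_i] is trivial and [aut_r] has order 3; the second is a copy of the
   quaternions on which [aut_i] is the left multiplication by i and [aut_3]
   the right multiplication by i; on the third, the action is monomial. *)
Definition adapted_base : seq (seq int) := [::
  [:: -1; 0; 1; -1; 1; 0; 1; 1; 0]; [:: 1; 2; 0; 0; -1; 1; 0; 0; 1];
  [:: 1; 0; 0; 0; 0; 0; 0; -1; 1]; [:: -1; 0; -1; -1; 0; -1; -1; 0; 0];
  [:: 0; 0; 0; 0; 1; -1; 0; 1; 0]; [:: 0; 0; 1; 1; 1; 0; -1; 0; -1];
  [:: 0; 0; 1; -1; 0; -1; -1; 1; -1]; [:: -1; -2; -1; 1; 1; 0; -1; 1; 0];
  [:: -1; 0; 0; 0; -1; -1; 0; 0; 1]].

(* Four times the inverse of [adapted_base]. *)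
Definition adapted_inv : seq (seq int) := [::
  [:: -1; 0; 1; -1; 1; -1; 1; 0; -1]; [:: 0; 1; -1; 1; 1; 1; -1; -1; 0];
  [:: 1; 0; 1; -1; -1; 1; 1; 0; 1]; [:: -1; 0; -1; -1; 1; 1; -1; 0; 1];
  [:: 1; 0; 1; 1; 1; 1; -1; 0; -1]; [:: 1; 1; 0; 0; -2; 0; 0; 1; -1];
  [:: 0; -1; -1; -1; 1; -1; -1; -1; 0]; [:: 0; 1; -1; -1; 1; -1; 1; 1; 0];
  [:: 1; 1; 2; 0; 0; 0; 0; 1; 1]].

Definition entry (M : seq (seq int)) (i j : nat) : int := nth 0 (nth [::] M i) j.

Definition mat_i : seq (seq int) := [::
  [:: 1; 0; 0; 0; 0; 0; 0; 0; 0]; [:: 0; 1; 0; 0; 0; 0; 0; 0; 0];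
  [:: 0; 0; 0; 1; 0; 0; 0; 0; 0]; [:: 0; 0; -1; 0; 0; 0; 0; 0; 0];
  [:: 0; 0; 0; 0; 0; 1; 0; 0; 0]; [:: 0; 0; 0; 0; -1; 0; 0; 0; 0];
  [:: 0; 0; 0; 0; 0; 0; 1; 0; 0]; [:: 0; 0; 0; 0; 0; 0; 0; -1; 0];
  [:: 0; 0; 0; 0; 0; 0; 0; 0; -1]].

(* Twice the matrix of [aut_r]. *)
Definition mat_r : seq (seq int) := [::
  [:: 0; 2; 0; 0; 0; 0; 0; 0; 0]; [:: -2; -2; 0; 0; 0; 0; 0; 0; 0];
  [:: 0; 0; -1; -1; -1; -1; 0; 0; 0]; [:: 0; 0; 1; -1; -1; 1; 0; 0; 0];
  [:: 0; 0; 1; 1; -1; -1; 0; 0; 0]; [:: 0; 0; 1; -1; 1; -1; 0; 0; 0];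
  [:: 0; 0; 0; 0; 0; 0; 0; 2; 0]; [:: 0; 0; 0; 0; 0; 0; 0; 0; 2];
  [:: 0; 0; 0; 0; 0; 0; 2; 0; 0]].

Definition mat_2 : seq (seq int) := [::
  [:: 0; -1; 0; 0; 0; 0; 0; 0; 0]; [:: -1; 0; 0; 0; 0; 0; 0; 0; 0];
  [:: 0; 0; 0; -1; 0; 0; 0; 0; 0]; [:: 0; 0; -1; 0; 0; 0; 0; 0; 0];
  [:: 0; 0; 0; 0; -1; 0; 0; 0; 0]; [:: 0; 0; 0; 0; 0; 1; 0; 0; 0];
  [:: 0; 0; 0; 0; 0; 0; -1; 0; 0]; [:: 0; 0; 0; 0; 0; 0; 0; 0; 1];
  [:: 0; 0; 0; 0; 0; 0; 0; 1; 0]].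

Definition mat_3 : seq (seq int) := [::
  [:: -1; 0; 0; 0; 0; 0; 0; 0; 0]; [:: 0; -1; 0; 0; 0; 0; 0; 0; 0];
  [:: 0; 0; 0; 1; 0; 0; 0; 0; 0]; [:: 0; 0; -1; 0; 0; 0; 0; 0; 0];
  [:: 0; 0; 0; 0; 0; -1; 0; 0; 0]; [:: 0; 0; 0; 0; 1; 0; 0; 0; 0];
  [:: 0; 0; 0; 0; 0; 0; 1; 0; 0]; [:: 0; 0; 0; 0; 0; 0; 0; 1; 0];
  [:: 0; 0; 0; 0; 0; 0; 0; 0; 1]].

Lemma act_check_i : act_check adapted_base tab_i 1 mat_i.
Proof. by vm_cast_no_check (erefl true). Qed.
Lemma act_check_r : act_check adapted_base tab_r 2 mat_r.
Proof. by vm_cast_no_check (erefl true). Qed.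
Lemma act_check_2 : act_check adapted_base tab_2 1 mat_2.
Proof. by vm_cast_no_check (erefl true). Qed.
Lemma act_check_3 : act_check adapted_base tab_3 1 mat_3.
Proof. by vm_cast_no_check (erefl true). Qed.

Lemma adapted_cotree_value : all (fun j => all (fun k =>
  cotree_value (base_cochain adapted_base j) k == entry adapted_base j k) (iota 0 9)) (iota 0 9).
Proof. by vm_compute. Qed.

Lemma adapted_invE : all (fun j => all (fun l =>
  foldr (fun k r => entry adapted_base j k * entry adapted_inv k l + r) 0 (iota 0 9)
    == 4 * (j == l)%:R) (iota 0 9)) (iota 0 9).
Proof. by vm_compute. Qed.

Lemma std_adapted : all (fun k => all (fun e =>
  4 * base_cochain std_base k e.1 e.2 ==
  foldr (fun l r => entry adapted_inv k l * base_cochain adapted_base l e.1 e.2 + r) 0 (iota 0 9))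
  edge_list) (iota 0 9).
Proof. by vm_compute. Qed.

Lemma ord9_iota (k : 'I_9) : (k : nat) \in iota 0 9.
Proof. by rewrite mem_iota /=. Qed.

Lemma foldr_intr (R : pzRingType) (f : nat -> int) :
  (foldr (fun k r => f k + r) 0 (iota 0 9))%:~R = \sum_(k < 9) (f k)%:~R :> R.
Proof. by rewrite /= !rmorphD rmorph0 !big_ord_recl big_ord0. Qed.

Section OddPrime.

Variable p : nat.
Hypotheses (p_prime : prime p) (p_odd : odd p).
Local Notation F := 'F_p.

Lemma two_neq0 : (2 : F) != 0.
Proof.
rewrite -[2]/(2%:R) -(dvdn_pcharf (pchar_Fp p_prime)) gtnNdvd //.
by case: p p_prime p_odd => [|[|[|]]].
Qed.

Lemma four_neq0 : (4 : F) != 0.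
Proof.
have -> : (4 : F) = 2 * 2 by ring.
by rewrite mulf_neq0 ?two_neq0.
Qed.

(** An exact cochain vanishes on the nine fundamental cycles, and the matrix of the values of the
    base on them is invertible because 4 is. *)
Lemma beta_exact0 (v : seq F) :
  exact (beta adapted_base v) -> forall j, (j < 9)%N -> v`_j = 0.
Proof.
move=> ex l l9; pose c i j : F := \sum_(k < 9) v`_k * (base_cochain adapted_base k i j)%:~R.
have val0 (k : 'I_9) : \sum_(j < 9) v`_j * (entry adapted_base j k)%:~R = 0.
  apply: etrans (@exact_cotree_value _ c k (ltn_ord k) ex); rewrite cotree_value_sum.
  apply: eq_bigr => j _; congr (_ * _%:~R); apply/esym/eqP.
  exact: (allP (allP adapted_cotree_value _ (ord9_iota j)) _ (ord9_iota k)).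
apply: (mulfI four_neq0); rewrite mulr0.
transitivity (\sum_(k < 9) (\sum_(j < 9) v`_j * (entry adapted_base j k)%:~R) *
    (entry adapted_inv k l)%:~R : F); last first.
  by rewrite big1 // => k _; rewrite val0 mul0r.
under eq_bigr do rewrite mulr_suml.
rewrite exchange_big /=.
have inner (j : 'I_9) : \sum_(k < 9) v`_j * (entry adapted_base j k)%:~R *
    (entry adapted_inv k l)%:~R = v`_j * (4 * (j == l :> nat)%:R).
  transitivity (\sum_(k < 9) v`_j * (entry adapted_base j k * entry adapted_inv k l)%:~R).
    by apply: eq_bigr => k _; rewrite -mulrA rmorphM.
  rewrite -mulr_sumr -(foldr_intr _ (fun k => entry adapted_base j k * entry adapted_inv k l)).
  have /eqP-> := allP (allP adapted_invE _ (ord9_iota j)) _ (ord9_iota (Ordinal l9)).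
  by rewrite /=; case: (_ == _); rewrite ?mulr1 ?mulr0 ?rmorph0.
transitivity (\sum_(j < 9) v`_j * (4 * (j == l :> nat)%:R) : F); last first.
  by apply: eq_bigr => j _; rewrite inner.
rewrite (bigD1 (Ordinal l9)) //= eqxx big1 => [|j nj].
  by rewrite addr0 mulr1 mulrC.
by rewrite -val_eqE /= in nj; rewrite (negbTE nj) !mulr0.
Qed.

(** The passage from unit cochains to the adapted base divides by 4; this is why the prime 2 is
    treated in [std_base]. *)
Lemma exact_adapted (c : GP83 -> GP83 -> F) :
  (forall x y, adj x y -> c y x = - c x y) ->
  exists v, exact (fun x y => c x y - beta adapted_base v x y).
Proof.
move=> /exact_std[w exw].
exists (mkseq (fun l => 4^-1 * \sum_(k < 9) w`_k * (entry adapted_inv k l)%:~R) 9).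
apply: exact_ext exw => x y xy; congr (_ - _).
have E e : e \in edge_list ->
    \sum_(k < 9) w`_k * (base_cochain std_base k e.1 e.2)%:~R =
    \sum_(l < 9) (mkseq (fun l => 4^-1 * \sum_(k < 9) w`_k * (entry adapted_inv k l)%:~R) 9)`_l *
       (base_cochain adapted_base l e.1 e.2)%:~R.
  move=> eE; apply: (mulfI four_neq0); rewrite !mulr_sumr.
  under [RHS]eq_bigr => l _.
    rewrite nth_mkseq // !mulrA divff ?four_neq0 // mul1r mulr_suml.
    under eq_bigr do rewrite -mulrA -rmorphM.
    over.
  rewrite exchange_big /=; apply: eq_bigr => k _.
  rewrite -mulr_sumr -(foldr_intr _ (fun l => entry adapted_inv k l * base_cochain adapted_base l e.1 e.2)) mulrCA -[4]/(4%:~R) -rmorphM /=.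
  by congr (_ * _%:~R); apply/eqP; apply: (allP (allP std_adapted _ (ord9_iota k)) _ eE).
move: x y xy; apply: (GP83_arcP (P := fun i j =>
    \sum_(k < 9) w`_k * (base_cochain std_base k i j)%:~R =
    \sum_(l < 9) (mkseq _ 9)`_l * (base_cochain adapted_base l i j)%:~R)) => e /E He.
split=> //; transitivity (- \sum_(k < 9) w`_k * (base_cochain std_base k e.1 e.2)%:~R).
  rewrite -sumrN; apply: eq_bigr => k _.
  by rewrite /base_cochain cotree_cochain_anti rmorphN mulrN.
rewrite He -sumrN; apply: eq_bigr => k _.
by rewrite [in RHS]/base_cochain cotree_cochain_anti rmorphN mulrN.
Qed.


End OddPrime.

Definition act_bits (M : seq (seq int)) (w : seq bool) : seq bool :=
  mkseq (fun j => foldr (fun i r => (nth false w i && odd `|entry M i j|%N) (+) r)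
    false (iota 0 9)) 9.

Definition std_mat (t : seq nat) : seq (seq int) :=
  [seq [seq cotree_value (fun x y => base_cochain std_base i (nth 0%N t x) (nth 0%N t y)) k
    | k <- iota 0 9] | i <- iota 0 9].

Definition mats_H : seq (seq (seq int)) := Eval vm_compute in map std_mat tabs_H.
Definition std_mat_2 : seq (seq int) := Eval vm_compute in std_mat tab_2.

Lemma act_check_H : all (fun k => act_check std_base (nth [::] tabs_H k) 1 (nth [::] mats_H k))
  (iota 0 24).
Proof. by vm_cast_no_check (erefl true). Qed.

Lemma act_check_std_2 : act_check std_base tab_2 1 std_mat_2.
Proof. by vm_cast_no_check (erefl true). Qed.

Fixpoint bit_rows (n : nat) : seq (seq bool) :=
  if n is n'.+1 then [seq b :: w | b <- [:: true; false], w <- bit_rows n'] else [:: [::]].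

Lemma mem_bit_rows (w : seq bool) : w \in bit_rows (size w).
Proof.
elim: w => // b w IHw; apply/allpairsP; exists (b, w).
by rewrite /= IHw !inE; case: b.
Qed.

Definition add_bits (u v : seq bool) : seq bool :=
  mkseq (fun j => nth false u j (+) nth false v j) 9.

Definition zero_bits : seq bool := nseq 9 false.

(* For p = 2, every H-submodule is stable under [aut_2] because the image of each
   vector is a sum of at most three vectors of its H-orbit. *)
Lemma orbit_sums : all (fun w =>
  let o := zero_bits :: undup [seq act_bits M w | M <- mats_H] in let t := act_bits std_mat_2 w in
  has (fun u => has (fun v => add_bits (add_bits t u) v \in o) o) o) (bit_rows 9).
Proof. by vm_cast_no_check (erefl true). Qed.

Lemma F2_bit (x : 'F_2) : x = (x != 0)%:R.
Proof. by case: x => [[|[|n]] i]; apply: val_inj. Qed.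

Lemma F2_addb (b c : bool) : (b (+) c)%:R = b%:R + c%:R :> 'F_2.
Proof. by case: b c => [] []; apply: val_inj. Qed.

Lemma F2_intr (m : int) : m%:~R = (odd `|m|%N)%:R :> 'F_2.
Proof.
have nat2 n : n%:R = (odd n)%:R :> 'F_2.
  elim: n => [|n IHn] //; rewrite -natr1 IHn -[1]/((true : nat)%:R) -F2_addb.
  by rewrite addbT.
case: m => n; first exact: nat2.
rewrite NegzE abszN absz_nat mulrNz [X in - X](nat2 n.+1).
by case: (odd _) => /=; apply/eqP.
Qed.

Definition row_of_bits (w : seq bool) : seq 'F_2 := [seq (nat_of_bool b)%:R | b <- w].

Lemma nth_row_of_bits w j : (row_of_bits w)`_j = (nth false w j)%:R.
Proof.
have [jw | wj] := ltnP j (size w); first by rewrite (nth_map false).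
by rewrite !nth_default ?size_map.
Qed.

Lemma act_row_bits M w (j : 'I_9) :
  (act_row M (row_of_bits w))`_j = (nth false (act_bits M w) j)%:R.
Proof.
rewrite !nth_mkseq // -(big_mkord xpredT (fun i => (row_of_bits w)`_i * (entry M i j)%:~R)).
rewrite /index_iota subn0; elim: (iota 0 9) => [|i s IHs]; first by rewrite big_nil.
rewrite big_cons /= F2_addb -IHs nth_row_of_bits F2_intr.
by case: (nth _ _ _) (odd _) => [] [] /=; rewrite ?mulr0 ?mul0r ?mulr1.
Qed.

Lemma F2_stable (Y : sgraph) (pr : Y -> GP83) : graph_morphism pr ->
  (forall a, a \in group_H -> forall c : GP83 -> GP83 -> 'F_2,
     exact_along pr c -> exact_along pr (pullback a c)) ->
  forall c : GP83 -> GP83 -> 'F_2, (forall x y, adj x y -> c y x = - c x y) ->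
  exact_along pr c -> exact_along pr (pullback aut_2 c).
Proof.
move=> mor stab c anti Wc.
pose D (v : seq 'F_2) := exact_along pr (beta std_base v).
have Dext u v : (forall j : 'I_9, u`_j = v`_j) -> D u -> D v.
  by move=> E; apply: exact_along_ext => x y; apply: beta_ext.
have Dadd u v : D u -> D v -> D (lin_row 1 1 u v).
  move=> Du Dv; apply: exact_along_ext (exact_along_comb 1 1 Du Dv) => x y.
  by rewrite beta_lin.
have Dact k v : (k < 24)%N -> D v -> D (act_row (nth [::] mats_H k) v).
  move=> k24 Dv; set t := nth [::] tabs_H k.
  have tH : t \in tabs_H by apply: mem_nth.
  have [h hH ht] := tabs_HP tH.
  have chk : act_check std_base t 1 (nth [::] mats_H k).
    by apply: (allP act_check_H); rewrite mem_iota.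
  have [g gE] := pullback_beta v ht chk.
  apply: exact_along_cohomologous (stab h hH _ Dv) => //.
  exists (fun x => - g x) => x y xy; rewrite -opprD gE // opprB rmorph1.
  by rewrite mul1r.
have [v exv] := exact_std anti.
have exN (b c' : GP83 -> GP83 -> 'F_2) :
    exact (fun x y => b x y - c' x y) -> exact (fun x y => c' x y - b x y).
  by case=> g gE; exists (fun x => - g x) => x y xy; rewrite -opprD gE // opprB.
pose w := mkseq (fun j => v`_j != 0) 9.
have vw (j : 'I_9) : v`_j = (row_of_bits w)`_j.
  by rewrite nth_row_of_bits nth_mkseq // -F2_bit.
have Dw : D (row_of_bits w).
  by apply: Dext vw _; apply: exact_along_cohomologous Wc => //; apply: exN.
have D0 : D (row_of_bits zero_bits).
  apply: exact_along_ext (exact_along0 _ pr) => x y; rewrite /beta big1 // => j _.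
  by rewrite nth_row_of_bits nth_nseq; case: ifP => _; rewrite mul0r.
have Do b : b \in zero_bits :: undup [seq act_bits M w | M <- mats_H] -> D (row_of_bits b).
  rewrite inE mem_undup => /orP[/eqP-> // | /mapP[M /(nthP [::])[k k24 <-] ->]].
  apply: Dext (Dact k _ k24 Dw) => j.
  by rewrite nth_row_of_bits act_row_bits.
have wE : w \in bit_rows 9 by have := mem_bit_rows w; rewrite size_mkseq.
(* Modulo 2, moving [u] and [u'] across the relation of [orbit_sums] writes the image as a sum of
   three killed vectors. *)
have /hasP[u uo /hasP[u' uo' so]] := allP orbit_sums _ wE.
have D2 : D (act_row std_mat_2 v).
  apply: Dext (Dadd _ _ (Dadd _ _ (Do _ so) (Do _ uo)) (Do _ uo')) => j.
  rewrite !(nth_mkseq _ _ (ltn_ord j)) !mul1r !nth_row_of_bits /add_bits.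
  rewrite !(nth_mkseq _ _ (ltn_ord j)).
  transitivity ((act_row std_mat_2 (row_of_bits w))`_j); last first.
    rewrite nth_mkseq //; apply: eq_bigr => i _; rewrite vw //.
  rewrite act_row_bits -!F2_addb.
  rewrite /act_bits (nth_mkseq _ _ (ltn_ord j)).
  by case: (foldr _ _ _) (nth _ u j) (nth _ u' j) => [] [] [].
have [g gE] := pullback_beta v table_of_2 act_check_std_2.
apply: exact_along_cohomologous D2 => //.
have [h hE] := exv.
exists (fun x => g x + h (aut_2 x)) => x y xy.
have aut2 : adj (aut_2 x) (aut_2 y) by rewrite (gautP _ aut_2_gaut).
rewrite opprD addrACA gE // hE // /pullback rmorph1 mul1r.
by rewrite addrC addrA subrK.
Qed.

End AdaptedBasis.

(** * Submodules in odd characteristic *)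

Section Submodules.
Local Open Scope ring_scope.

Variable p : nat.
Hypotheses (p_prime : prime p) (p_odd : odd p).
Local Notation F := 'F_p.

Definition vec (a0 a1 b0 b1 b2 b3 c0 c1 c2 : F) : seq F :=
  [:: a0; a1; b0; b1; b2; b3; c0; c1; c2].

Lemma forall_ord9 (P : nat -> Prop) :
  [/\ P 0, P 1, P 2, P 3 & [/\ P 4, P 5, P 6, P 7 & P 8]]%N -> forall j, (j < 9)%N -> P j.
Proof. by case=> P0 P1 P2 P3 [P4 P5 P6 P7 P8] [|[|[|[|[|[|[|[|[|]]]]]]]]]. Qed.

Lemma act_i_vec a0 a1 b0 b1 b2 b3 c0 c1 c2 j : (j < 9)%N ->
  (act_row mat_i (vec a0 a1 b0 b1 b2 b3 c0 c1 c2))`_j =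
  (vec a0 a1 (- b1) b0 (- b3) b2 c0 (- c1) (- c2))`_j.
Proof.
move: j; apply: forall_ord9.
by split; last split; rewrite nth_mkseq // !big_ord_recl big_ord0 /=; ring.
Qed.

Lemma act_r_vec a0 a1 b0 b1 b2 b3 c0 c1 c2 j : (j < 9)%N ->
  (act_row mat_r (vec a0 a1 b0 b1 b2 b3 c0 c1 c2))`_j =
  (vec (2 * - a1) (2 * (a0 - a1)) (- b0 + b1 + b2 + b3) (- b0 - b1 + b2 - b3)
    (- b0 - b1 - b2 + b3) (- b0 + b1 - b2 - b3) (2 * c2) (2 * c0) (2 * c1))`_j.
Proof.
move: j; apply: forall_ord9.
by split; last split; rewrite nth_mkseq // !big_ord_recl big_ord0 /=; ring.
Qed.

Lemma act_2_vec a0 a1 b0 b1 b2 b3 c0 c1 c2 j : (j < 9)%N ->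
  (act_row mat_2 (vec a0 a1 b0 b1 b2 b3 c0 c1 c2))`_j =
  (vec (- a1) (- a0) (- b1) (- b0) (- b2) b3 (- c0) c2 c1)`_j.
Proof.
move: j; apply: forall_ord9.
by split; last split; rewrite nth_mkseq // !big_ord_recl big_ord0 /=; ring.
Qed.

Lemma act_3_vec a0 a1 b0 b1 b2 b3 c0 c1 c2 j : (j < 9)%N ->
  (act_row mat_3 (vec a0 a1 b0 b1 b2 b3 c0 c1 c2))`_j =
  (vec (- a0) (- a1) (- b1) b0 b3 (- b2) c0 c1 c2)`_j.
Proof.
move: j; apply: forall_ord9.
by split; last split; rewrite nth_mkseq // !big_ord_recl big_ord0 /=; ring.
Qed.

Variable D : seq F -> Prop.
Hypothesis D_ext : forall u v, (forall j, (j < 9)%N -> u`_j = v`_j) -> D u -> D v.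
Hypothesis D_lin : forall s t u v, D u -> D v -> D (lin_row s t u v).
Hypothesis D_i : forall v, D v -> D (act_row mat_i v).
Hypothesis D_r : forall v, D v -> D (act_row mat_r v).

Lemma D_vec v : D v <-> D (vec v`_0 v`_1 v`_2 v`_3 v`_4 v`_5 v`_6 v`_7 v`_8).
Proof. by split; apply: D_ext; apply: forall_ord9. Qed.

Lemma D_eq a0 a1 b0 b1 b2 b3 c0 c1 c2 a0' a1' b0' b1' b2' b3' c0' c1' c2' :
  D (vec a0 a1 b0 b1 b2 b3 c0 c1 c2) ->
  a0 = a0' -> a1 = a1' -> b0 = b0' -> b1 = b1' -> b2 = b2' -> b3 = b3' ->
  c0 = c0' -> c1 = c1' -> c2 = c2' -> D (vec a0' a1' b0' b1' b2' b3' c0' c1' c2').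
Proof. by move=> Dv; do 9!move=> <-. Qed.

Lemma D_comb s t a0 a1 b0 b1 b2 b3 c0 c1 c2 a0' a1' b0' b1' b2' b3' c0' c1' c2' :
  D (vec a0 a1 b0 b1 b2 b3 c0 c1 c2) -> D (vec a0' a1' b0' b1' b2' b3' c0' c1' c2') ->
  D (vec (s * a0 + t * a0') (s * a1 + t * a1') (s * b0 + t * b0') (s * b1 + t * b1')
    (s * b2 + t * b2') (s * b3 + t * b3') (s * c0 + t * c0') (s * c1 + t * c1')
    (s * c2 + t * c2')).
Proof. by move=> Du Dv; apply: D_ext (D_lin s t Du Dv); apply: forall_ord9. Qed.

Lemma D_zero : (exists v, D v) -> D (vec 0 0 0 0 0 0 0 0 0).
Proof.
case=> v Dv; apply: D_ext (D_lin 0 0 Dv Dv) => j j9; rewrite nth_mkseq // !mul0r addr0.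
by move: j j9; apply: forall_ord9.
Qed.

Lemma D_scale s a0 a1 b0 b1 b2 b3 c0 c1 c2 : D (vec a0 a1 b0 b1 b2 b3 c0 c1 c2) ->
  D (vec (s * a0) (s * a1) (s * b0) (s * b1) (s * b2) (s * b3) (s * c0) (s * c1) (s * c2)).
Proof. by move=> Dv; apply: (D_eq (D_comb s 0 Dv Dv)); ring. Qed.

Lemma D_vec_i a0 a1 b0 b1 b2 b3 c0 c1 c2 : D (vec a0 a1 b0 b1 b2 b3 c0 c1 c2) ->
  D (vec a0 a1 (- b1) b0 (- b3) b2 c0 (- c1) (- c2)).
Proof. by move/D_i; apply: D_ext => j j9; rewrite act_i_vec. Qed.

Let h : F := 2^-1.
Let two : (2 : F) != 0 := two_neq0 p_prime p_odd.

Lemma D_vec_r a0 a1 b0 b1 b2 b3 c0 c1 c2 : D (vec a0 a1 b0 b1 b2 b3 c0 c1 c2) ->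
  D (vec (- a1) (a0 - a1) (h * (- b0 + b1 + b2 + b3)) (h * (- b0 - b1 + b2 - b3))
    (h * (- b0 - b1 - b2 + b3)) (h * (- b0 + b1 - b2 - b3)) c2 c0 c1).
Proof.
move/D_r => Dv; have {}Dv := D_ext (fun j j9 => act_r_vec _ _ _ _ _ _ _ _ _ j9) Dv.
by apply: (D_eq (D_scale h Dv)); rewrite /h; field.
Qed.

Definition DA a0 a1 := D (vec a0 a1 0 0 0 0 0 0 0).
Definition DB b0 b1 b2 b3 := D (vec 0 0 b0 b1 b2 b3 0 0 0).
Definition DC c0 c1 c2 := D (vec 0 0 0 0 0 0 c0 c1 c2).

Lemma DA_r a0 a1 : DA a0 a1 -> DA (- a1) (a0 - a1).
Proof. by move/D_vec_r=> Dv; apply: (D_eq Dv); ring. Qed.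

Lemma DC_r c0 c1 c2 : DC c0 c1 c2 -> DC c2 c0 c1.
Proof. by move/D_vec_r=> Dv; apply: (D_eq Dv); ring. Qed.

Lemma DB_i b0 b1 b2 b3 : DB b0 b1 b2 b3 -> DB (- b1) b0 (- b3) b2.
Proof. by move/D_vec_i=> Dv; apply: (D_eq Dv); ring. Qed.

Lemma DB_r b0 b1 b2 b3 : DB b0 b1 b2 b3 ->
  DB (h * (- b0 + b1 + b2 + b3)) (h * (- b0 - b1 + b2 - b3))
    (h * (- b0 - b1 - b2 + b3)) (h * (- b0 + b1 - b2 - b3)).
Proof. by move/D_vec_r=> Dv; apply: (D_eq Dv); ring. Qed.

(** On B, [aut_r] is left multiplication by rho = -(1 + i + j + k)/2, of order 3, and rho i rho^2 =
    j. So the B-part is closed under left multiplication by all quaternions. *)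
Lemma DB_j b0 b1 b2 b3 : DB b0 b1 b2 b3 -> DB (- b2) b3 b0 (- b1).
Proof.
by move/DB_r/DB_r/DB_i/DB_r=> Dv; apply: (D_eq Dv); rewrite /h; field.
Qed.

Lemma DB_comb s t b0 b1 b2 b3 b0' b1' b2' b3' : DB b0 b1 b2 b3 -> DB b0' b1' b2' b3' ->
  DB (s * b0 + t * b0') (s * b1 + t * b1') (s * b2 + t * b2') (s * b3 + t * b3').
Proof. by move=> Du Dv; apply: (D_eq (D_comb s t Du Dv)); ring. Qed.

Lemma DB_eq b0 b1 b2 b3 b0' b1' b2' b3' : DB b0 b1 b2 b3 ->
  b0 = b0' -> b1 = b1' -> b2 = b2' -> b3 = b3' -> DB b0' b1' b2' b3'.
Proof. by move=> Db <- <- <- <-. Qed.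

(** The square of [aut_i] is -1 on B and 1 on A and C, so averaging over it removes B. *)
Lemma DAC a0 a1 b0 b1 b2 b3 c0 c1 c2 : D (vec a0 a1 b0 b1 b2 b3 c0 c1 c2) ->
  D (vec a0 a1 0 0 0 0 c0 c1 c2).
Proof.
move=> Dv; have Dz := D_vec_i (D_vec_i Dv).
by apply: (D_eq (D_comb h h Dv Dz)); rewrite /h; field.
Qed.

Lemma D_DB a0 a1 b0 b1 b2 b3 c0 c1 c2 : D (vec a0 a1 b0 b1 b2 b3 c0 c1 c2) -> DB b0 b1 b2 b3.
Proof. by move=> Dv; apply: (D_eq (D_comb 1 (-1) Dv (DAC Dv))); ring. Qed.

(** On C, [aut_i] is diagonal with entries 1, -1, -1: averaging leaves only the first coordinate,
    which [aut_r] moves to a place where a second average removes it. The A-part has then been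
    turned once by [aut_r], and two more turns restore it. *)
Lemma D_DA a0 a1 b0 b1 b2 b3 c0 c1 c2 : D (vec a0 a1 b0 b1 b2 b3 c0 c1 c2) -> DA a0 a1.
Proof.
move/DAC=> Dv; have D1 : D (vec a0 a1 0 0 0 0 c0 0 0).
  by apply: (D_eq (D_comb h h Dv (D_vec_i Dv))); rewrite /h; field.
have D2 := D_vec_r D1.
have D3 : DA (- a1) (a0 - a1).
  by apply: (D_eq (D_comb h h D2 (D_vec_i D2))); rewrite /h; field.
by apply: (D_eq (DA_r (DA_r D3))); ring.
Qed.

Lemma D_DC a0 a1 b0 b1 b2 b3 c0 c1 c2 : D (vec a0 a1 b0 b1 b2 b3 c0 c1 c2) -> DC c0 c1 c2.
Proof. by move/DAC=> Dv; apply: (D_eq (D_comb 1 (-1) Dv (D_DA Dv))); ring. Qed.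

Lemma D_sum a0 a1 b0 b1 b2 b3 c0 c1 c2 : DA a0 a1 -> DB b0 b1 b2 b3 -> DC c0 c1 c2 ->
  D (vec a0 a1 b0 b1 b2 b3 c0 c1 c2).
Proof.
by move=> Da Db Dc; apply: (D_eq (D_comb 1 1 Da (D_comb 1 1 Db Dc))); ring.
Qed.

(** Averaging isolates each coordinate and [aut_r] permutes them, so every coordinate of a vector of
    C lies in [D] separately. *)
Lemma DC_2 c0 c1 c2 : DC c0 c1 c2 -> DC (- c0) c2 c1.
Proof.
have first x y z : DC x y z -> DC x 0 0.
  by move=> Dc; apply: (D_eq (D_comb h h Dc (D_vec_i Dc))); rewrite /h; field.
move=> Dc; have D0 := first _ _ _ Dc.
have D1 := DC_r (DC_r (first _ _ _ (DC_r (DC_r Dc)))).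
have D2 := DC_r (first _ _ _ (DC_r Dc)).
by apply: (D_eq (D_comb (-1) 1 D0 (D_comb 1 1 D1 D2))); ring.
Qed.

(** The left ideal generated by b contains the product of the conjugate of b by b, which is its
    norm. *)
Lemma DB_full b0 b1 b2 b3 : DB b0 b1 b2 b3 -> b0 ^+ 2 + b1 ^+ 2 + b2 ^+ 2 + b3 ^+ 2 != 0 ->
  forall x0 x1 x2 x3, DB x0 x1 x2 x3.
Proof.
move=> Db nz x0 x1 x2 x3; set n := _ + _ in nz.
have Di := DB_i Db; have Dj := DB_j Db; have Dk := DB_i Dj.
have Dn : DB n 0 0 0.
  by apply: (DB_eq (DB_comb 1 1 (DB_comb b0 (- b1) Db Di) (DB_comb (- b2) (- b3) Dj Dk)));
    rewrite /n; ring.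
have one : DB 1 0 0 0.
  by apply: (DB_eq (DB_comb n^-1 0 Dn Dn)); rewrite ?mul0r ?mulr0 ?addr0 ?mulVf.
have i1 := DB_i one; have j1 := DB_j one; have k1 := DB_i j1.
by apply: (DB_eq (DB_comb 1 1 (DB_comb x0 x1 one i1) (DB_comb x2 x3 j1 k1))); ring.
Qed.

Lemma DB_null b0 b1 b2 b3 : ~ (forall x0 x1 x2 x3, DB x0 x1 x2 x3) ->
  DB b0 b1 b2 b3 -> b0 ^+ 2 + b1 ^+ 2 + b2 ^+ 2 + b3 ^+ 2 = 0.
Proof.
by move=> nfull Db; apply/eqP/contraT => nz; case: nfull; apply: DB_full Db nz.
Qed.

(** Write b = alpha + beta j with alpha = b0 + b1 i and beta = b2 + b3 i. Dividing by alpha on the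
    left gives 1 + (z - y i) j, where z - y i = alpha^-1 beta has norm -1 since b has norm 0; the
    second vector is i times the first. *)
Lemma DB_circle b0 b1 b2 b3 : ~ (forall x0 x1 x2 x3, DB x0 x1 x2 x3) ->
  DB b0 b1 b2 b3 -> b0 ^+ 2 + b1 ^+ 2 != 0 ->
  exists y z, [/\ y ^+ 2 + z ^+ 2 = -1, DB 1 0 z (- y) & DB 0 1 y z].
Proof.
move=> nfull Db nz; have Di := DB_i Db; set n := b0 ^+ 2 + b1 ^+ 2 in nz.
have null : b2 ^+ 2 + b3 ^+ 2 = - n.
  by apply/eqP; rewrite -subr_eq0 opprK addrC /n addrA (DB_null nfull Db).
have nV : n * n^-1 = 1 by rewrite divff.
have scale x0 x1 x2 x3 : DB x0 x1 x2 x3 -> DB (n^-1 * x0) (n^-1 * x1) (n^-1 * x2) (n^-1 * x3).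
  by move=> Dx; apply: (DB_eq (DB_comb n^-1 0 Dx Dx)); ring.
exists (n^-1 * (b1 * b2 - b0 * b3)), (n^-1 * (b0 * b2 + b1 * b3)); split.
- transitivity (n^-1 ^+ 2 * (n * (b2 ^+ 2 + b3 ^+ 2))); first by rewrite /n; ring.
  by rewrite null mulrN mulrN -expr2 -exprMn mulVf // expr1n.
- apply: (DB_eq (scale _ _ _ _ (DB_comb b0 (- b1) Db Di))).
  + by rewrite -(mulVf nz) /n; ring.
  + by ring.
  + by ring.
  + by ring.
apply: (DB_eq (scale _ _ _ _ (DB_comb b1 b0 Db Di))).
- by ring.
- by rewrite -(mulVf nz) /n; ring.
- by ring.
- by ring.
Qed.

(** If alpha is not invertible for b nor for b + j b, the vanishing norms make b an eigenvector of
    right multiplication by i, or else alpha = 0 and b i = - i b. In both cases b i lies in the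
    ideal, which was excluded. *)
Lemma DB_circle_of_not_3 b0 b1 b2 b3 : ~ (forall x0 x1 x2 x3, DB x0 x1 x2 x3) ->
  DB b0 b1 b2 b3 -> ~ DB (- b1) b0 b3 (- b2) ->
  exists y z, [/\ y ^+ 2 + z ^+ 2 = -1, DB 1 0 z (- y) & DB 0 1 y z].
Proof.
move=> nfull Db n3.
have [n0 | nz] := eqVneq (b0 ^+ 2 + b1 ^+ 2) 0; last exact: DB_circle Db nz.
have Dbj := DB_comb 1 1 Db (DB_j Db).
have [n0' | nz] := eqVneq ((1 * b0 + 1 * - b2) ^+ 2 + (1 * b1 + 1 * b3) ^+ 2) 0; last first.
  exact: DB_circle Dbj nz.
have null : b2 ^+ 2 + b3 ^+ 2 = 0.
  by have := DB_null nfull Db; rewrite n0 add0r.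
have e1 : b0 * b2 = b1 * b3.
  apply: (mulfI two); apply/eqP; rewrite -subr_eq0; apply/eqP.
  transitivity (b0 ^+ 2 + b1 ^+ 2 + (b2 ^+ 2 + b3 ^+ 2) -
    ((1 * b0 + 1 * - b2) ^+ 2 + (1 * b1 + 1 * b3) ^+ 2)); first by ring.
  by rewrite n0 n0' null subr0 addr0.
case: n3; have [b00 | nz0] := eqVneq b0 0.
  have b10 : b1 = 0.
    by apply/eqP; move: n0; rewrite b00 expr0n add0r => /eqP; rewrite sqrf_eq0.
  by apply: (DB_eq (DB_comb (-1) 0 (DB_i Db) Db)); rewrite ?b00 ?b10; ring.
have e2 : b0 * b3 = - (b1 * b2).
  apply: (mulfI nz0); apply/eqP; rewrite -subr_eq0; apply/eqP.
  transitivity ((b0 ^+ 2 + b1 ^+ 2) * b3 + b1 * (b0 * b2 - b1 * b3)); first by ring.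
  by rewrite n0 e1 subrr mul0r mulr0 addr0.
have e3 : b0 * b0 = - (b1 * b1).
  by apply/eqP; rewrite -addr_eq0 -!expr2 n0.
apply: (DB_eq (DB_comb (- b1 / b0) 0 Db Db)); apply: (mulfI nz0).
- by field.
- by rewrite e3; field.
- by rewrite e2; field.
by rewrite mulrN e1; field.
Qed.

(** A is F_p[r]/(r^2 + r + 1), with norm a0^2 + a1^2 - a0 a1. A vector of nonzero norm generates all
    of A, while one of norm 0 spans an eigenline of [aut_r] with eigenvalue w. For w = 1, possible
    only when p = 3, this line is stable under t_2. *)
Lemma D_A_line a0 a1 : DA a0 a1 -> ~ DA (- a1) (- a0) ->
  exists w, [/\ w ^+ 2 + w + 1 = 0, w != 1 & DA 1 (- w)].
Proof.
move=> Da n2; have Dr := DA_r Da.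
have DA_comb s t x y x' y' : DA x y -> DA x' y' -> DA (s * x + t * x') (s * y + t * y').
  by move=> Dx Dx'; apply: (D_eq (D_comb s t Dx Dx')); ring.
have DA_eq x y x' y' : DA x y -> x = x' -> y = y' -> DA x' y' by move=> Dx <- <-.
have [n0 | nz] := eqVneq (a0 ^+ 2 + a1 ^+ 2 - a0 * a1) 0; last first.
  set n := _ - _ in nz; have one : DA 1 0.
    apply: (DA_eq _ _ _ _ (DA_comb ((a0 - a1) / n) (- a1 / n) _ _ _ _ Da Dr)).
      by rewrite -[RHS](divff nz) /n; ring.
    by ring.
  case: n2; apply: (DA_eq _ _ _ _ (DA_comb (- a1 + a0 - a0) (- a0) _ _ _ _ one (DA_r one))).
    by ring.
  by ring.
have nz0 : a0 != 0.
  apply/eqP=> a00; move: n0; rewrite a00 expr0n mul0r subr0 add0r => /eqP.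
  rewrite sqrf_eq0 => /eqP a10; apply: n2; apply: (DA_eq _ _ _ _ Da).
    by rewrite a10 oppr0.
  by rewrite a10 a00 oppr0.
have line : DA 1 (- (- a1 / a0)).
  apply: (DA_eq _ _ _ _ (DA_comb a0^-1 0 _ _ _ _ Da Da)); first by field.
  by field.
exists (- a1 / a0); split=> //.
  transitivity ((a0 ^+ 2 + a1 ^+ 2 - a0 * a1) / a0 ^+ 2); first by field.
  by rewrite n0 mul0r.
apply/eqP=> w1; apply: n2; apply: (DA_eq _ _ _ _ (DA_comb a0 0 _ _ _ _ line line)).
  have : - a1 = a0 by rewrite -[LHS](divfK nz0) w1 mul1r.
  by move=> ->; ring.
by rewrite w1; ring.
Qed.

(** The obstruction to t_3 gives a plane in B. If y = z, this plane is the whole B-part and is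
    stable under t_2, as is the C-part, so the obstruction to t_2 lies in A. *)
Lemma submodule_dichotomy :
  ~ (forall v, D v -> D (act_row mat_2 v)) -> ~ (forall v, D v -> D (act_row mat_3 v)) ->
  (exists y z, [/\ y ^+ 2 + z ^+ 2 = -1, y != z, DB 1 0 z (- y) & DB 0 1 y z]) \/
  (exists w y, [/\ w ^+ 2 + w + 1 = 0, w != 1, y ^+ 2 + y ^+ 2 = -1, DA 1 (- w) &
    DB 1 0 y (- y) /\ DB 0 1 y y]).
Proof.
move=> n2 n3.
have n2' : exists a0 a1 b0 b1 b2 b3 c0 c1 c2, D (vec a0 a1 b0 b1 b2 b3 c0 c1 c2) /\
    ~ D (vec (- a1) (- a0) (- b1) (- b0) (- b2) b3 (- c0) c2 c1).
  apply: NNPP => nex; apply: n2 => v /D_vec Dv; apply: NNPP => nDv; apply: nex.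
  do 9!eexists; split; [exact: Dv|] => D2; apply: nDv.
  apply: (D_ext _ D2) => j j9; rewrite -act_2_vec //; rewrite !nth_mkseq //.
  by apply: eq_bigr => i _; congr (_ * _); move: (i : nat) (ltn_ord i); apply: forall_ord9.
have n3' : exists a0 a1 b0 b1 b2 b3 c0 c1 c2, D (vec a0 a1 b0 b1 b2 b3 c0 c1 c2) /\
    ~ D (vec (- a0) (- a1) (- b1) b0 b3 (- b2) c0 c1 c2).
  apply: NNPP => nex; apply: n3 => v /D_vec Dv; apply: NNPP => nDv; apply: nex.
  do 9!eexists; split; [exact: Dv|] => D2; apply: nDv.
  apply: (D_ext _ D2) => j j9; rewrite -act_3_vec //; rewrite !nth_mkseq //.
  by apply: eq_bigr => i _; congr (_ * _); move: (i : nat) (ltn_ord i); apply: forall_ord9.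
have [nfull [y [z [cyz D0 D1]]]] : ~ (forall x0 x1 x2 x3, DB x0 x1 x2 x3) /\
    exists y z, [/\ y ^+ 2 + z ^+ 2 = -1, DB 1 0 z (- y) & DB 0 1 y z].
  have [a0 [a1 [b0 [b1 [b2 [b3 [c0 [c1 [c2 [Dv nDv]]]]]]]]]] := n3'.
  have nB3 : ~ DB (- b1) b0 b3 (- b2).
    move=> Db; apply: nDv; apply: D_sum Db (D_DC Dv).
    by apply: (D_eq (D_scale (-1) (D_DA Dv))); ring.
  have nfull : ~ (forall x0 x1 x2 x3, DB x0 x1 x2 x3) by move=> full; apply: nB3.
  by split=> //; apply: DB_circle_of_not_3 nfull (D_DB Dv) nB3.
have [eyz | nyz] := eqVneq y z; last by left; exists y, z.
right; subst z.
have [a0 [a1 [b0 [b1 [b2 [b3 [c0 [c1 [c2 [Dv nDv]]]]]]]]]] := n2'.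
(* All of [DB] is isotropic, so the part of [b] orthogonal to the plane already
   found vanishes. *)
pose u := b2 - b0 * y - b1 * y; pose v := b3 + b0 * y - b1 * y.
have Duv : DB 0 0 u v.
  apply: (DB_eq (DB_comb 1 1 (D_DB Dv) (DB_comb (- b0) (- b1) D0 D1))); rewrite /u /v; ring.
have n0 := DB_null nfull D0; have n1 := DB_null nfull D1; have nuv := DB_null nfull Duv.
have e0 : y * u - y * v = 0.
  apply: (mulfI two); rewrite mulr0.
  have := DB_null nfull (DB_comb 1 1 D0 Duv).
  move=> ns; transitivity ((1 * 1 + 1 * 0) ^+ 2 + (1 * 0 + 1 * 0) ^+ 2 + (1 * y + 1 * u) ^+ 2 +
    (1 * - y + 1 * v) ^+ 2 - (1 ^+ 2 + 0 ^+ 2 + y ^+ 2 + (- y) ^+ 2) -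
    (0 ^+ 2 + 0 ^+ 2 + u ^+ 2 + v ^+ 2)); first by ring.
  by rewrite ns n0 nuv !subr0.
have e1 : y * u + y * v = 0.
  apply: (mulfI two); rewrite mulr0.
  have := DB_null nfull (DB_comb 1 1 D1 Duv).
  move=> ns; transitivity ((1 * 0 + 1 * 0) ^+ 2 + (1 * 1 + 1 * 0) ^+ 2 + (1 * y + 1 * u) ^+ 2 +
    (1 * y + 1 * v) ^+ 2 - (0 ^+ 2 + 1 ^+ 2 + y ^+ 2 + y ^+ 2) -
    (0 ^+ 2 + 0 ^+ 2 + u ^+ 2 + v ^+ 2)); first by ring.
  by rewrite ns n1 nuv !subr0.
have nzy : y != 0.
  by apply/eqP=> y0; move/eqP: cyz; rewrite y0 expr0n addr0 eq_sym oppr_eq0 oner_eq0.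
have u0 : u = 0.
  apply: (mulfI nzy); apply: (mulfI two); rewrite !mulr0.
  by transitivity ((y * u - y * v) + (y * u + y * v)); [ring | rewrite e0 e1 addr0].
have v0 : v = 0.
  by apply: (mulfI nzy); move: e1; rewrite u0 !mulr0 add0r.
have nA2 : ~ DA (- a1) (- a0).
  move=> Da; apply: nDv; apply: D_sum Da _ (DC_2 (D_DC Dv)).
  apply: (DB_eq (DB_comb (- b1) (- b0) D0 D1)).
  - by ring.
  - by ring.
  - by apply/eqP; rewrite -subr_eq0; apply/eqP; rewrite -[RHS]u0 /u; ring.
  - by apply/eqP; rewrite -subr_eq0; apply/eqP; rewrite -[RHS]oppr0 -v0 /v; ring.
by have [w [w2 w1 Dw]] := D_A_line (D_DA Dv) nA2; exists w, y.
Qed.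

End Submodules.

(** * Counting squares *)

Lemma odd_mod4 p : odd p -> p %% 4 = 1 \/ p %% 4 = 3.
Proof. lia. Qed.

(** Meant for [b] telling whether -2 is a square and [n] the size of a set with a free
    involution. *)
Lemma mod8_of_parity p n (b : bool) : odd p -> ~~ odd n ->
  4 * (b + ((p %% 4 == 1) + n)) = (if p %% 4 == 1 then p - 1 else p + 1) ->
  (p %% 8 \in [:: 1; 3]) = b.
Proof.
move=> p_odd n_even; rewrite !inE; have [k ->] : exists k, n = k.*2 by exists n./2; lia.
by case: (odd_mod4 p_odd) => p4; rewrite p4 /=; case: b; lia.
Qed.

Section SquareCounts.
Local Open Scope ring_scope.

Variable p : nat.
Hypotheses (p_prime : prime p) (p_odd : odd p).
Local Notation F := 'F_p.

Let two : (2 : F) != 0.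
Proof.
rewrite -[2]/(2%:R) -(dvdn_pcharf (pchar_Fp p_prime)) gtnNdvd //.
by case: p p_prime p_odd => [|[|[|]]].
Qed.

Let cardF : #|F| = p. Proof. exact: card_Fp. Qed.

Let expFp (x : F) : x ^+ p = x. Proof. by rewrite -{2}(expf_card x) cardF. Qed.

Lemma Fp_prim_root : exists z : F, p.-1.-primitive_root z.
Proof.
have p1 : (0 < p.-1)%N by case: p p_prime p_odd => [|[|[|]]].
have := @has_prim_root F p.-1 (enum [set x : F | x != 0]) p1.
case/(_ _ _ _)/hasP => [|||z _ pz]; last by exists z.
- apply/allP=> x; rewrite mem_enum inE => nzx; rewrite unity_rootE.
  apply/eqP; apply: (mulfI nzx); rewrite mulr1 -exprS prednK ?prime_gt0 //.
- exact: enum_uniq.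
- rewrite -cardE; have := cardsC1 (0 : F); rewrite cardF => <-.
  by apply/subset_leq_card/subsetP=> x; rewrite !inE.
Qed.

Lemma Fp_sqrtN1 : (p %% 4 = 1)%N -> exists i : F, i ^+ 2 = -1.
Proof.
move=> p4; have [z pz] := Fp_prim_root; exists (z ^+ (p.-1 %/ 4)%N).
have p1 : (0 < p.-1)%N by case: p p_prime p_odd => [|[|[|]]].
have sq : (z ^+ (p.-1 %/ 4)%N) ^+ 2 ^+ 2 == 1.
  by rewrite -!exprM; apply/eqP; rewrite -(prim_expr_order pz); congr (_ ^+ _); lia.
rewrite sqrf_eq1 in sq; case/orP: sq => /eqP // sq.
have dv : (p.-1 %| p.-1 %/ 4 * 2)%N by rewrite (prim_order_dvd pz) exprM sq.
have pos : (0 < p.-1 %/ 4 * 2)%N by lia.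
by have := dvdn_leq pos dv; lia.
Qed.

Lemma Fp_sqrtN1_nex (i : F) : (p %% 4 = 3)%N -> i ^+ 2 != -1.
Proof.
move=> p4; apply/eqP=> i2; have E : (p = (2 * 2 * (p %/ 4) + 2).+1)%N by lia.
have := congr1 (fun n => i ^+ n) E; rewrite /= expFp exprS exprD !exprM !i2.
rewrite sqrrN !expr1n mul1r mulrN1 => /eqP.
rewrite -subr_eq0 opprK -mulr2n -mulr_natr mulf_eq0 (negbTE two) orbF => /eqP i0.
by move/eqP: i2; rewrite i0 expr0n eq_sym oppr_eq0 oner_eq0.
Qed.

(** The condition on w excludes p = 3, where 1 is a root of the polynomial. *)
Lemma Fp_cube_root : (p %% 3 = 1)%N <-> exists w : F, w ^+ 2 + w + 1 = 0 /\ w != 1.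
Proof.
split=> [p3 | [w [w2 w1]]].
  have [z pz] := Fp_prim_root; pose w := z ^+ (p.-1 %/ 3)%N; exists w.
  have p1 : (0 < p.-1)%N by case: p p_prime p_odd => [|[|[|]]].
  have nw1 : w != 1.
    have pos : (0 < p.-1 %/ 3)%N by lia.
    by rewrite /w -(prim_order_dvd pz); apply/negP=> /(dvdn_leq pos); lia.
  split=> //; apply: (mulfI (x := w - 1)); first by rewrite subr_eq0.
  rewrite mulr0; transitivity (w ^+ 3 - 1); first by ring.
  by rewrite -exprM; apply/eqP; rewrite subr_eq0 -(prim_order_dvd pz); apply/dvdnP; exists 1%N; lia.
have w3 : w ^+ 3 = 1.
  by apply/eqP; rewrite -subr_eq0; apply/eqP; transitivity ((w - 1) * (w ^+ 2 + w + 1));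
    [ring | rewrite w2 mulr0].
have nz : w != 0 by apply/eqP=> w0; move/eqP: w3; rewrite w0 expr0n eq_sym oner_eq0.
have := congr1 (fun n => w ^+ n) (divn_eq p 3); rewrite /= expFp exprD mulnC exprM w3 expr1n mul1r.
have := ltn_pmod p (isT : 0 < 3)%N.
case: (p %% 3)%N => [|[|[|]]] // _; first by rewrite expr0 => E; rewrite E eqxx in w1.
by rewrite expr2 -[LHS]mulr1 => /(mulfI nz) E; rewrite -E eqxx in w1.
Qed.

Definition sqrts (x : F) : {set F} := [set u | u ^+ 2 == x].

Lemma card_sqrts0 : #|sqrts 0| = 1%N.
Proof.
rewrite -(cards1 (0 : F)); congr #|pred_of_set _|.
by apply/setP=> u; rewrite !inE sqrf_eq0.
Qed.

Lemma card_sqrts (u x : F) : x != 0 -> u ^+ 2 = x -> #|sqrts x| = 2.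
Proof.
move=> nzx eqx; rewrite -eqx in nzx *; have nzu : u != 0 by rewrite -sqrf_eq0.
have -> : sqrts (u ^+ 2) = [set u; - u] by apply/setP=> v; rewrite !inE eqf_sqr.
rewrite cards2; suff -> : u != - u by [].
by rewrite -subr_eq0 opprK (_ : u + u = 2 * u) ?mulf_neq0 //; ring.
Qed.

Lemma card_sqrts_eq0 (x : F) : (forall u, u ^+ 2 != x) -> #|sqrts x| = 0%N.
Proof. by move=> nsq; apply: eq_card0 => u; rewrite inE (negbTE (nsq u)). Qed.

Definition squares : {set F} := [set u ^+ 2 | u : F].

Lemma squaresP x : reflect (exists u, u ^+ 2 = x) (x \in squares).
Proof. by apply: (iffP imsetP) => [[u _ ->] | [u <-]]; exists u. Qed.

Lemma card_sqrtsE x : x != 0 -> #|sqrts x| = (2 * (x \in squares))%N.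
Proof.
move=> nzx; case: squaresP => [[u] | nsq]; first exact: card_sqrts.
by rewrite card_sqrts_eq0 // => u; apply/eqP=> ux; apply: nsq; exists u.
Qed.

Lemma card_fibres (T R : finType) (f : T -> R) (A : {set T}) :
  #|A| = (\sum_r #|[set t in A | f t == r]|)%N.
Proof.
rewrite -sum1_card (partition_big f predT) //=; apply: eq_bigr => r _.
by rewrite -sum1_card; apply: eq_bigl => t; rewrite inE.
Qed.

Lemma sum_card_sqrts : (\sum_(x : F) #|sqrts x|)%N = p.
Proof.
rewrite -[RHS]cardF -cardsT (card_fibres (fun u : F => u ^+ 2)).
by apply: eq_bigr => x _; apply: eq_card => u; rewrite !inE.
Qed.

Lemma card_squares : (p < 2 * #|squares|)%N.
Proof.
have sq0 : 0 \in squares by apply/squaresP; exists 0; rewrite expr0n.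
have E := sum_card_sqrts; rewrite (bigD1 0) //= card_sqrts0 in E.
have {}E : (p = (\sum_(x : F | x != 0%R) #|sqrts x|).+1)%N by rewrite -[LHS]E.
have := cardsD1 0 squares; rewrite sq0 add1n => ->; rewrite {1}E.
suff : (\sum_(x : F | x != 0%R) #|sqrts x| <= 2 * #|squares :\ 0%R|)%N by move=> le; rewrite mulnS add2n !ltnS.
rewrite (eq_bigr (fun x => 2 * (x \in squares)))%N; last by move=> x; apply: card_sqrtsE.
rewrite -big_distrr /= leq_mul2l -sum1_card [leqRHS]big_mkcond [leqLHS]big_mkcond /=.
by apply: leq_sum => x _; rewrite !inE; case: (x == 0) (x \in _) => [] [].
Qed.

(** The squares and their differences from [c] each fill more than half of the field, so they
    meet. *)
Lemma sum_two_squares (c : F) : exists a b, a ^+ 2 + b ^+ 2 = c.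
Proof.
pose Q' := [set c - x | x in squares].
have cQ' : #|Q'| = #|squares| by rewrite card_imset // => x y /addrI/oppr_inj.
have : ~~ [disjoint squares & Q'].
  apply/negP=> /disjoint_setI0 dis.
  have := cardsUI squares Q'; rewrite dis cards0 addn0 cQ' => E.
  have := max_card (mem (squares :|: Q')); rewrite cardF E.
  by have := card_squares; lia.
case/pred0Pn=> x /andP[/squaresP[a ax] /imsetP[y /squaresP[b by_] xy]].
by exists a, b; rewrite ax by_ xy subrK.
Qed.

Definition circle (c : F) : {set F * F} := [set w | w.1 ^+ 2 + w.2 ^+ 2 == c].

(** Multiplication by a + b i, of norm [d], maps one circle injectively into the other. *)
Lemma leq_card_circle (c d : F) : d != 0 -> (#|circle c| <= #|circle (c * d)%R|)%N.
Proof.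
move=> nzd; have [a [b abd]] := sum_two_squares d.
pose f (w : F * F) := (w.1 * a - w.2 * b, w.1 * b + w.2 * a).
have f_inj : injective f.
  move=> [u v] [u' v'] eqf; have e1 := congr1 fst eqf; have e2 := congr1 snd eqf.
  rewrite /= in e1 e2.
  have E x y x' y' : x * a - y * b = x' * a - y' * b -> x * b + y * a = x' * b + y' * a ->
      x = x' /\ y = y'.
    move=> h1 h2; split; apply: (mulfI nzd); rewrite -abd.
      transitivity ((x * a - y * b) * a + (x * b + y * a) * b); first by ring.
      by rewrite h1 h2; ring.
    transitivity ((x * b + y * a) * a - (x * a - y * b) * b); first by ring.
    by rewrite h1 h2; ring.
  by have [-> ->] := E _ _ _ _ e1 e2.
rewrite -(card_imset (circle c) f_inj); apply/subset_leq_card/subsetP=> _ /imsetP[[u v] uvc ->].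
move: uvc; rewrite !inE /= => /eqP <-; rewrite -abd; apply/eqP; ring.
Qed.

Lemma card_circle_eq (c : F) : c != 0 -> #|circle c| = #|circle 1|.
Proof.
move=> nzc; apply/eqP; rewrite eqn_leq.
have := leq_card_circle c (invr_neq0 nzc); rewrite mulfV // => ->.
by have := leq_card_circle 1 nzc; rewrite mul1r.
Qed.

Lemma card_circle_sum (c : F) : #|circle c| = (\sum_s #|sqrts s| * #|sqrts (c - s)%R|)%N.
Proof.
rewrite (card_fibres (fun w => w.1 ^+ 2)); apply: eq_bigr => s _.
rewrite -cardsX; apply: eq_card => [[u v]]; rewrite !inE /= andbC.
by case: eqP => //= ->; rewrite [RHS]eq_sym subr_eq addrC eq_sym.
Qed.

Lemma sum_card_circle : (\sum_c #|circle c|)%N = (p * p)%N.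
Proof.
have -> : (p * p)%N = #|[set: F * F]| by rewrite cardsT card_prod cardF.
rewrite (card_fibres (fun w => w.1 ^+ 2 + w.2 ^+ 2)).
by apply: eq_bigr => c _; apply: eq_card => w; rewrite !inE.
Qed.

Lemma sqrts_opp (i x : F) : i ^+ 2 = -1 -> #|sqrts (- x)| = #|sqrts x|.
Proof.
move=> i2; have nzi : i != 0.
  by apply/eqP=> i0; move/eqP: i2; rewrite i0 expr0n eq_sym oppr_eq0 oner_eq0.
rewrite -(card_imset (sqrts x) (mulfI nzi)); apply: eq_card => u.
apply/idP/imsetP=> [|[v]]; rewrite !inE => /eqP; last by move=> vx ->; rewrite exprMn i2 vx mulN1r.
move=> ux; exists (- i * u); first by rewrite inE exprMn sqrrN i2 ux mulN1r opprK.
by rewrite mulrA mulrN -expr2 i2 opprK mul1r.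
Qed.

(** The circles partition the p^2 points of the plane, those with nonzero [c] have equal size, and
    the circle of 0 is two lines or one point according as -1 is a square or not. *)
Lemma card_circle_neq0 (c : F) : c != 0 ->
  #|circle c| = (if p %% 4 == 1 then p - 1 else p + 1)%N.
Proof.
move=> nzc; have p_gt2 : (2 < p)%N by case: p p_prime p_odd => [|[|[|]]].
have := sum_card_circle; rewrite (bigD1 0) //=.
rewrite (eq_bigr (fun=> #|circle c|)); last first.
  by move=> x nzx; rewrite !card_circle_eq.
rewrite sum_nat_const.
have -> : #|[pred x : F | x != 0]| = p.-1.
  by have := cardC1 (0 : F); rewrite cardF => <-; apply: eq_card => x; rewrite !inE.
have p4 := odd_mod4 p_odd.
have c0 : #|circle 0| = (if p %% 4 == 1 then 2 * (p - 1) + 1 else 1)%N.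
  rewrite card_circle_sum (bigD1 0) //= subr0 card_sqrts0.
  case: p4 => p4; rewrite p4 /=.
    have [i i2] := Fp_sqrtN1 p4.
    rewrite (eq_bigr (fun s => 2 * #|sqrts s|)%N); last first.
      move=> s nzs; rewrite sub0r (sqrts_opp _ i2) card_sqrtsE //.
      by case: (_ \in _).
    rewrite -big_distrr /=; have := sum_card_sqrts; rewrite (bigD1 0) //= card_sqrts0.
    by set S := (\sum_(i | _) _)%N; lia.
  rewrite big1 // => s nzs; rewrite sub0r !card_sqrtsE ?oppr_eq0 //.
  case: squaresP => [[u us] | //]; case: squaresP => [[v vs] | //].
  have nzu : u != 0 by rewrite -sqrf_eq0 us.
  have := Fp_sqrtN1_nex (v / u) p4; rewrite expr_div_n us vs mulNr divff ?eqxx //.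
rewrite {}c0; case: p4 => -> /=; nia.
Qed.

(* The planes [in_plane y z] with [y != z], up to [aut_2] and [aut_3], correspond
   to the values [s = (y - z)^2], for which [- 2 - s = (y + z)^2]. *)
Definition params : {set F} := [set s | [&& s != 0, s \in squares & - 2 - s \in squares]].

Let neg2 : (- 2 : F) != 0. Proof. by rewrite oppr_eq0. Qed.

(** Roots u of s and v of -2 - s form a point of the circle of -2, and a parameter s has four such
    points unless s = -2. That one occurs when -2 is a square and has two; the two points with s =
    0, which is not a parameter, make up for the loss. *)
Lemma card_params : (4 * #|params| = if p %% 4 == 1 then p - 1 else p + 1)%N.
Proof.
rewrite -(card_circle_neq0 neg2) card_circle_sum -sum1_card big_distrr /= big_mkcond /=.
have n2 : (-2 : F) != 0 by apply: neg2.
rewrite (bigD1 0) // (bigD1 (- 2)) //= [RHS](bigD1 0) // [in RHS](bigD1 (- 2)) //=.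
rewrite subr0 subrr card_sqrts0 !inE eqxx /= subrr n2 /=.
have -> : 0 \in squares by apply/squaresP; exists 0; rewrite expr0n.
rewrite card_sqrtsE // andbT; rewrite !addnA; congr (_ + _)%N.
  by case: (_ \in _).
apply: eq_bigr => s /andP[nz0 nz2]; rewrite inE nz0 /= !card_sqrtsE //.
  by case: (s \in squares) (- 2 - s \in squares) => [] [].
by rewrite subr_eq0 eq_sym.
Qed.

Lemma even_card_involution (T : finType) (A : {set T}) (f : T -> T) :
  involutive f -> (forall x, x \in A -> f x \in A /\ f x != x) -> ~~ odd #|A|.
Proof.
move=> fK fA; pose B := [set x in A | (enum_rank x < enum_rank (f x))%N].
have AB : A :\: B = f @: B.
  apply/setP=> x; apply/setDP/imsetP=> [[xA xB] | [y /setIdP[yA lt] ->]]; last first.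
    have [fyA _] := fA y yA; split=> //.
    by rewrite inE fyA /= fK -leqNgt ltnW.
  have [fxA nfx] := fA x xA; exists (f x); rewrite ?fK // inE fxA fK /=.
  move: xB; rewrite inE xA /= -leqNgt leq_eqVlt => /orP[|//].
  by rewrite val_eqE (inj_eq enum_rank_inj) (negbTE nfx).
have BA : B \subset A by apply/subsetP=> x; rewrite inE => /andP[].
have := cardsD A B; rewrite AB (setIidPr BA) card_imset; last exact: inv_inj.
move=> E; have := subset_leq_card BA => le.
by have -> : #|A| = (#|B| * 2)%N; [lia | rewrite oddM andbF].
Qed.

(** Away from -2, which goes to 0, the map sending s to -2 - s is an involution of the parameters
    whose only possible fixed point is -1. Now -2 and -1 are parameters exactly when they are
    squares, so the parity of the number found in [card_params] decides whether -2 is a square. *)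
Lemma neg2_square : (p %% 8 \in [:: 1; 3])%N = ((- 2 : F) \in squares).
Proof.
have p_gt2 : (2 < p)%N by case: p p_prime p_odd => [|[|[|]]].
have n1 : (-1 : F) != 0 by rewrite oppr_eq0 oner_eq0.
have n12 : (-1 : F) != - 2.
  by rewrite -subr_eq0 opprK (_ : -1 + 2 = 1 :> F) ?oner_eq0 //; ring.
have sq0 : 0 \in squares by apply/squaresP; exists 0; rewrite expr0n.
pose A := params :\ (- 2) :\ (- 1).
have evA : ~~ odd #|A|.
  apply: (@even_card_involution _ _ (fun s => - 2 - s)) => [s|s]; first by ring.
  rewrite !inE => /and5P[s1 s2 s0 sq sq2]; split.
    apply/and5P; split.
    - by apply: contra s1 => /eqP E; apply/eqP; rewrite -[s]opprK -(subKr (-2) s) E; ring.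
    - by apply: contra s0 => /eqP E; apply/eqP; rewrite -(subKr (-2) s) E subrr.
    - by rewrite subr_eq0 eq_sym.
    - by [].
    - by rewrite subKr.
  apply: contra s1 => /eqP E; apply/eqP; apply: (mulfI two).
  by transitivity (s - (- 2 - s) - 2); [ring | rewrite E subrr; ring].
have m2 : (- 2 \in params) = (- 2 \in squares).
  by rewrite inE neg2 subrr sq0 andbT.
have m1 : (- 1 \in params :\ (- 2)) = (- 1 \in squares).
  by rewrite !inE n12 n1 (_ : -2 - -1 = -1 :> F) ?andbb //; ring.
have cardE : #|params| = (((- 2)%R \in squares) + (((- 1)%R \in squares) + #|A|))%N.
  by rewrite (cardsD1 (- 2)) m2 (cardsD1 (- 1) (params :\ _)) m1.
have := card_params; rewrite {}cardE.
suff -> : ((- 1)%R \in squares) = (p %% 4 == 1)%N by apply: mod8_of_parity.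
case: (odd_mod4 p_odd) => p4; rewrite p4 /=; first by apply/squaresP/(Fp_sqrtN1 p4).
by apply/squaresP=> [[i]]; apply/eqP/Fp_sqrtN1_nex.
Qed.

End SquareCounts.

(** * Covers of the Möbius-Kantor graph *)

Lemma GP83_connected : connected GP83.
Proof.
have chk : all (fun k => let s := behead (nth [::] tree_paths k) in
    [&& path gp_adj 0 s, last 0 s == k & all (fun j => j < 16) s]) table_id by vm_compute.
have from0 x : connect adj (vtx 0) x.
  have /and3P[pth /eqP lst /allP lt16] := allP chk _ (ord_table_id x).
  apply/connectP; exists (map vtx (behead (nth [::] tree_paths x))).
    rewrite path_map; apply: (sub_in_path (P := fun j => j < 16)) _ pth => /=.
      by move=> i j i16 j16 ij; rewrite -(vtxE i16) -(vtxE j16) in ij.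
    by apply/allP.
  by rewrite last_map lst -ord16P.
move=> x y; apply: connect_trans (from0 y).
by rewrite (sym_connect_sym (@adj_sym GP83)) from0.
Qed.

(** * Correspondence of covers under automorphisms *)

Section GoodCovers.

Variable p : nat.
Local Notation F := 'F_p.

Definition good_cover (X : sgraph) (P : graph_over X) : Prop :=
  [/\ connected P, covering (@proj _ P) & separated p (@proj _ P)].

(* [P] and [Q] determine subspaces of H^1 which correspond under [a]. *)
Definition related (X : sgraph) (P Q : graph_over X) (a : X -> X) : Prop :=
  forall c : X -> X -> F, exact_along (@proj _ Q) c <-> exact_along (@proj _ P) (pullback a c).

Lemma related_trans (X : sgraph) (P Q R : graph_over X) (a b : {perm X}) :
  related P Q a -> related Q R b -> related P R (a * b)%g.
Proof.
move=> rPQ rQR c; split=> [/rQR/rPQ | Wc]; last apply/rQR/rPQ; last move: Wc.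
  by apply: exact_along_ext => x y; rewrite /pullback !permM.
by apply: exact_along_ext => x y; rewrite /pullback !permM.
Qed.

Lemma related_sym (X : sgraph) (P Q : graph_over X) (a : {perm X}) :
  related P Q a -> related Q P (a^-1)%g.
Proof.
move=> rPQ c; split=> [Wc | /rPQ]; first apply/rPQ; last move=> Wc.
  by apply: exact_along_ext Wc => x y; rewrite /pullback !permK.
by apply: exact_along_ext Wc => x y; rewrite /pullback !permK.
Qed.

Lemma related_lift (X : sgraph) (P : graph_over X) (a : {perm X}) :
  a \in lift_set (@proj _ P) -> related P P a.
Proof.
move=> aP c; split; first by apply: exact_along_pullback; case/lift_setP: aP.
have : (a^-1)%g \in lift_set (@proj _ P) by rewrite groupV.
case/lift_setP=> _ la /(exact_along_pullback la).
by apply: exact_along_ext => x y; rewrite /pullback !permKV.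
Qed.

Lemma related_same (X : sgraph) (P P' Q : graph_over X) (a : {perm X}) :
  related P Q a -> related P' Q a ->
  forall c : X -> X -> F, exact_along (@proj _ P) c -> exact_along (@proj _ P') c.
Proof.
move=> rP rP' c Wc; have E x y : c x y = pullback a (pullback (a^-1)%g c) x y.
  by rewrite /pullback !permK.
have /rP/rP' : exact_along (@proj _ P) (pullback a (pullback (a^-1)%g c)).
  exact: exact_along_ext E Wc.
exact: exact_along_ext.
Qed.

Lemma related_iso (X : sgraph) (P Q : graph_over X) (a : {perm X}) :
  good_cover P -> good_cover Q -> a \in gaut X -> related P Q a -> isomorphic_over P Q.
Proof.
move=> [cP covP sepP] [cQ covQ sepQ] aX rPQ; exists a => //.
exact: covering_iso rPQ.
Qed.

Lemma iso_related (X : sgraph) (P Q : graph_over X) : isomorphic_over P Q ->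
  exists2 a, a \in gaut X & related P Q a.
Proof.
case=> a aX [f [[g fK gK] fadj] fE]; exists a => // c; split=> [[h hE] | [h hE]].
  by exists (h \o f) => x y xy /=; rewrite hE ?fadj // /pullback !fE.
exists (h \o g) => x y xy /=; rewrite hE /pullback ?fE ?gK //.
by rewrite -fadj !gK.
Qed.

Lemma isomorphic_over_trans (X : sgraph) (P Q R : graph_over X) :
  isomorphic_over P Q -> isomorphic_over Q R -> isomorphic_over P R.
Proof.
case=> a aX [f [bf fadj] fE] [b bX [g [bg gadj] gE]].
exists (a * b)%g; first exact: groupM.
exists (g \o f); last by move=> x /=; rewrite permM fE gE.
by split; [apply: bij_comp | move=> x y /=; rewrite gadj fadj].
Qed.

Lemma exact_along_anti (Y X : sgraph) (pr : Y -> X) (c : X -> X -> F) :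
  covering pr -> exact_along pr c -> forall x y, adj x y -> (c y x = - c x y)%R.
Proof.
case=> [[_ sur] ex _] [f fE] x y; have [u <-] := sur x => /ex[v uv <-].
by rewrite -!fE // ?opprB // adj_sym.
Qed.

End GoodCovers.

Section LiftedGroups.

Variables (p : nat) (p_prime : prime p) (P : graph_over GP83).
Hypothesis goodP : good_cover p P.
Local Notation F := 'F_p.
Let pr := @proj _ P.

Lemma semisymmetric_H : semisymmetric pr -> aut_i \in lift_set pr /\ aut_r \in lift_set pr.
Proof.
case=> etP _.
apply: (@edge_transitive_contains_H (lift_group pr)); first exact: lift_set_gaut.
exact: edge_transitive_projP.
Qed.

Lemma semisymmetric_not_2 : semisymmetric pr -> aut_2 \notin lift_set pr.
Proof.
move=> ss; have [iP rP] := semisymmetric_H ss; apply/negP=> P2; case: ss => _; apply.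
apply: (@vertex_transitive_proj_intro _ _ _ (vtx 0)) => x.
exact: (@vertex_transitive_H2 (lift_group pr) tab_2).
Qed.

Lemma semisymmetric_not_3 : semisymmetric pr -> aut_3 \notin lift_set pr.
Proof.
move=> ss; have [iP rP] := semisymmetric_H ss; apply/negP=> P3; case: ss => _; apply.
apply: (@vertex_transitive_proj_intro _ _ _ (vtx 0)) => x.
exact: (@vertex_transitive_H2 (lift_group pr) tab_3).
Qed.

Lemma group_H_lift : aut_i \in lift_set pr -> aut_r \in lift_set pr ->
  forall h, h \in group_H -> h \in lift_set pr.
Proof.
move=> iP rP h; have /subsetP : group_H \subset lift_group pr.
  by rewrite gen_subG subUset !sub1set; apply/andP.
exact.
Qed.

(** A vertex-transitive lifting group would contain an element taking 0 to 1, which is t_2 or t_3 up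
    to an element of H. *)
Lemma semisymmetric_intro : aut_i \in lift_set pr -> aut_r \in lift_set pr ->
  aut_2 \notin lift_set pr -> aut_3 \notin lift_set pr -> semisymmetric pr.
Proof.
move=> iP rP n2 n3; split.
  apply: (@edge_transitive_proj_intro _ _ _ [set vtx 0; vtx 1]).
    exact: edge_vtx.
  exact: (@edge_transitive_H (lift_group pr)).
move/vertex_transitive_projP/(_ (vtx 0) (vtx 1))=> [a aP a01].
have HP := group_H_lift iP rP.
have [h hH [] def_a] := gaut_swap (subsetP (lift_set_gaut pr) _ aP) a01.
- by case/negP: n2; rewrite -(groupMl (G := lift_group pr) _ (HP h hH)) -def_a.
- by case/negP: n3; rewrite -(groupMl (G := lift_group pr) _ (HP h hH)) -def_a.
Qed.

End LiftedGroups.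

Lemma no_semisymmetric_2 (P : graph_over GP83) : good_cover 2 P -> ~ semisymmetric (@proj _ P).
Proof.
move=> [cP covP sepP] ss.
have [iP rP] := semisymmetric_H ss; case/negP: (semisymmetric_not_2 ss).
apply: (pullback_exact_liftable (p := 2)) => // [|c Wc]; first exact: aut_2_gaut.
apply: (F2_stable _ _ (exact_along_anti covP Wc) Wc); first by case: covP => [[]].
move=> h hH c'; apply: exact_along_pullback.
by have /lift_setP[] := group_H_lift iP rP hH.
Qed.

(** * Semisymmetry and minimality in terms of the coordinates of killed classes *)

Section OddCovers.
Local Open Scope ring_scope.

Variables (p : nat).
Hypotheses (p_prime : prime p) (p_odd : odd p).
Local Notation F := 'F_p.

(* The class with coordinates [v] becomes trivial on [Y]. *)
Definition killed (Y : sgraph) (pr : Y -> GP83) (v : seq F) : Prop :=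
  exact_along pr (beta adapted_base v).

Lemma killed_ext (Y : sgraph) (pr : Y -> GP83) u v :
  (forall j, (j < 9)%N -> u`_j = v`_j) -> killed pr u -> killed pr v.
Proof. by move=> E; apply: exact_along_ext => x y; apply: beta_ext => j; apply: E. Qed.

Lemma killed_lin (Y : sgraph) (pr : Y -> GP83) s t u v :
  killed pr u -> killed pr v -> killed pr (lin_row s t u v).
Proof.
move=> Du Dv; apply: exact_along_ext (exact_along_comb s t Du Dv) => x y.
by rewrite beta_lin.
Qed.

Lemma exact_sub_sym (X : sgraph) (c c' : X -> X -> F) :
  exact (fun x y => c x y - c' x y) -> exact (fun x y => c' x y - c x y).
Proof.
by case=> g gE; exists (fun x => - g x) => x y xy; rewrite -opprD gE // opprB.
Qed.

Lemma exact_pullback (a : {perm GP83}) (c : GP83 -> GP83 -> F) :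
  a \in gaut GP83 -> exact c -> exact (pullback a c).
Proof.
by move=> /gautP aX [g gE]; exists (g \o a) => x y xy /=; rewrite gE ?aX.
Qed.

Section Action.

Variables (a : {perm GP83}) (t : seq nat) (den : int) (M : seq (seq int)).
Hypotheses (aX : a \in gaut GP83) (at_ : table_of a = t).
Hypotheses (chk : act_check adapted_base t den M) (nz_den : (den%:~R : F) != 0).

Lemma killed_act (Y : sgraph) (pr : Y -> GP83) v : graph_morphism pr ->
  killed pr (act_row M v) <-> exact_along pr (pullback a (beta adapted_base v)).
Proof.
move=> mor; have ex := pullback_beta v at_ chk; split=> W.
  have W' := exact_along_cohomologous mor ex W.
  apply: exact_along_ext (exact_along_comb (den%:~R^-1) 0 W' W') => x y /=.
  by rewrite mul0r addr0 mulKf.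
apply: (exact_along_cohomologous mor (exact_sub_sym ex)).
apply: exact_along_ext (exact_along_comb den%:~R 0 W W) => x y /=.
by rewrite mul0r addr0.
Qed.

Lemma related_act (P Q : graph_over GP83) :
  covering (@proj _ P) -> covering (@proj _ Q) ->
  (forall v, killed (@proj _ Q) v <-> killed (@proj _ P) (act_row M v)) ->
  related p P Q a.
Proof.
move=> covP covQ E c; have [[[morP _] _ _] [[morQ _] _ _]] := (covP, covQ).
have adja x y : adj (a x) (a y) = adj x y by apply: gautP.
(* Only antisymmetric cochains have coordinates; the others are killed by no cover. *)
have [anti | nanti] := classic (forall x y, adj x y -> c y x = - c x y); last first.
  split=> W; case: nanti; first exact: exact_along_anti W.
  move=> x y xy; have := @exact_along_anti p _ _ _ (pullback a c) covP W
    ((a^-1)%g x) ((a^-1)%g y).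
  by rewrite /pullback !permKV; apply; rewrite -adja !permKV.
have [v ex] := exact_adapted p_prime p_odd anti.
have exa := exact_pullback aX ex.
split=> W.
  have /E/(killed_act _ morP) : killed (@proj _ Q) v.
    exact: exact_along_cohomologous (exact_sub_sym ex) W.
  exact: exact_along_cohomologous exa.
apply: (exact_along_cohomologous morQ ex); apply/E/(killed_act _ morP).
exact: exact_along_cohomologous (exact_sub_sym exa) W.
Qed.

Lemma lift_act (P : graph_over GP83) : good_cover p P ->
  a \in lift_set (@proj _ P) <->
  forall v, killed (@proj _ P) v -> killed (@proj _ P) (act_row M v).
Proof.
move=> [cP covP sepP]; have [[morP _] _ _] := covP; split=> [aP v Dv | stab].
  by apply/(killed_act _ morP)/exact_along_pullback => //; case/lift_setP: aP.
apply: (pullback_exact_liftable (p := p)) => // c Wc.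
have [v ex] := exact_adapted p_prime p_odd (exact_along_anti covP Wc).
apply: (exact_along_cohomologous morP (exact_pullback aX ex)).
apply/(killed_act _ morP)/stab.
exact: exact_along_cohomologous (exact_sub_sym ex) Wc.
Qed.

End Action.

Let nz1 : ((1 : int)%:~R : F) != 0. Proof. exact: oner_neq0. Qed.
Let nz2 : ((2 : int)%:~R : F) != 0. Proof. exact: two_neq0. Qed.

Definition lift_act_i := lift_act aut_i_gaut table_of_i act_check_i nz1.
Definition lift_act_r := lift_act aut_r_gaut table_of_r act_check_r nz2.
Definition lift_act_2 := lift_act aut_2_gaut table_of_2 act_check_2 nz1.
Definition lift_act_3 := lift_act aut_3_gaut table_of_3 act_check_3 nz1.

Definition semisymmetric_module (D : seq F -> Prop) : Prop :=
  [/\ forall v, D v -> D (act_row mat_i v), forall v, D v -> D (act_row mat_r v),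
      ~ forall v, D v -> D (act_row mat_2 v) & ~ forall v, D v -> D (act_row mat_3 v)].

Lemma semisymmetricE (P : graph_over GP83) : good_cover p P ->
  semisymmetric (@proj _ P) <-> semisymmetric_module (killed (@proj _ P)).
Proof.
move=> goodP; split=> [ss | [Di Dr n2 n3]].
  have [iP rP] := semisymmetric_H ss; split.
  - exact/(lift_act_i goodP).
  - exact/(lift_act_r goodP).
  - by move/(lift_act_2 goodP) => P2; case/negP: (semisymmetric_not_2 ss).
  - by move/(lift_act_3 goodP) => P3; case/negP: (semisymmetric_not_3 ss).
apply: semisymmetric_intro.
- exact/(lift_act_i goodP).
- exact/(lift_act_r goodP).
- by apply/negP=> /(lift_act_2 goodP).
- by apply/negP=> /(lift_act_3 goodP).
Qed.

Lemma exact_along_of_killed (P Q : graph_over GP83) : covering (@proj _ P) -> covering (@proj _ Q) ->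
  (forall v, killed (@proj _ P) v -> killed (@proj _ Q) v) ->
  forall c : GP83 -> GP83 -> F, exact_along (@proj _ P) c -> exact_along (@proj _ Q) c.
Proof.
move=> covP covQ sub c Wc; have [[[morP _] _ _] [[morQ _] _ _]] := (covP, covQ).
have [v ex] := exact_adapted p_prime p_odd (exact_along_anti covP Wc).
apply: (exact_along_cohomologous morQ ex); apply: sub.
exact: exact_along_cohomologous (exact_sub_sym ex) Wc.
Qed.

Lemma elementary_abelian_good (P : graph_over GP83) : connected P ->
  elementary_abelian_covering (@proj _ P) p -> good_cover p P.
Proof.
move=> cP [N [/regular_covering_byP[covP dgN] abN _]]; split=> //.
exact: abelem_separated covP dgN abN.
Qed.

Section Model.

Variables (d : nat) (ws : 'I_d -> seq F).

Definition voltage (x y : GP83) : 'rV[F]_d := \row_k beta adapted_base (ws k) x y.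

Lemma voltage_anti x y : voltage y x = - voltage x y.
Proof. by apply/rowP=> k; rewrite !mxE beta_anti. Qed.

Definition model : graph_over GP83 := derived_cover voltage_anti.

Definition comb (l : 'cV[F]_d) : seq F := mkseq (fun j => \sum_k (ws k)`_j * l k 0) 9.

Lemma voltage_comb l x y : (voltage x y *m l) 0 0 = beta adapted_base (comb l) x y.
Proof.
rewrite mxE /beta; under eq_bigr do rewrite mxE mulr_suml.
rewrite exchange_big /=; apply: eq_bigr => j _.
by rewrite nth_mkseq // mulr_suml; apply: eq_bigr => k _; rewrite mulrAC.
Qed.

Hypothesis indep : forall l, (forall j, (j < 9)%N -> (comb l)`_j = 0) -> l = 0.

Lemma model_good : good_cover p model.
Proof.
split; [|exact: derived_covering | exact: derived_separated].
apply: derived_connected; first exact: GP83_connected.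
move=> l ex; apply: indep; apply: (beta_exact0 p_prime p_odd).
by apply: exact_ext ex => x y _; rewrite voltage_comb.
Qed.

Lemma killed_model v : killed (@proj _ model) v <->
  exists l, forall j, (j < 9)%N -> v`_j = (comb l)`_j.
Proof.
have [cM _ _] := model_good; split.
  case/(derived_exact_along _ cM)=> l ex; exists l => j j9.
  have := @beta_exact0 p p_prime p_odd (lin_row 1 (-1) v (comb l)) _ j j9.
  rewrite nth_mkseq // mul1r mulN1r => /(_ _)/eqP; rewrite subr_eq0 => /(_ _)/eqP; apply.
  by apply: exact_ext ex => x y _; rewrite beta_lin voltage_comb mul1r mulN1r.
case=> l E; apply/(derived_exact_along _ cM); exists l.
exists (fun=> 0) => x y _; rewrite voltage_comb subrr.
by rewrite (beta_ext _ _ _ (fun j => E j (ltn_ord j))) subrr.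
Qed.

Lemma killed_ws k : killed (@proj _ model) (ws k).
Proof.
apply/killed_model; exists (delta_mx k 0) => j j9; rewrite nth_mkseq // (bigD1 k) //= big1.
  by rewrite mxE !eqxx mulr1 addr0.
by move=> i nik; rewrite mxE (negbTE nik) mulr0.
Qed.

Hypothesis d_gt0 : (0 < d)%N.
Hypothesis ssM : semisymmetric_module (killed (@proj _ model)).

Lemma model_elementary_abelian : elementary_abelian_covering (@proj _ model) p.
Proof. exact: derived_elementary_abelian (vtx 0) d_gt0. Qed.

(** An intermediate semisymmetric cover kills a module [D] of the same kind; if this must be
    everything, [middle_proper] is contradicted. *)
Lemma model_minimal :
  (forall D : seq F -> Prop,
    (forall u v, (forall j, (j < 9)%N -> u`_j = v`_j) -> D u -> D v) ->
    (forall s t u v, D u -> D v -> D (lin_row s t u v)) ->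
    semisymmetric_module D -> (forall v, D v -> killed (@proj _ model) v) ->
    forall v, killed (@proj _ model) v -> D v) ->
  minimal_semisymmetric_elab_cover p model.
Proof.
move=> minD; have [cM covM sepM] := model_good.
have [N [/regular_covering_byP[_ dgN] abN _]] := model_elementary_abelian.
split=> //; first exact: model_elementary_abelian.
split; first exact/(semisymmetricE model_good).
case=> Z [pr2 [pr1 [pr12 reg2 reg1 ss1]]].
pose Q := GraphOver pr1.
have goodQ : good_cover p Q.
  split; first exact: (@middle_connected model cM Z pr2 reg2).
    exact: middle_covering reg1.
  exact: (middle_separated cM covM dgN abN pr12 reg2).
have covQ : covering (@proj _ Q) by case: goodQ.
apply: (middle_proper cM covM dgN abN pr12 reg2 (p := p)).
apply: (@exact_along_of_killed model Q) => //.
apply: minD; [exact: killed_ext | exact: killed_lin | exact/(semisymmetricE goodQ)|].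
by move=> v; apply: middle_exact_along pr12 reg2 _.
Qed.

(** The model lies below [P]; if it killed less, it would be an intermediate cover contradicting the
    minimality of [P]. *)
Lemma model_captures (P : graph_over GP83) :
  minimal_semisymmetric_elab_cover p P -> (forall k, killed (@proj _ P) (ws k)) ->
  isomorphic_over model P.
Proof.
case=> cP elP [ssP minP] Dws; have goodP := elementary_abelian_good cP elP.
have [_ covP _] := goodP; have [[morP _] _ _] := covP.
have [cM covM sepM] := model_good.
have Pl (l : 'cV[F]_d) : exact_along (@proj _ P) (fun x y => (voltage x y *m l) 0 0).
  apply: exact_along_ext (exact_along_sum (fun k => l k 0) Dws) => x y.
  by rewrite mxE; apply: eq_bigr => k _; rewrite !mxE mulrC.
have sub : forall c : GP83 -> GP83 -> F, exact_along (@proj _ P) c -> exact_along (@proj _ model) c.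
  apply: NNPP => proper; case: minP.
  have [N [/regular_covering_byP[_ dgN] abN _]] := elP.
  have [pr2 [pr12 reg2]] := derived_decomposition cP covP dgN cM Pl proper.
  exists model, pr2, (@proj _ model); split=> //.
    by have [N' [rN' _ nt]] := model_elementary_abelian; exists N'.
  exact/(semisymmetricE model_good).
apply: (related_iso (a := 1%g) model_good goodP); first exact: group1.
move=> c; split=> [/sub | Wc].
  by apply: exact_along_ext => x y; rewrite /pullback !perm1.
have {}Wc : exact_along (@proj _ model) c.
  by apply: exact_along_ext Wc => x y; rewrite /pullback !perm1.
have [l ex] := (derived_exact_along c cM).1 Wc.
exact: exact_along_cohomologous ex (Pl l).
Qed.

End Model.
End OddCovers.

(** * The two families of solutions *)

Section Families.
Local Open Scope ring_scope.

Variables (p : nat).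
Hypotheses (p_prime : prime p) (p_odd : odd p).
Local Notation F := 'F_p.

(** Proves an equation by exhibiting it as a multiple of a known one; the side condition is an
    identity for [ring]. *)
Lemma eq_of_mul (c x y x' y' : F) : x = y -> x' - y' = c * (x - y) -> x' = y'.
Proof. by move=> -> /eqP; rewrite subrr mulr0 subr_eq0 => /eqP. Qed.

Lemma act_row_vec M (v : seq F) :
  act_row M v = act_row M (vec v`_0 v`_1 v`_2 v`_3 v`_4 v`_5 v`_6 v`_7 v`_8).
Proof.
apply: eq_mkseq => j; apply: eq_bigr => i _; congr (_ * _).
by move: (i : nat) (ltn_ord i); apply: forall_ord9.
Qed.

Lemma vec_ext (u v : seq F) : size u = 9%N -> size v = 9%N ->
  (forall j, (j < 9)%N -> u`_j = v`_j) -> u = v.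
Proof. by move=> su sv E; apply: (eq_from_nth (x0 := 0)); rewrite su ?sv. Qed.

Lemma act_iE (v : seq F) : act_row mat_i v =
  vec v`_0 v`_1 (- v`_3) v`_2 (- v`_5) v`_4 v`_6 (- v`_7) (- v`_8).
Proof. by rewrite act_row_vec; apply: vec_ext => [||j /act_i_vec] //; rewrite size_mkseq. Qed.

Lemma act_rE (v : seq F) : act_row mat_r v =
  vec (2 * - v`_1) (2 * (v`_0 - v`_1)) (- v`_2 + v`_3 + v`_4 + v`_5)
    (- v`_2 - v`_3 + v`_4 - v`_5) (- v`_2 - v`_3 - v`_4 + v`_5) (- v`_2 + v`_3 - v`_4 - v`_5)
    (2 * v`_8) (2 * v`_6) (2 * v`_7).
Proof. by rewrite act_row_vec; apply: vec_ext => [||j /act_r_vec] //; rewrite size_mkseq. Qed.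

Lemma act_2E (v : seq F) : act_row mat_2 v =
  vec (- v`_1) (- v`_0) (- v`_3) (- v`_2) (- v`_4) v`_5 (- v`_6) v`_8 v`_7.
Proof. by rewrite act_row_vec; apply: vec_ext => [||j /act_2_vec] //; rewrite size_mkseq. Qed.

Lemma act_3E (v : seq F) : act_row mat_3 v =
  vec (- v`_0) (- v`_1) (- v`_3) v`_2 v`_5 (- v`_4) v`_6 v`_7 v`_8.
Proof. by rewrite act_row_vec; apply: vec_ext => [||j /act_3_vec] //; rewrite size_mkseq. Qed.

(* When [y^2 + z^2 = -1], this plane of the quaternion part is the left ideal of
   the elements [b] with [b (i + y j + z k) = 0]. *)
Definition in_plane (y z : F) (v : seq F) : Prop :=
  [/\ v`_4 = v`_2 * z + v`_3 * y, v`_5 = v`_3 * z - v`_2 * y, v`_6 = 0, v`_7 = 0 & v`_8 = 0].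

Lemma in_plane_i y z v : in_plane y z v -> in_plane y z (act_row mat_i v).
Proof.
rewrite act_iE; case=> e4 e5 e6 e7 e8; rewrite /in_plane /= e4 e5 e6 e7 e8.
by split; rewrite ?oppr0 //; ring.
Qed.

Lemma in_plane_r y z v : y ^+ 2 + z ^+ 2 = -1 ->
  in_plane y z v -> in_plane y z (act_row mat_r v).
Proof.
move=> cyz; rewrite act_rE; case=> e4 e5 e6 e7 e8; rewrite /in_plane /= e4 e5 e6 e7 e8.
split; rewrite ?mulr0 //.
  by apply: (eq_of_mul (c := - (v`_2 + v`_3)) cyz); ring.
by apply: (eq_of_mul (c := v`_3 - v`_2) cyz); ring.
Qed.

Lemma in_plane_2 y z v : in_plane z y v <-> in_plane y z (act_row mat_2 v).
Proof.
rewrite act_2E /in_plane /=; split; case=> e4 e5 e6 e7 e8; split=> //.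
- by rewrite e4; ring.
- by rewrite e5; ring.
- by rewrite e6 oppr0.
- by apply: (eq_of_mul (c := -1) e4); ring.
- by rewrite e5; ring.
- by apply: (eq_of_mul (c := -1) e6); ring.
Qed.

Lemma in_plane_3 y z v : in_plane (- y) (- z) v <-> in_plane y z (act_row mat_3 v).
Proof.
rewrite act_3E /in_plane /=; split; case=> e4 e5 e6 e7 e8; split=> //.
- by rewrite e5; ring.
- by rewrite e4; ring.
- by apply: (eq_of_mul (c := -1) e5); ring.
- by apply: (eq_of_mul (c := 1) e4); ring.
Qed.

Definition plane0 y z : seq F := vec 0 0 1 0 z (- y) 0 0 0.
Definition plane1 y z : seq F := vec 0 0 0 1 y z 0 0 0.

Definition plane_ws (y z : F) (k : 'I_2) : seq F := nth [::] [:: plane0 y z; plane1 y z] k.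

Definition in_U (y z : F) (v : seq F) : Prop := [/\ v`_0 = 0, v`_1 = 0 & in_plane y z v].

Definition cover_U (y z : F) : graph_over GP83 := model (plane_ws y z).

Lemma comb_U y z l j : (j < 9)%N ->
  (comb (plane_ws y z) l)`_j = (plane0 y z)`_j * l 0 0 + (plane1 y z)`_j * l 1 0.
Proof.
move=> j9; rewrite nth_mkseq // !big_ord_recl big_ord0 addr0 /plane_ws /=.
by congr (_ + _ * l _ 0); apply: val_inj.
Qed.

Lemma U_indep y z l : (forall j, (j < 9)%N -> (comb (plane_ws y z) l)`_j = 0) -> l = 0.
Proof.
move=> E; apply/colP=> k; rewrite mxE.
have := E 2%N isT; have := E 3%N isT; rewrite !comb_U //= !mul0r !mul1r addr0 add0r => l1 l0.
by case: k => [[|[|]] //] k2; [rewrite -l0 | rewrite -l1]; congr (l _ 0); apply: val_inj.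
Qed.

Lemma U_good y z : good_cover p (cover_U y z).
Proof. exact: model_good (@U_indep y z). Qed.

Lemma killed_U y z v : killed (@proj _ (cover_U y z)) v <-> in_U y z v.
Proof.
rewrite (killed_model p_prime p_odd (@U_indep y z)); split=> [[l E] | [e0 e1 [e4 e5 e6 e7 e8]]].
  rewrite /in_U /in_plane !E //; rewrite !comb_U //=.
  by split; [| |split]; ring.
exists (\col_k (if k == 0 then v`_2 else v`_3)) => j j9; rewrite comb_U // !mxE /=.
move: j j9; apply: forall_ord9; rewrite /= e0 e1 e4 e5 e6 e7 e8.
by split; last split; ring.
Qed.

Lemma U_semisymmetric (y z : F) : y ^+ 2 + z ^+ 2 = -1 -> y != z ->
  semisymmetric_module (p := p) (killed (@proj _ (cover_U y z))).
Proof.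
move=> cyz nyz; split.
- by move=> v /killed_U[e0 e1 pv]; apply/killed_U; split; [| |exact: in_plane_i]; rewrite act_iE.
- move=> v /killed_U[e0 e1 pv]; apply/killed_U; split; [| |exact: in_plane_r]; rewrite act_rE /= ?e0 ?e1; ring.
- have D0 : killed (@proj _ (cover_U y z)) (plane0 y z).
    exact: (killed_ws p_prime p_odd (@U_indep y z) 0).
  move/(_ _ D0)/killed_U => [_ _]; rewrite act_2E => -[/= e _ _ _ _].
  case/eqP: nyz; apply/esym; apply: (eq_of_mul (c := -1) e); ring.
have D0 : killed (@proj _ (cover_U y z)) (plane0 y z).
  exact: (killed_ws p_prime p_odd (@U_indep y z) 0).
move/(_ _ D0)/killed_U => [_ _]; rewrite act_3E => -[/= e e' _ _ _].
have y0 : y = 0 by apply: (mulfI (two_neq0 p_prime p_odd)); apply: (eq_of_mul (c := -1) e); ring.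
have z0 : z = 0 by apply: (mulfI (two_neq0 p_prime p_odd)); apply: (eq_of_mul (c := -1) e'); ring.
by case/eqP: nyz; rewrite y0 z0.
Qed.

(* Here [w] is a primitive cube root of unity: [aut_2] preserves the plane but not
   the eigenline of [aut_r] spanned by the first vector, and [aut_3] conversely. *)
Definition line_plane_ws (w y : F) (k : 'I_3) : seq F :=
  nth [::] [:: vec 1 (- w) 0 0 0 0 0 0 0; plane0 y y; plane1 y y] k.

Definition in_E (w y : F) (v : seq F) : Prop := v`_1 = - w * v`_0 /\ in_plane y y v.

Definition cover_E (w y : F) : graph_over GP83 := model (line_plane_ws w y).

Lemma comb_E w y l j : (j < 9)%N -> (comb (line_plane_ws w y) l)`_j =
  (vec 1 (- w) 0 0 0 0 0 0 0)`_j * l 0 0 + (plane0 y y)`_j * l 1 0 + (plane1 y y)`_j * l 2 0.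
Proof.
move=> j9; rewrite nth_mkseq // !big_ord_recl big_ord0 addr0 /line_plane_ws /= addrA.
by congr (_ + _ * l _ 0 + _ * l _ 0); apply: val_inj.
Qed.

Lemma E_indep w y l : (forall j, (j < 9)%N -> (comb (line_plane_ws w y) l)`_j = 0) -> l = 0.
Proof.
move=> E; apply/colP=> k; rewrite mxE.
have := E 0%N isT; have := E 2%N isT; have := E 3%N isT.
rewrite !comb_E //= !mul0r !mul1r !addr0 !add0r => l2 l1 l0.
by case: k => [[|[|[|]]] //] k2; [rewrite -l0 | rewrite -l1 | rewrite -l2];
  congr (l _ 0); apply: val_inj.
Qed.

Lemma E_good w y : good_cover p (cover_E w y).
Proof. exact: model_good (@E_indep w y). Qed.

Lemma killed_E w y v : killed (@proj _ (cover_E w y)) v <-> in_E w y v.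
Proof.
rewrite (killed_model p_prime p_odd (@E_indep w y)); split=> [[l E] | [e1 [e4 e5 e6 e7 e8]]].
  rewrite /in_E /in_plane !E //; rewrite !comb_E //=.
  by split; [|split]; ring.
exists (\col_k (if k == 0 then v`_0 else if k == 1 then v`_2 else v`_3)) => j j9.
rewrite comb_E // !mxE /=.
move: j j9; apply: forall_ord9; rewrite /= e1 e4 e5 e6 e7 e8.
by split; last split; ring.
Qed.

Lemma E_semisymmetric (w y : F) : w ^+ 2 + w + 1 = 0 -> w != 1 -> y ^+ 2 + y ^+ 2 = -1 ->
  semisymmetric_module (p := p) (killed (@proj _ (cover_E w y))).
Proof.
move=> w2 w1 y2; have D0 := killed_ws p_prime p_odd (@E_indep w y).
split.
- by move=> v /killed_E[e1 pv]; apply/killed_E; split; [|exact: in_plane_i]; rewrite act_iE.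
- move=> v /killed_E[e1 pv]; apply/killed_E; split; [|exact: in_plane_r]; rewrite act_rE /= e1.
  by apply: (eq_of_mul (c := 2 * v`_0) w2); ring.
- move/(_ _ (D0 0))/killed_E => [+ _]; rewrite act_2E /= => e.
  have w1' : w = - 1.
    have : (w - 1) * (w + 1) = 0 by apply: (eq_of_mul (c := 1) e); ring.
    by move/eqP; rewrite mulf_eq0 subr_eq0 (negbTE w1) addr_eq0 => /eqP.
  by move/eqP: w2; rewrite w1' sqrrN expr1n subrr add0r oner_eq0.
move/(_ _ (D0 1))/killed_E => [_]; rewrite act_3E => -[/= e _ _ _ _].
have y0 : y = 0 by apply: (mulfI (two_neq0 p_prime p_odd)); apply: (eq_of_mul (c := -1) e); ring.
by move/eqP: y2; rewrite y0 expr0n addr0 eq_sym oppr_eq0 oner_eq0.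
Qed.

End Families.

(** * Classification up to isomorphism and counting *)

Section Classification.
Local Open Scope ring_scope.

Variables (p : nat).
Hypotheses (p_prime : prime p) (p_odd : odd p).
Local Notation F := 'F_p.

Let two := two_neq0 p_prime p_odd.

Lemma eq_of_double (x y : F) : 2 * x = 2 * y -> x = y.
Proof. exact: (mulfI two). Qed.

Lemma plane0_in (y z y' z' : F) : in_plane y z (plane0 y' z') -> y' = y /\ z' = z.
Proof.
case=> /= e4 e5 _ _ _; split; first by apply: (eq_of_mul (c := -1) e5); ring.
by apply: (eq_of_mul (c := 1) e4); ring.
Qed.

Lemma in_plane_span (D : seq F -> Prop) y z a0 a1 v :
  (forall u v, (forall j, (j < 9)%N -> u`_j = v`_j) -> D u -> D v) ->
  (forall s t u v, D u -> D v -> D (lin_row s t u v)) ->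
  D (plane0 y z) -> D (plane1 y z) -> D (vec a0 a1 0 0 0 0 0 0 0) ->
  v`_0 = a0 -> v`_1 = a1 -> in_plane y z v -> D v.
Proof.
move=> Dext Dlin D0 D1 Da e0 e1 [e4 e5 e6 e7 e8].
apply: Dext (Dlin 1 1 _ _ Da (Dlin v`_2 v`_3 _ _ D0 D1)).
apply: forall_ord9; rewrite /= e0 e1 e4 e5 e6 e7 e8.
by split; last split; ring.
Qed.

(** A semisymmetric submodule contains a plane, whose parameters can be read off from its first
    basis vector and must be y and z. The second kind is excluded because the vectors here have no
    A-part. *)
Lemma U_minimal (y z : F) : y ^+ 2 + z ^+ 2 = -1 -> y != z ->
  minimal_semisymmetric_elab_cover p (cover_U y z).
Proof.
move=> cyz nyz; apply: (model_minimal p_prime p_odd (@U_indep p y z)) => //.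
  exact: U_semisymmetric.
move=> D Dext Dlin [Di Dr n2 n3] sub v.
have Uin u : D u -> in_U y z u by move/sub/(killed_U p_prime p_odd).
case: (submodule_dichotomy p_prime p_odd Dext Dlin Di Dr n2 n3).
  case=> y' [z' [_ _ D0 D1]].
  have [_ _ /plane0_in[ey ez]] := Uin _ D0; rewrite /DB {}ey {}ez in D0 D1.
  move/(killed_U p_prime p_odd) => [e0 e1 pv].
  apply: (in_plane_span Dext Dlin D0 D1 _ e0 e1 pv).
  by apply: D_zero => //; exists (plane0 y z).
case=> w [y' [_ _ _ /Uin[/= /eqP]]]; by rewrite oner_eq0.
Qed.

(** The only plane inside has equal parameters, so a semisymmetric submodule is of the second kind,
    with the same w and y. *)
Lemma E_minimal (w y : F) : w ^+ 2 + w + 1 = 0 -> w != 1 -> y ^+ 2 + y ^+ 2 = -1 ->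
  minimal_semisymmetric_elab_cover p (cover_E w y).
Proof.
move=> w2 w1 y2; apply: (model_minimal p_prime p_odd (@E_indep p w y)) => //.
  exact: E_semisymmetric.
move=> D Dext Dlin [Di Dr n2 n3] sub v.
have Ein u : D u -> in_E w y u by move/sub/(killed_E p_prime p_odd).
case: (submodule_dichotomy p_prime p_odd Dext Dlin Di Dr n2 n3).
  case=> y' [z' [_ nyz D0 D1]].
  by have [_ /plane0_in[ey ez]] := Ein _ D0; rewrite ey ez eqxx in nyz.
case=> w' [y' [_ _ _ Dw [D0 D1]]].
have [_ /plane0_in[ey _]] := Ein _ D0; rewrite /DB {}ey in D0 D1.
have [/= ew _] := Ein _ Dw; rewrite mulr1 in ew; rewrite /DA ew in Dw.
move/(killed_E p_prime p_odd) => [e1 pv].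
apply: (in_plane_span (a0 := v`_0) (a1 := - w * v`_0) Dext Dlin D0 D1 _ _ e1 pv) => //.
by apply: (D_eq (D_scale Dext Dlin v`_0 Dw)); ring.
Qed.

Lemma classification (P : graph_over GP83) : minimal_semisymmetric_elab_cover p P ->
  (exists y z, [/\ y ^+ 2 + z ^+ 2 = -1, y != z & isomorphic_over (@cover_U p y z) P]) \/
  (exists w y, [/\ w ^+ 2 + w + 1 = 0, w != 1, y ^+ 2 + y ^+ 2 = -1 &
    isomorphic_over (@cover_E p w y) P]).
Proof.
move=> minP; have [cP elP [ssP _]] := minP; have goodP := elementary_abelian_good cP elP.
have [Di Dr n2 n3] := (semisymmetricE p_prime p_odd goodP).1 ssP.
have [] := submodule_dichotomy p_prime p_odd (@killed_ext p P (@proj _ P))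
  (@killed_lin p P (@proj _ P)) Di Dr n2 n3.
  case=> y [z [cyz nyz D0 D1]]; left; exists y, z; split=> //.
  apply: (model_captures p_prime p_odd (@U_indep p y z)) => //.
    exact: U_semisymmetric.
  by case=> [[|[|]]].
case=> w [y [w2 w1 y2 Dw [D0 D1]]]; right; exists w, y; split=> //.
apply: (model_captures p_prime p_odd (@E_indep p w y)) => //.
  exact: E_semisymmetric.
by case=> [[|[|[|]]]].
Qed.

Let nz1 : ((1 : int)%:~R : F) != 0. Proof. exact: oner_neq0. Qed.

Lemma good_covering (P : graph_over GP83) : good_cover p P -> covering (@proj _ P).
Proof. by case. Qed.

Lemma U_related_2 (y z : F) : related p (cover_U y z) (cover_U z y) aut_2.
Proof.
have cov a b := good_covering (U_good p_prime p_odd a b).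
apply: (related_act p_prime p_odd aut_2_gaut table_of_2 act_check_2 nz1 (cov y z) (cov z y)) => v.
split; case/(killed_U p_prime p_odd) => e0 e1; [move/in_plane_2|move/(in_plane_2 y z v).2] => pv;
  apply/(killed_U p_prime p_odd).
  by split=> //; rewrite act_2E /= ?e0 ?e1 oppr0.
by rewrite act_2E /= in e0 e1; split; [| |exact: pv]; apply: oppr_inj; rewrite oppr0.
Qed.

Lemma U_related_3 (y z : F) : related p (cover_U y z) (cover_U (- y) (- z)) aut_3.
Proof.
have cov a b := good_covering (U_good p_prime p_odd a b).
apply: (related_act p_prime p_odd aut_3_gaut table_of_3 act_check_3 nz1 (cov _ _) (cov _ _)) => v.
split; case/(killed_U p_prime p_odd) => e0 e1; [move/in_plane_3|move/(in_plane_3 y z v).2] => pv;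
  apply/(killed_U p_prime p_odd).
  by split=> //; rewrite act_3E /= ?e0 ?e1 oppr0.
by rewrite act_3E /= in e0 e1; split; [| |exact: pv]; apply: oppr_inj; rewrite oppr0.
Qed.

Lemma E_related_2 (w y : F) : w ^+ 2 + w + 1 = 0 ->
  related p (cover_E w y) (cover_E (w ^+ 2) y) aut_2.
Proof.
move=> w2; have cov a b := good_covering (E_good p_prime p_odd a b).
apply: (related_act p_prime p_odd aut_2_gaut table_of_2 act_check_2 nz1 (cov _ _) (cov _ _)) => v.
have w3 : w ^+ 3 = 1 by apply: (eq_of_mul (c := w - 1) w2); ring.
split; case/(killed_E p_prime p_odd) => e; [move/in_plane_2|move/(in_plane_2 y y v).2] => pv;
  apply/(killed_E p_prime p_odd); split=> //.
  rewrite act_2E /= e; transitivity (- (w ^+ 3) * v`_0); first by rewrite w3; ring.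
  by ring.
rewrite act_2E /= in e; transitivity (w ^+ 3 * v`_1); first by rewrite w3; ring.
by apply: (eq_of_mul (c := - w ^+ 2) e); ring.
Qed.

Lemma E_related_3 (w y : F) : related p (cover_E w y) (cover_E w (- y)) aut_3.
Proof.
have cov a b := good_covering (E_good p_prime p_odd a b).
apply: (related_act p_prime p_odd aut_3_gaut table_of_3 act_check_3 nz1 (cov _ _) (cov _ _)) => v.
split; case/(killed_E p_prime p_odd) => e; [move/in_plane_3|move/(in_plane_3 y y v).2] => pv;
  apply/(killed_E p_prime p_odd); split=> //.
  by rewrite act_3E /= e; ring.
by rewrite act_3E /= in e; apply: (eq_of_mul (c := -1) e); ring.
Qed.

Lemma U_lift_H (y z : F) : y ^+ 2 + z ^+ 2 = -1 -> y != z ->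
  forall h, h \in group_H -> related p (cover_U y z) (cover_U y z) h.
Proof.
move=> cyz nyz h hH; apply: related_lift; apply: group_H_lift hH.
  by apply/(lift_act_i p_prime p_odd (U_good p_prime p_odd y z)); case: (U_semisymmetric p_prime p_odd cyz nyz).
by apply/(lift_act_r p_prime p_odd (U_good p_prime p_odd y z)); case: (U_semisymmetric p_prime p_odd cyz nyz).
Qed.

(** Each coset of H acts on the parameters through exchange and negation, both of which keep (y -
    z)^2. *)
Lemma U_orbit (y z : F) (a : {perm GP83}) : y ^+ 2 + z ^+ 2 = -1 -> y != z -> a \in gaut GP83 ->
  exists y' z', (y' - z') ^+ 2 = (y - z) ^+ 2 /\ related p (cover_U y' z') (cover_U y z) a.
Proof.
move=> cyz nyz /gaut_cosets[h hH []->].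
- by exists y, z; split=> //; apply: U_lift_H.
- exists z, y; split; first by ring.
  by apply: related_trans (U_related_2 z y); apply: U_lift_H => //; rewrite 1?addrC 1?eq_sym.
- exists (- y), (- z); split; first by ring.
  have := U_related_3 (- y) (- z); rewrite !opprK; apply: related_trans.
  by apply: U_lift_H => //; rewrite ?sqrrN ?(inj_eq oppr_inj).
exists (- z), (- y); split; first by ring.
apply: (@related_trans _ _ _ (cover_U (- z) (- y))).
  by apply: U_lift_H => //; rewrite ?sqrrN 1?addrC // (inj_eq oppr_inj) eq_sym.
apply: related_trans (U_related_2 _ _) _.
by have := U_related_3 (- y) (- z); rewrite !opprK.
Qed.

Lemma U_iso_inj (y z y' z' : F) : y ^+ 2 + z ^+ 2 = -1 -> y != z ->
  isomorphic_over (cover_U y' z') (cover_U y z) -> (y' - z') ^+ 2 = (y - z) ^+ 2.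
Proof.
move=> cyz nyz /(iso_related p)[a aX r].
have [y1 [z1 [<- r1]]] := U_orbit cyz nyz aX.
have D0 : killed (@proj _ (cover_U y' z')) (plane0 y' z').
  by apply/(killed_U p_prime p_odd); split; [| |split] => //=; ring.
by have /(killed_U p_prime p_odd)[_ _ /plane0_in[-> ->]] := related_same r r1 D0.
Qed.

Lemma E_U_not_related (w y0 y z : F) a : y ^+ 2 + z ^+ 2 = -1 -> y != z -> a \in gaut GP83 ->
  ~ related p (cover_E w y0) (cover_U y z) a.
Proof.
move=> cyz nyz aX r; have [y1 [z1 [_ r1]]] := U_orbit cyz nyz aX.
have D0 : killed (@proj _ (cover_E w y0)) (vec 1 (- w) 0 0 0 0 0 0 0).
  by apply/(killed_E p_prime p_odd); split; [|split] => //=; ring.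
have /(killed_U p_prime p_odd)[/= /eqP] := related_same r r1 D0.
by rewrite oner_eq0.
Qed.

(** Both equations have at most two roots: t_3 changes the sign of y, and t_2 replaces w by w^2. *)
Lemma E_iso (w y w' y' : F) : w ^+ 2 + w + 1 = 0 -> w' ^+ 2 + w' + 1 = 0 ->
  y ^+ 2 + y ^+ 2 = -1 -> y' ^+ 2 + y' ^+ 2 = -1 -> isomorphic_over (cover_E w y) (cover_E w' y').
Proof.
move=> w2 w2' y2 y2'.
have good a b := E_good p_prime p_odd a b.
have iso_y v : isomorphic_over (cover_E v y) (cover_E v y').
  have : (y' - y) * (y' + y) = 0.
    apply: eq_of_double; transitivity ((y' ^+ 2 + y' ^+ 2) - (y ^+ 2 + y ^+ 2)); first by ring.
    by rewrite y2 y2' subrr mulr0.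
  move/eqP; rewrite mulf_eq0 subr_eq0 addr_eq0 => /orP[] /eqP->.
    exists 1%g; first exact: group1.
    by exists id => [|x]; rewrite ?perm1 //; split=> //; exists id.
  exact: related_iso (good _ _) (good _ _) aut_3_gaut (E_related_3 v y).
apply: (isomorphic_over_trans (iso_y w)).
have : (w' - w) * (w' - w ^+ 2) = 0.
  have w3 : w ^+ 3 = 1 by apply: (eq_of_mul (c := w - 1) w2); ring.
  transitivity ((w' ^+ 2 + w' + 1) - w' * (w ^+ 2 + w + 1) + (w ^+ 3 - 1)); first by ring.
  by rewrite w2 w2' w3 mulr0 subr0 subrr addr0.
move/eqP; rewrite mulf_eq0 !subr_eq0 => /orP[] /eqP->.
  exists 1%g; first exact: group1.
  by exists id => [|x]; rewrite ?perm1 //; split=> //; exists id.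
exact: related_iso (good _ _) (good _ _) aut_2_gaut (E_related_2 y' w2).
Qed.

(** On the circle, (y - z)^2 and (y + z)^2 have sum -2, so both are prescribed. The four choices of
    signs correspond to 1, t_2, t_3 and their product. *)
Lemma U_iso (y z y' z' : F) : y ^+ 2 + z ^+ 2 = -1 -> y' ^+ 2 + z' ^+ 2 = -1 ->
  (y' - z') ^+ 2 = (y - z) ^+ 2 -> isomorphic_over (cover_U y z) (cover_U y' z').
Proof.
move=> cyz cyz' /eqP.
have good a b := U_good p_prime p_odd a b.
have iso2 a b : isomorphic_over (@cover_U p a b) (cover_U b a).
  exact: related_iso (good _ _) (good _ _) aut_2_gaut (U_related_2 a b).
have iso3 a b : isomorphic_over (@cover_U p a b) (cover_U (- a) (- b)).
  exact: related_iso (good _ _) (good _ _) aut_3_gaut (U_related_3 a b).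
have iso1 a b : isomorphic_over (@cover_U p a b) (cover_U a b).
  exists 1%g; first exact: group1.
  by exists id => [|x]; rewrite ?perm1 //; split=> //; exists id.
have /eqP sum : (y' + z') ^+ 2 - (y + z) ^+ 2 == - ((y' - z') ^+ 2 - (y - z) ^+ 2).
  rewrite -subr_eq0; apply/eqP.
  transitivity (2 * (y' ^+ 2 + z' ^+ 2) - 2 * (y ^+ 2 + z ^+ 2)); first by ring.
  by rewrite cyz cyz' subrr.
rewrite -subr_eq0 => /eqP dif; move: sum; rewrite dif oppr0 => sum.
have : ((y' - z') - (y - z)) * ((y' - z') + (y - z)) = 0 by rewrite -[RHS]dif; ring.
have : ((y' + z') - (y + z)) * ((y' + z') + (y + z)) = 0 by rewrite -[RHS]sum; ring.
move=> /eqP; rewrite mulf_eq0 => /orP[] /eqP s /eqP; rewrite mulf_eq0 => /orP[] /eqP d.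
- have [-> ->] : y' = y /\ z' = z.
    split; apply: eq_of_double; apply/eqP; rewrite -subr_eq0; apply/eqP.
      by transitivity (((y' + z') - (y + z)) + ((y' - z') - (y - z))); [ring | rewrite s d addr0].
    by transitivity (((y' + z') - (y + z)) - ((y' - z') - (y - z))); [ring | rewrite s d subr0].
  exact: iso1.
- have [-> ->] : y' = z /\ z' = y.
    split; apply: eq_of_double; apply/eqP; rewrite -subr_eq0; apply/eqP.
      by transitivity (((y' + z') - (y + z)) + ((y' - z') + (y - z))); [ring | rewrite s d addr0].
    by transitivity (((y' + z') - (y + z)) - ((y' - z') + (y - z))); [ring | rewrite s d subr0].
  exact: iso2.
- have [-> ->] : y' = - z /\ z' = - y.
    split; apply: eq_of_double; apply/eqP; rewrite -subr_eq0; apply/eqP.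
      by transitivity (((y' + z') + (y + z)) + ((y' - z') - (y - z))); [ring | rewrite s d addr0].
    by transitivity (((y' + z') + (y + z)) - ((y' - z') - (y - z))); [ring | rewrite s d subr0].
  exact: isomorphic_over_trans (iso2 _ _) (iso3 _ _).
have [-> ->] : y' = - y /\ z' = - z.
  split; apply: eq_of_double; apply/eqP; rewrite -subr_eq0; apply/eqP.
    by transitivity (((y' + z') + (y + z)) + ((y' - z') + (y - z))); [ring | rewrite s d addr0].
  by transitivity (((y' + z') + (y + z)) - ((y' - z') + (y - z))); [ring | rewrite s d subr0].
exact: iso3.
Qed.

Lemma circle_param (s : F) : s \in params p ->
  exists w : F * F, [/\ w.1 ^+ 2 + w.2 ^+ 2 = -1, w.1 != w.2 & (w.1 - w.2) ^+ 2 = s].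
Proof.
rewrite inE => /and3P[nzs /squaresP[u us] /squaresP[v vs]].
have nzu : u != 0 by rewrite -sqrf_eq0 us.
(* The solution of y - z = u and y + z = v. *)
exists (2^-1 * (u + v), 2^-1 * (v - u)) => /=.
have E : 2^-1 * (u + v) - 2^-1 * (v - u) = u by field.
split; [| by rewrite -subr_eq0 E | by rewrite E].
transitivity (2^-1 * (u ^+ 2 + v ^+ 2)); first by field.
by rewrite us vs; field.
Qed.

Lemma param_circle (y z : F) : y ^+ 2 + z ^+ 2 = -1 -> y != z -> (y - z) ^+ 2 \in params p.
Proof.
move=> cyz nyz; rewrite inE sqrf_eq0 subr_eq0 nyz /=; apply/andP; split.
  by apply/squaresP; exists (y - z).
apply/squaresP; exists (y + z); apply: (eq_of_mul (c := 2) cyz); ring.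
Qed.

Lemma extra_iff : (p %% 3 == 1)%N && (p %% 8 \in [:: 1; 3])%N <->
  exists w y : F, [/\ w ^+ 2 + w + 1 = 0, w != 1 & y ^+ 2 + y ^+ 2 = -1].
Proof.
rewrite (neg2_square p_prime p_odd); split.
  case/andP=> /eqP/(Fp_cube_root p_prime p_odd)[w [w2 w1]] /squaresP[u u2].
  exists w, (2^-1 * u); split=> //.
  transitivity (2^-1 * u ^+ 2); first by field.
  by rewrite u2; field.
case=> w [y [w2 w1 y2]]; apply/andP; split.
  by apply/eqP/(Fp_cube_root p_prime p_odd); exists w.
by apply/squaresP; exists (2 * y); apply: (eq_of_mul (c := 2) y2); ring.
Qed.

Lemma count_odd : num_iso_classes (minimal_semisymmetric_elab_cover p)
  (((p %% 3 == 1) && (p %% 8 \in [:: 1; 3])) + #|params p|)%N.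
Proof.
have /fin_all_exists[f fP] (i : 'I_#|params p|) := circle_param (enum_valP i).
pose U i := cover_U (f i).1 (f i).2.
have Umin i : minimal_semisymmetric_elab_cover p (U i).
  by case: (fP i) => f1 f2 _; apply: U_minimal.
have Uinj i j : isomorphic_over (U i) (U j) -> i = j.
  have [_ _ fi] := fP i; have [fj1 fj2 fj] := fP j => iso.
  by apply: enum_val_inj; rewrite -fi -fj; apply: U_iso_inj iso.
have Uall (y z : F) P : y ^+ 2 + z ^+ 2 = -1 -> y != z -> isomorphic_over (cover_U y z) P ->
    exists i, isomorphic_over (U i) P.
  move=> cyz nyz iso; have sE := param_circle cyz nyz.
  exists (enum_rank_in sE ((y - z) ^+ 2)); apply: isomorphic_over_trans iso.
  case: (fP (enum_rank_in sE ((y - z) ^+ 2))) => f1 f2 f3.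
  by apply: U_iso; rewrite // f3 enum_rankK_in.
case: (boolP (_ && _)) => [/extra_iff[w [y [w2 w1 y2]]] | /negP nextra]; last first.
  exists U; split=> // P /classification[[y [z [cyz nyz iso]]] | [w [y [w2 w1 y2 _]]]].
    exact: Uall iso.
  by case: nextra; apply/extra_iff; exists w, y.
exists (fun i : 'I_(1 + #|params p|) => if unlift ord0 i is Some j then U j else cover_E w y).
have nEU j a : a \in gaut GP83 -> ~ related p (cover_E w y) (U j) a.
  by have [f1 f2 _] := fP j => aX; apply: E_U_not_related.
split=> [i | i j | P].
- by case: unliftP => [j _ | _]; [exact: Umin | exact: E_minimal].
- case: (unliftP ord0 i) => [i' -> | ->]; case: (unliftP ord0 j) => [j' -> | ->] //.
  + by move/Uinj->.
  + case/(iso_related p) => a aX /related_sym.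
    by move/nEU; case; rewrite groupV.
  + by case/(iso_related p) => a aX /nEU; case.
case/classification=> [[y' [z' [cyz nyz iso]]] | [w' [y' [w2' w1' y2' iso]]]].
  by have [i isoi] := Uall _ _ _ cyz nyz iso; exists (lift ord0 i); rewrite liftK.
exists ord0; rewrite unlift_none; apply: isomorphic_over_trans iso.
exact: E_iso.
Qed.

End Classification.

Theorem mainTheorem1 (p : nat) (p_prime : prime p) :
  let n_p_is := num_iso_classes (minimal_semisymmetric_elab_cover p) in
  [/\ p = 2 -> n_p_is 0,
      p %% 24 \in [:: 5; 9; 13; 17; 21] -> n_p_is ((p - 1) %/ 4),
      p %% 24 = 1 -> n_p_is (1 + (p - 1) %/ 4),
      p %% 24 \in [:: 3; 7; 11; 15; 23] -> n_p_is ((p + 1) %/ 4) &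
      p %% 24 = 19 -> n_p_is (1 + (p + 1) %/ 4)].
Proof.
move=> n_p_is.
(* The residue mod 24 acts through p mod 4 for the circle, p mod 3 for the cube roots of unity and p
   mod 8 for the square root of -2; the extra class belongs to the residues 1 and 19. *)
have count n m : odd p -> p %% 4 = m -> n = ((p %% 3 == 1) && (p %% 8 \in [:: 1; 3])) +
    (if m == 1 then p - 1 else p + 1) %/ 4 -> n_p_is n.
  move=> p_odd p4 ->; have := count_odd p_prime p_odd.
  have := card_params p_prime p_odd; rewrite p4 => E.
  by have -> : #|params p| = (if m == 1 then p - 1 else p + 1) %/ 4 by rewrite -E mulKn.
split.
- move=> p2; subst p; exists (fun i : 'I_0 => GraphOver (@id GP83)).
  split=> [[]|[]|P] // [cP elP [ssP _]].
  by case: (no_semisymmetric_2 (elementary_abelian_good cP elP) ssP).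
- move=> pm; apply: (count _ 1); move: pm; rewrite ?inE /=; lia.
- by move=> pm; apply: (count _ 1); rewrite ?inE /=; lia.
- move=> pm; apply: (count _ 3); move: pm; rewrite ?inE /=; lia.
- by move=> pm; apply: (count _ 3); rewrite ?inE /=; lia.
Qed.
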